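(* Let $A$ and $B$ be rings, $V$ an $A$-$B$-bimodule, $U$ a $B$-$A$-bimodule, $\Lambda_{(0,0)}=\begin{pmatrix}A&V\\ U&B\end{pmatrix}$ the Morita ring with zero bimodule homomorphisms, $n\geqslant 1$ an integer, $\mathcal{C}_1,\mathcal{C}_2$ classes of left $A$-modules and $\mathcal{D}_1,\mathcal{D}_2$ classes of left $B$-modules. (1) Let $(\mathcal{C}_1,\mathcal{C}_2)$ and $(\mathcal{D}_1,\mathcal{D}_2)$ be left $n$-cotorsion pairs in $A$-$\mathrm{Mod}$ and $B$-$\mathrm{Mod}$, respectively. Assume that $\mathrm{Ext}_A^i(V,\mathcal{C}_2)=0=\mathrm{Ext}_B^i(U,\mathcal{D}_2)$ for each $1\leqslant i\leqslant n$, $\mathrm{Ext}_A^1(\mathrm{Hom}_B(U,(\mathcal{D}_2)_{n-1}^{\wedge}),(\mathcal{C}_2)_{n-1}^{\wedge})=0=\mathrm{Ext}_B^1(\mathrm{Hom}_A(V,(\mathcal{C}_2)_{n-1}^{\wedge}),(\mathcal{D}_2)_{n-1}^{\wedge})$, $\mathfrak{U}_{\mathcal{D}_1}^{\mathcal{C}_1}$ is a resolving class, and $(\mathfrak{J}_{\mathcal{D}_2}^{\mathcal{C}_2})_{n-1}^{\wedge}$ is closed under extensions. Then $(\mathfrak{U}_{\mathcal{D}_1}^{\mathcal{C}_1},\mathfrak{J}_{\mathcal{D}_2}^{\mathcal{C}_2})$ is a hereditary left $n$-cotorsion pair in $\Lambda_{(0,0)}$-$\mathrm{Mod}$. (2)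 Let $(\mathcal{C}_1,\mathcal{C}_2)$ and $(\mathcal{D}_1,\mathcal{D}_2)$ be right $n$-cotorsion pairs in $A$-$\mathrm{Mod}$ and $B$-$\mathrm{Mod}$, respectively. Assume that $\mathrm{Tor}_i^A(U,\mathcal{C}_1)=0=\mathrm{Tor}_i^B(V,\mathcal{D}_1)$ for each $1\leqslant i\leqslant n$, $\mathrm{Ext}_A^1((\mathcal{C}_1)_{n-1}^{\vee},V\otimes_B(\mathcal{D}_1)_{n-1}^{\vee})=0=\mathrm{Ext}_B^1((\mathcal{D}_1)_{n-1}^{\vee},U\otimes_A(\mathcal{C}_1)_{n-1}^{\vee})$, $\mathfrak{U}_{\mathcal{D}_2}^{\mathcal{C}_2}$ is a coresolving class, and $(\mathfrak{B}_{\mathcal{D}_1}^{\mathcal{C}_1})_{n-1}^{\vee}$ is closed under extensions. Then $(\mathfrak{B}_{\mathcal{D}_1}^{\mathcal{C}_1},\mathfrak{U}_{\mathcal{D}_2}^{\mathcal{C}_2})$ is a hereditary right $n$-cotorsion pair in $\Lambda_{(0,0)}$-$\mathrm{Mod}$.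
   Context: Rings are associative with identity, modules are unitary, and $S$-$\mathrm{Mod}$ is the category of left $S$-modules. Classes of modules contain $0$ and are closed under isomorphisms. Vanishing statements with classes as arguments mean vanishing for all members of the classes (chosen independently). $\Lambda_{(0,0)}$ consists of matrices $\begin{pmatrix}a&v\\ u&b\end{pmatrix}$ with entrywise addition and $\begin{pmatrix}a_1&v_1\\ u_1&b_1\end{pmatrix}\begin{pmatrix}a_2&v_2\\ u_2&b_2\end{pmatrix}=\begin{pmatrix}a_1a_2&a_1v_2+v_1b_2\\ u_1a_2+b_1u_2&b_1b_2\end{pmatrix}$. A left $\Lambda_{(0,0)}$-module is identified with a tuple $(X,Y,f,g)$, where $X\in A$-$\mathrm{Mod}$, $Y\in B$-$\mathrm{Mod}$, $f:U\otimes_A X\to Y$ is $B$-linear, $g:V\otimes_B Y\to X$ is $A$-linear, $g(V\otimes_B f)=0$ and $f(U\otimes_A g)=0$; equivalently (by adjunction) with a tuple $[X,Y,f,g]$, where $f:X\to\mathrm{Hom}_B(U,Y)$ is $A$-linear, $g:Y\to\mathrm{Hom}_A(V,X)$ is $B$-linear, $\mathrm{Hom}_B(U,g)f=0$ and $\mathrm{Hom}_A(V,f)g=0$. Morphisms are pairs of linear maps compatible with the structure maps; exactness is componentwise. For a class $\mathcal{C}$ of left $A$-modules and a class $\mathcal{D}$ of left $B$-modules: $\mathfrak{U}_{\mathcal{D}}^{\mathcal{C}}$ is the class of $(X,Y,f,g)$ with $X\in\mathcal{C}$, $Y\in\mathcal{D}$; $\mathfrak{B}_{\mathcal{D}}^{\mathcal{C}}$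 is the class of $(X,Y,f,g)$ with $\mathrm{Coker}\,f\in\mathcal{D}$, $\mathrm{Coker}\,g\in\mathcal{C}$, and $V\otimes_B U\otimes_A X\xrightarrow{V\otimes_B f}V\otimes_B Y\xrightarrow{g}X$ and $U\otimes_A V\otimes_B Y\xrightarrow{U\otimes_A g}U\otimes_A X\xrightarrow{f}Y$ exact; $\mathfrak{J}_{\mathcal{D}}^{\mathcal{C}}$ is the class of $[X,Y,f,g]$ with $\mathrm{Ker}\,f\in\mathcal{C}$, $\mathrm{Ker}\,g\in\mathcal{D}$, and $X\xrightarrow{f}\mathrm{Hom}_B(U,Y)\xrightarrow{\mathrm{Hom}_B(U,g)}\mathrm{Hom}_B(U,\mathrm{Hom}_A(V,X))$ and $Y\xrightarrow{g}\mathrm{Hom}_A(V,X)\xrightarrow{\mathrm{Hom}_A(V,f)}\mathrm{Hom}_A(V,\mathrm{Hom}_B(U,Y))$ exact. A class is resolving (resp. coresolving) if it is closed under extensions and kernels of epimorphisms (resp. extensions and cokernels of monomorphisms). For a class $\mathcal{C}$ of objects of an abelian category and $m\geqslant 0$: $\mathcal{C}_m^{\wedge}$ is the class of objects $A$ admitting an exact sequence $0\to C_k\to\cdots\to C_0\to A\to 0$ with all $C_i\in\mathcal{C}$ and some $k\leqslant m$; $\mathcal{C}_m^{\vee}$ is the class of objects $A$ admitting an exact sequence $0\to A\to C^0\to\cdots\to C^k\to 0$ with all $C^i\in\mathcal{C}$ and some $k\leqslant m$. A pair $(\mathcal{C},\mathcal{D})$ of classes of objects in an abelian category is a left $n$-cotorsion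 pair if (i) $\mathcal{C}$ is closed under direct summands, (ii) $\mathrm{Ext}^i(C,D)=0$ for all $1\leqslant i\leqslant n$, $C\in\mathcal{C}$, $D\in\mathcal{D}$, and (iii) every object $A$ admits a short exact sequence $0\to K\to C\to A\to 0$ with $C\in\mathcal{C}$, $K\in\mathcal{D}_{n-1}^{\wedge}$. It is a right $n$-cotorsion pair if (i') $\mathcal{D}$ is closed under direct summands, (ii) holds, and (iii') every object $A$ admits a short exact sequence $0\to A\to D\to K\to 0$ with $D\in\mathcal{D}$, $K\in\mathcal{C}_{n-1}^{\vee}$. A left or right $n$-cotorsion pair $(\mathcal{C},\mathcal{D})$ is hereditary if $\mathrm{Ext}^{n+1}(C,D)=0$ for all $C\in\mathcal{C}$, $D\in\mathcal{D}$. *)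

(* Defs.v *)
From HB Require Import structures.
From mathcomp Require Import all_boot all_order all_algebra generic_quotient.
From mathcomp Require Import boolp.

Set Implicit Arguments.
Unset Strict Implicit.
Unset Printing Implicit Defensive.

Import GRing.Theory.
Local Open Scope ring_scope.
Local Open Scope quotient_scope.

(* Exactness at the middle term of X -> Y -> Z, for functions into pointed
   (additive) types. *)
Definition exact_at (X Y : Type) (Z : nmodType) (f : X -> Y) (g : Y -> Z) :=
  forall y, g y = 0 <-> exists x, f x = y.

Definition surj (X Y : Type) (f : X -> Y) := forall y, exists x, f x = y.

Definition zero_module (R : pzRingType) (M : lmodType R) := forall x : M, x = 0.

Definition isomorphic (R : pzRingType) (M N : lmodType R) :=
  exists f : {linear M -> N}, bijective f.

Definition short_exact (R : pzRingType) (K M N : lmodType R)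
    (i : {linear K -> M}) (p : {linear M -> N}) :=
  [/\ injective i, exact_at i p & surj p].

Definition modclass (R : pzRingType) := lmodType R -> Prop.

Definition is_class (R : pzRingType) (C : modclass R) :=
  (forall M, zero_module M -> C M) /\
  (forall M N, isomorphic M N -> C M -> C N).

Definition extension_closed (R : pzRingType) (C : modclass R) :=
  forall (K M N : lmodType R) (i : {linear K -> M}) (p : {linear M -> N}),
    short_exact i p -> C K -> C N -> C M.

Definition epi_kernel_closed (R : pzRingType) (C : modclass R) :=
  forall (K M N : lmodType R) (i : {linear K -> M}) (p : {linear M -> N}),
    short_exact i p -> C M -> C N -> C K.

Definition mono_cokernel_closed (R : pzRingType) (C : modclass R) :=
  forall (K M N : lmodType R) (i : {linear K -> M}) (p : {linear M -> N}),
    short_exact i p -> C K -> C M -> C N.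

Definition resolving (R : pzRingType) (C : modclass R) :=
  extension_closed C /\ epi_kernel_closed C.

Definition coresolving (R : pzRingType) (C : modclass R) :=
  extension_closed C /\ mono_cokernel_closed C.

Definition summand_closed (R : pzRingType) (C : modclass R) :=
  forall M N N' : lmodType R,
    isomorphic M (N * N')%type -> C M -> C N.

(* Ker f belongs to C.  Kernels and cokernels are only defined up to
   isomorphism, and C is meant to be closed under isomorphisms. *)
Definition ker_in (R : pzRingType) (C : modclass R) (X Y : lmodType R)
    (f : {linear X -> Y}) :=
  exists (K : lmodType R) (k : {linear K -> X}),
    [/\ injective k, exact_at k f & C K].

Definition coker_in (R : pzRingType) (C : modclass R) (X Y : lmodType R)
    (f : {linear X -> Y}) :=
  exists (Q : lmodType R) (q : {linear Y -> Q}),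
    [/\ exact_at f q, surj q & C Q].

(* ... -> P 2 -> P 1 -> P 0 -> M -> 0 *)
Record resolution (R : pzRingType) (M : lmodType R) := Resolution {
  res_mod :> nat -> lmodType R;
  res_d : forall i, {linear res_mod i.+1 -> res_mod i};
  res_aug : {linear res_mod 0%N -> M};
  res_aug_surj : surj res_aug;
  res_exact0 : exact_at (res_d 0) res_aug;
  res_exactS : forall i, exact_at (res_d i.+1) (res_d i)
}.

(* 0 -> M -> I 0 -> I 1 -> I 2 -> ... *)
Record coresolution (R : pzRingType) (M : lmodType R) := Coresolution {
  cores_mod :> nat -> lmodType R;
  cores_d : forall i, {linear cores_mod i -> cores_mod i.+1};
  cores_aug : {linear M -> cores_mod 0%N};
  cores_aug_inj : injective cores_aug;
  cores_exact0 : exact_at cores_aug (cores_d 0);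
  cores_exactS : forall i, exact_at (cores_d i) (cores_d i.+1)
}.

(* A finite sequence 0 -> C_k -> ... -> C_0 -> M -> 0 is a resolution whose
   terms of index > k vanish. *)
Definition finite_res_class (R : pzRingType) (C : modclass R) (m : nat) :
    modclass R := fun M =>
  exists (P : resolution M) (k : nat),
    [/\ (k <= m)%N, forall i, (i <= k)%N -> C (P i)
      & forall i, (k < i)%N -> zero_module (P i)].

Definition finite_cores_class (R : pzRingType) (C : modclass R) (m : nat) :
    modclass R := fun M =>
  exists (I : coresolution M) (k : nat),
    [/\ (k <= m)%N, forall i, (i <= k)%N -> C (I i)
      & forall i, (k < i)%N -> zero_module (I i)].

Definition projective (R : pzRingType) (P : lmodType R) :=
  forall (M N : lmodType R) (p : {linear M -> N}) (h : {linear P -> N}),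
    surj p -> exists k : {linear P -> M}, forall x, p (k x) = h x.

(* Ext_R^i(M, N) = 0, where Ext_R^i(M, N) is the i-th cohomology of Hom_R(P, N)
   for a projective resolution P of M; it does not depend on P. *)
Definition Ext_zero (R : pzRingType) (i : nat) (M N : lmodType R) :=
  forall P : resolution M, (forall j, projective (P j)) ->
  forall phi : {linear P i -> N}, (forall x, phi (res_d P i x) = 0) ->
  match i return {linear P i -> N} -> Prop with
  | 0 => fun phi => forall x, phi x = 0
  | j.+1 => fun phi =>
      exists psi : {linear P j -> N}, forall x, psi (res_d P j x) = phi x
  end phi.

Definition Ext_zero_cc (R : pzRingType) (i : nat) (C D : modclass R) :=
  forall M N : lmodType R, C M -> D N -> Ext_zero i M N.

Definition left_cotorsion_pair (R : pzRingType) (n : nat) (C D : modclass R) :=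
  [/\ summand_closed C,
      forall i, (1 <= i <= n)%N -> Ext_zero_cc i C D
    & forall M : lmodType R, exists (K X : lmodType R)
        (i : {linear K -> X}) (p : {linear X -> M}),
        [/\ short_exact i p, C X & finite_res_class D n.-1 K]].

Definition right_cotorsion_pair (R : pzRingType) (n : nat) (C D : modclass R) :=
  [/\ summand_closed D,
      forall i, (1 <= i <= n)%N -> Ext_zero_cc i C D
    & forall M : lmodType R, exists (Y K : lmodType R)
        (i : {linear M -> Y}) (p : {linear Y -> K}),
        [/\ short_exact i p, D Y & finite_cores_class C n.-1 K]].

Definition hereditary_left_cotorsion_pair
    (R : pzRingType) (n : nat) (C D : modclass R) :=
  left_cotorsion_pair n C D /\ Ext_zero_cc n.+1 C D.

Definition hereditary_right_cotorsion_pair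
    (R : pzRingType) (n : nat) (C D : modclass R) :=
  right_cotorsion_pair n C D /\ Ext_zero_cc n.+1 C D.

Record bimodule (A B : pzRingType) := Bimodule {
  bim_mod :> lmodType A;
  ract : bim_mod -> B -> bim_mod;
  ractDl : forall u v b, ract (u + v) b = ract u b + ract v b;
  ractDr : forall u b c, ract u (b + c) = ract u b + ract u c;
  ractA : forall u b c, ract (ract u b) c = ract u (b * c);
  ract1 : forall u, ract u 1 = u;
  ractZ : forall a u b, ract (a *: u) b = a *: ract u b
}.

Lemma ract0 (A B : pzRingType) (U : bimodule A B) b : ract (0 : U) b = 0.
Proof. by apply: (addrI (ract (0 : U) b)); rewrite -ractDl !addr0. Qed.

(* Hom_B(U, Y) is a left A-module by (a h)(u) = h (u a). *)

Lemma linear_ext (R : pzRingType) (X Y : lmodType R) (f g : {linear X -> Y}) :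
  f =1 g -> f = g.
Proof.
case: f g => [f [[a] [b]]] [g [[a'] [b']]] /= /funext efg.
subst g.
by rewrite (Prop_irrelevance a a') (Prop_irrelevance b b').
Qed.

Definition bimHom (B A : pzRingType) (U : bimodule B A) (Y : lmodType B) : Type :=
  {linear U -> Y}.

Section HomModule.
Variables (B A : pzRingType) (U : bimodule B A) (Y : lmodType B).
Implicit Types h k : bimHom U Y.

HB.instance Definition _ := gen_eqMixin (bimHom U Y).
HB.instance Definition _ := gen_choiceMixin (bimHom U Y).

Definition bimHom_app h : U -> Y := let f : {linear U -> Y} := h in f.

Lemma bimHom_ext h k : bimHom_app h =1 bimHom_app k -> h = k.
Proof. exact: linear_ext. Qed.

Definition hom_zero_fun (u : U) : Y := 0.
Fact hom_zero_linear : linear hom_zero_fun.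
Proof. by move=> a u v; rewrite /hom_zero_fun scaler0 addr0. Qed.
HB.instance Definition _ :=
  GRing.isLinear.Build B U Y *:%R hom_zero_fun hom_zero_linear.

Definition hom_opp_fun h (u : U) : Y := - bimHom_app h u.
Fact hom_opp_linear h : linear (hom_opp_fun h).
Proof. by move=> a u v; rewrite /hom_opp_fun /bimHom_app linearP opprD scalerN. Qed.
HB.instance Definition _ h :=
  GRing.isLinear.Build B U Y *:%R (hom_opp_fun h) (hom_opp_linear h).

Definition hom_add_fun h k (u : U) : Y := bimHom_app h u + bimHom_app k u.
Fact hom_add_linear h k : linear (hom_add_fun h k).
Proof.
by move=> a u v; rewrite /hom_add_fun /bimHom_app !linearP scalerDr addrACA.
Qed.
HB.instance Definition _ h k :=
  GRing.isLinear.Build B U Y *:%R (hom_add_fun h k) (hom_add_linear h k).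

Definition hom_scale_fun (a : A) h (u : U) : Y := bimHom_app h (ract u a).
Fact hom_scale_linear a h : linear (hom_scale_fun a h).
Proof.
by move=> b u v; rewrite /hom_scale_fun /bimHom_app ractDl ractZ linearP.
Qed.
HB.instance Definition _ a h :=
  GRing.isLinear.Build B U Y *:%R (hom_scale_fun a h) (hom_scale_linear a h).

Definition hom_zero : bimHom U Y := GRing.Linear.clone _ _ _ _ hom_zero_fun _.
Definition hom_opp h : bimHom U Y := GRing.Linear.clone _ _ _ _ (hom_opp_fun h) _.
Definition hom_add h k : bimHom U Y :=
  GRing.Linear.clone _ _ _ _ (hom_add_fun h k) _.
Definition hom_scale a h : bimHom U Y :=
  GRing.Linear.clone _ _ _ _ (hom_scale_fun a h) _.

Fact hom_addA : associative hom_add.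
Proof. by move=> h k l; apply: bimHom_ext => u; apply: addrA. Qed.
Fact hom_addC : commutative hom_add.
Proof. by move=> h k; apply: bimHom_ext => u; apply: addrC. Qed.
Fact hom_add0 : left_id hom_zero hom_add.
Proof. by move=> h; apply: bimHom_ext => u; apply: add0r. Qed.
Fact hom_addN : left_inverse hom_zero hom_opp hom_add.
Proof. by move=> h; apply: bimHom_ext => u; apply: addNr. Qed.
HB.instance Definition _ :=
  GRing.isZmodule.Build (bimHom U Y) hom_addA hom_addC hom_add0 hom_addN.

Fact hom_scaleA a b h : hom_scale a (hom_scale b h) = hom_scale (a * b) h.
Proof.
by apply: bimHom_ext => u; congr (bimHom_app h _); rewrite ractA.
Qed.
Fact hom_scale1 : left_id 1 hom_scale.
Proof. by move=> h; apply: bimHom_ext => u; congr (bimHom_app h _); rewrite ract1. Qed.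
Fact hom_scaleDr : right_distributive hom_scale +%R.
Proof. by move=> a h k; apply: bimHom_ext. Qed.
Fact hom_scaleDl h : {morph hom_scale^~ h : a b / a + b}.
Proof.
move=> a b; apply: bimHom_ext => u.
rewrite /bimHom_app /= /hom_scale_fun /bimHom_app ractDr.
exact: (raddfD (h : {linear U -> Y})).
Qed.
HB.instance Definition _ := GRing.Zmodule_isLmodule.Build A (bimHom U Y)
  hom_scaleA hom_scale1 hom_scaleDr hom_scaleDl.

End HomModule.

Section HomFunctor.
Variables (B A : pzRingType) (U : bimodule B A) (Y Y' : lmodType B).
Variable f : {linear Y -> Y'}.

Definition hom_map (h : bimHom U Y) : bimHom U Y' :=
  GRing.Linear.clone _ _ _ _ (f \o bimHom_app h) _.

End HomFunctor.

Section TensorRel.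
Variables (B A : pzRingType) (U : bimodule B A) (X : lmodType A).

(* U (x)_A X is the group of formal sums of pure tensors modulo the usual
   relations.  A word [:: (u_1, x_1); ...; (u_k, x_k)] stands for the formal sum of the
   u_i (x) x_i.  Words need no signs, since - (u (x) x) = (- u) (x) x. *)
Inductive tensor_rel : seq (U * X) -> seq (U * X) -> Prop :=
| TensorRefl w : tensor_rel w w
| TensorSym w1 w2 : tensor_rel w1 w2 -> tensor_rel w2 w1
| TensorTrans w1 w2 w3 :
    tensor_rel w1 w2 -> tensor_rel w2 w3 -> tensor_rel w1 w3
| TensorCat w1 w1' w2 w2' : tensor_rel w1 w1' -> tensor_rel w2 w2' ->
    tensor_rel (w1 ++ w2) (w1' ++ w2')
| TensorCatC w1 w2 : tensor_rel (w1 ++ w2) (w2 ++ w1)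
| Tensor0 x : tensor_rel [:: (0, x)] [::]
| TensorDl u u' x : tensor_rel [:: (u + u', x)] [:: (u, x); (u', x)]
| TensorDr u x x' : tensor_rel [:: (u, x + x')] [:: (u, x); (u, x')]
| TensorBal u a x : tensor_rel [:: (ract u a, x)] [:: (u, a *: x)].

Definition tensor_eqv : rel (seq (U * X)) := fun w w' => `[< tensor_rel w w' >].

Fact tensor_eqv_refl : reflexive tensor_eqv.
Proof. by move=> w; apply/asboolP; apply: TensorRefl. Qed.
Fact tensor_eqv_sym : symmetric tensor_eqv.
Proof. by move=> w w'; apply/asboolP/asboolP; apply: TensorSym. Qed.
Fact tensor_eqv_trans : transitive tensor_eqv.
Proof.
move=> w2 w1 w3 /asboolP r12 /asboolP r23.
by apply/asboolP; apply: TensorTrans r12 r23.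
Qed.
Canonical tensor_equiv :=
  EquivRel tensor_eqv tensor_eqv_refl tensor_eqv_sym tensor_eqv_trans.

Definition tensor : Type := {eq_quot tensor_equiv}.

HB.instance Definition _ := Quotient.on tensor.
HB.instance Definition _ := Choice.on tensor.

Definition tpi (w : seq (U * X)) : tensor := \pi_tensor w.
Definition tens (u : U) (x : X) : tensor := tpi [:: (u, x)].

Lemma tpiP w w' : tpi w = tpi w' <-> tensor_rel w w'.
Proof.
split=> [/eqmodP /asboolP //|r].
by apply/eqmodP; apply/asboolP.
Qed.

Lemma tpi_repr (t : tensor) : tpi (repr t) = t.
Proof. exact: reprK. Qed.

Lemma repr_tpi w : tensor_rel (repr (tpi w)) w.
Proof. by apply/tpiP; rewrite tpi_repr. Qed.

Definition tensor_zero : tensor := tpi [::].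
Definition tensor_add (s t : tensor) : tensor := tpi (repr s ++ repr t).
Definition opp_word (w : seq (U * X)) := [seq (- p.1, p.2) | p <- w].
Definition tensor_opp (t : tensor) : tensor := tpi (opp_word (repr t)).
Definition scale_word (b : B) (w : seq (U * X)) := [seq (b *: p.1, p.2) | p <- w].
Definition tensor_scale b (t : tensor) : tensor := tpi (scale_word b (repr t)).

Lemma tensor_addE w w' : tensor_add (tpi w) (tpi w') = tpi (w ++ w').
Proof. by apply/tpiP/TensorCat; apply: repr_tpi. Qed.

Fact opp_word_rel w w' :
  tensor_rel w w' -> tensor_rel (opp_word w) (opp_word w').
Proof.
elim=> {w w'} /=.
- by move=> w; apply: TensorRefl.
- by move=> w w' _; apply: TensorSym.
- by move=> w1 w2 w3 _ r12 _; apply: TensorTrans r12.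
- by move=> *; rewrite /opp_word !map_cat; apply: TensorCat.
- by move=> *; rewrite /opp_word !map_cat; apply: TensorCatC.
- by move=> x; rewrite oppr0; apply: Tensor0.
- by move=> u u' x; rewrite opprD; apply: TensorDl.
- by move=> u x x'; apply: TensorDr.
- move=> u a x; have -> : - ract u a = ract (- u) a; last exact: TensorBal.
  by apply: (addrI (ract u a)); rewrite -ractDl !subrr ract0.
Qed.

Fact scale_word_rel b w w' :
  tensor_rel w w' -> tensor_rel (scale_word b w) (scale_word b w').
Proof.
elim=> {w w'} /=.
- by move=> w; apply: TensorRefl.
- by move=> w w' _; apply: TensorSym.
- by move=> w1 w2 w3 _ r12 _; apply: TensorTrans r12.
- by move=> *; rewrite /scale_word !map_cat; apply: TensorCat.
- by move=> *; rewrite /scale_word !map_cat; apply: TensorCatC.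
- by move=> x; rewrite scaler0; apply: Tensor0.
- by move=> u u' x; rewrite scalerDr; apply: TensorDl.
- by move=> u x x'; apply: TensorDr.
- by move=> u a x; rewrite -ractZ; apply: TensorBal.
Qed.

Lemma tensor_oppE w : tensor_opp (tpi w) = tpi (opp_word w).
Proof. by apply/tpiP/opp_word_rel/repr_tpi. Qed.
Lemma tensor_scaleE b w : tensor_scale b (tpi w) = tpi (scale_word b w).
Proof. by apply/tpiP/scale_word_rel/repr_tpi. Qed.

Fact tensor_addA : associative tensor_add.
Proof.
move=> r s t; rewrite -(tpi_repr r) -(tpi_repr s) -(tpi_repr t).
by rewrite !tensor_addE catA.
Qed.
Fact tensor_addC : commutative tensor_add.
Proof. by move=> s t; apply/tpiP/TensorCatC. Qed.
Fact tensor_add0 : left_id tensor_zero tensor_add.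
Proof. by move=> t; rewrite -(tpi_repr t) tensor_addE. Qed.
Fact tensor_addN : left_inverse tensor_zero tensor_opp tensor_add.
Proof.
move=> t; rewrite -(tpi_repr t) tensor_oppE tensor_addE; apply/tpiP.
elim: (repr t) => [|[u x] w IHw] /=; first exact: TensorRefl.
rewrite -[_ :: w]cat1s -[_ :: (_ ++ _)]cat1s.
apply: (TensorTrans (w2 := [:: (- u, x)] ++ ([:: (u, x)] ++ opp_word w ++ w))).
  apply: TensorCat; first exact: TensorRefl.
  rewrite !catA; apply: TensorCat; last exact: TensorRefl.
  exact: TensorCatC.
rewrite catA -[[::]]/([::] ++ [::]); apply: TensorCat => //=.
apply: TensorTrans (TensorSym (TensorDl (- u) u x)) _.
by rewrite addNr; apply: Tensor0.
Qed.
HB.instance Definition _ := GRing.isZmodule.Build tensor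
  tensor_addA tensor_addC tensor_add0 tensor_addN.

Fact tensor_scaleA a b t :
  tensor_scale a (tensor_scale b t) = tensor_scale (a * b) t.
Proof.
rewrite -(tpi_repr t) !tensor_scaleE /scale_word -map_comp.
by congr tpi; apply: eq_map => p /=; rewrite scalerA.
Qed.
Fact tensor_scale1 : left_id 1 tensor_scale.
Proof.
move=> t; rewrite -{2}(tpi_repr t); congr tpi.
by rewrite /scale_word -[RHS]map_id; apply: eq_map => -[u x]; rewrite scale1r.
Qed.
Fact tensor_scaleDr : right_distributive tensor_scale +%R.
Proof.
move=> a s t; rewrite -(tpi_repr s) -(tpi_repr t).
rewrite [_ + _]tensor_addE !tensor_scaleE [RHS]tensor_addE.
by rewrite /scale_word map_cat.
Qed.
Fact tensor_scaleDl t : {morph tensor_scale^~ t : a b / a + b}.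
Proof.
move=> a b; rewrite -(tpi_repr t) !tensor_scaleE [RHS]tensor_addE.
apply/tpiP; elim: (repr t) => [|[u x] w IHw] /=; first exact: TensorRefl.
rewrite -cat1s -[(a *: u, x) :: _]cat1s -[(b *: u, x) :: _]cat1s.
apply: (TensorTrans (w2 := ([:: (a *: u, x)] ++ [:: (b *: u, x)]) ++
                           (scale_word a w ++ scale_word b w))).
  by apply: TensorCat => //; rewrite scalerDl; apply: TensorDl.
rewrite -!catA; apply: TensorCat; first exact: TensorRefl.
rewrite !catA; apply: TensorCat; last exact: TensorRefl.
exact: TensorCatC.
Qed.
HB.instance Definition _ := GRing.Zmodule_isLmodule.Build B tensor
  tensor_scaleA tensor_scale1 tensor_scaleDr tensor_scaleDl.

Lemma tensDl u u' x : tens (u + u') x = tens u x + tens u' x.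
Proof. by rewrite [RHS]tensor_addE; apply/tpiP/TensorDl. Qed.
Lemma tensDr u x x' : tens u (x + x') = tens u x + tens u x'.
Proof. by rewrite [RHS]tensor_addE; apply/tpiP/TensorDr. Qed.
Lemma tens_bal u a x : tens (ract u a) x = tens u (a *: x).
Proof. exact/tpiP/TensorBal. Qed.
Lemma tensZ b u x : tens (b *: u) x = b *: tens u x.
Proof. by rewrite [RHS]tensor_scaleE. Qed.

End TensorRel.

Section TensorFunctor.
Variables (B A : pzRingType) (U : bimodule B A) (X X' : lmodType A).
Variable f : {linear X -> X'}.

Definition map_word (w : seq (U * X)) : seq (U * X') :=
  [seq (p.1, f p.2) | p <- w].

Definition tensor_map (t : tensor U X) : tensor U X' := tpi (map_word (repr t)).

Fact map_word_rel w w' :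
  tensor_rel w w' -> tensor_rel (map_word w) (map_word w').
Proof.
elim=> {w w'} /=.
- by move=> w; apply: TensorRefl.
- by move=> w w' _; apply: TensorSym.
- by move=> w1 w2 w3 _ r12 _; apply: TensorTrans r12.
- by move=> *; rewrite /map_word !map_cat; apply: TensorCat.
- by move=> *; rewrite /map_word !map_cat; apply: TensorCatC.
- by move=> x; apply: Tensor0.
- by move=> u u' x; apply: TensorDl.
- by move=> u x x'; rewrite raddfD; apply: TensorDr.
- by move=> u a x; rewrite linearZ; apply: TensorBal.
Qed.

Lemma tensor_mapE w : tensor_map (tpi w) = tpi (map_word w).
Proof. by apply/tpiP/map_word_rel/repr_tpi. Qed.

Lemma tensor_map_tens u x : tensor_map (tens u x) = tens u (f x).
Proof. exact: tensor_mapE. Qed.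

Fact tensor_map_linear : linear tensor_map.
Proof.
move=> b s t; rewrite -(tpi_repr s) -(tpi_repr t).
rewrite [_ *: tpi _]tensor_scaleE [_ + _]tensor_addE !tensor_mapE.
rewrite [_ *: tpi _]tensor_scaleE [_ + _]tensor_addE.
by rewrite /map_word /scale_word map_cat -!map_comp.
Qed.
HB.instance Definition _ := GRing.isLinear.Build B (tensor U X) (tensor U X')
  *:%R tensor_map tensor_map_linear.

End TensorFunctor.

Arguments tensor_map {B A} U {X X'} f.
Arguments hom_map {B A} U {Y Y'} f.

(* Tor_i^A(U, M) = 0, where Tor_i^A(U, M) is the i-th homology of U (x)_A P for
   a projective resolution P of M; it does not depend on P. *)
Definition Tor_zero (B A : pzRingType) (i : nat) (U : bimodule B A)
    (M : lmodType A) :=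
  forall P : resolution M, (forall j, projective (P j)) ->
  forall t : tensor U (P i),
  match i return tensor U (P i) -> Prop with
  | 0 => fun=> True
  | j.+1 => fun t => tensor_map U (res_d P j) t = 0
  end t ->
  exists s : tensor U (P i.+1), tensor_map U (res_d P i) s = t.

Section MoritaRing.
Variables (A B : pzRingType) (V : bimodule A B) (U : bimodule B A).

(* The matrix (a v; u b). *)
Record morita := Morita { m_a : A; m_v : V; m_u : U; m_b : B }.

Definition morita_tuple (m : morita) := (m_a m, m_v m, m_u m, m_b m).
Definition tuple_morita (p : A * V * U * B) :=
  Morita p.1.1.1 p.1.1.2 p.1.2 p.2.
Fact morita_tupleK : cancel morita_tuple tuple_morita.
Proof. by case. Qed.
HB.instance Definition _ := Choice.copy morita (can_type morita_tupleK).

Definition morita_zero := Morita 0 0 0 0.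
Definition morita_opp m := Morita (- m_a m) (- m_v m) (- m_u m) (- m_b m).
Definition morita_add m1 m2 :=
  Morita (m_a m1 + m_a m2) (m_v m1 + m_v m2) (m_u m1 + m_u m2) (m_b m1 + m_b m2).
Definition morita_one := Morita 1 0 0 1.
Definition morita_mul m1 m2 :=
  Morita (m_a m1 * m_a m2)
         (m_a m1 *: m_v m2 + ract (m_v m1) (m_b m2))
         (ract (m_u m1) (m_a m2) + m_b m1 *: m_u m2)
         (m_b m1 * m_b m2).

Fact morita_addA : associative morita_add.
Proof. by case=> ? ? ? ? [????] [????]; rewrite /morita_add /= !addrA. Qed.
Fact morita_addC : commutative morita_add.
Proof. by case=> a v u b [a' v' u' b']; congr Morita; apply: addrC. Qed.
Fact morita_add0 : left_id morita_zero morita_add.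
Proof. by case=> ????; rewrite /morita_add /= !add0r. Qed.
Fact morita_addN : left_inverse morita_zero morita_opp morita_add.
Proof. by case=> ????; rewrite /morita_add /= !addNr. Qed.
HB.instance Definition _ := GRing.isZmodule.Build morita
  morita_addA morita_addC morita_add0 morita_addN.

Fact morita_mulA : associative morita_mul.
Proof.
case=> a v u b [a' v' u' b'] [a'' v'' u'' b'']; rewrite /morita_mul /=.
congr Morita; rewrite ?mulrA // ?scalerDr ?ractDl ?scalerA ?ractA ?ractZ.
  by rewrite addrA.
by rewrite addrA.
Qed.
Fact morita_mul1 : left_id morita_one morita_mul.
Proof.
by case=> a v u b; rewrite /morita_mul /= !mul1r !scale1r !ract0 addr0 add0r.
Qed.
Fact morita_mulr1 : right_id morita_one morita_mul.
Proof.
by case=> a v u b; rewrite /morita_mul /= !mulr1 !scaler0 !ract1 addr0 add0r.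
Qed.
Fact morita_mulDl : left_distributive morita_mul +%R.
Proof.
case=> a v u b [a' v' u' b'] [a'' v'' u'' b''].
rewrite /morita_mul [RHS]/(morita_add _ _) /morita_add /=.
by congr Morita; rewrite ?mulrDl // ?scalerDl ?ractDl addrACA.
Qed.
Fact morita_mulDr : right_distributive morita_mul +%R.
Proof.
case=> a v u b [a' v' u' b'] [a'' v'' u'' b''].
rewrite /morita_mul [RHS]/(morita_add _ _) /morita_add /=.
by congr Morita; rewrite ?mulrDr // ?scalerDr ?ractDr addrACA.
Qed.
HB.instance Definition _ := GRing.Zmodule_isPzRing.Build morita
  morita_mulA morita_mul1 morita_mulr1 morita_mulDl morita_mulDr.

End MoritaRing.

Section MoritaModules.
Variables (A B : pzRingType) (V : bimodule A B) (U : bimodule B A).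

(* (X, Y, f, g) *)
Record mtuple := MTuple {
  mt_X : lmodType A;
  mt_Y : lmodType B;
  mt_f : {linear tensor U mt_X -> mt_Y};
  mt_g : {linear tensor V mt_Y -> mt_X};
  mt_gVf : forall t, mt_g (tensor_map V mt_f t) = 0;
  mt_fUg : forall t, mt_f (tensor_map U mt_g t) = 0
}.

(* The module of columns (x; y), on which (a v; u b) acts by
   (a x + g (v (x) y); f (u (x) x) + b y). *)
Definition mt_mod (T : mtuple) : Type := (mt_X T * mt_Y T)%type.

Section Action.
Variable T : mtuple.

HB.instance Definition _ := GRing.Zmodule.on (mt_mod T).

Definition mt_scale (m : morita V U) (z : mt_mod T) : mt_mod T :=
  (m_a m *: z.1 + mt_g T (tens (m_v m) z.2),
   mt_f T (tens (m_u m) z.1) + m_b m *: z.2).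

Fact mt_scaleA m m' z : mt_scale m (mt_scale m' z) = mt_scale (m * m') z.
Proof.
case: m m' z => a v u b [a' v' u' b'] [x y]; rewrite /mt_scale /=.
have gf w w' x' : mt_g T (tens w (mt_f T (tens w' x'))) = 0.
  by rewrite -tensor_map_tens mt_gVf.
have fg w w' y' : mt_f T (tens w (mt_g T (tens w' y'))) = 0.
  by rewrite -tensor_map_tens mt_fUg.
congr pair.
  rewrite tensDr linearD /= gf add0r scalerDr scalerA -addrA; congr (_ + _).
  by rewrite tensDl linearD /= tens_bal tensZ linearZ.
rewrite tensDr linearD /= fg addr0 scalerDr scalerA addrA; congr (_ + _).
by rewrite tensDl linearD /= tens_bal tensZ linearZ.
Qed.

Fact tens0 (R S : pzRingType) (W : bimodule R S) (X : lmodType S) (x : X) :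
  tens (0 : W) x = 0.
Proof. exact/tpiP/Tensor0. Qed.

Fact mt_scale1 : left_id 1 mt_scale.
Proof.
by case=> x y; rewrite /mt_scale /= !tens0 !linear0 !scale1r addr0 add0r.
Qed.

Fact mt_scaleDr : right_distributive mt_scale +%R.
Proof.
move=> m [x y] [x' y']; rewrite /mt_scale /=.
by congr pair; rewrite tensDr linearD scalerDr addrACA.
Qed.

Fact mt_scaleDl z : {morph mt_scale^~ z : m m' / m + m'}.
Proof.
move=> m m'; rewrite /mt_scale /=.
by congr pair; rewrite tensDl linearD scalerDl addrACA.
Qed.
HB.instance Definition _ :=
  GRing.Zmodule_isLmodule.Build (morita V U) (mt_mod T)
    mt_scaleA mt_scale1 mt_scaleDr mt_scaleDl.

End Action.

End MoritaModules.

Section Adjoint.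
Variables (B A : pzRingType) (U : bimodule B A).
Variables (X : lmodType A) (Y : lmodType B) (f : {linear tensor U X -> Y}).

Definition adj_fun (x : X) (u : U) : Y := f (tens u x).
Fact adj_fun_linear x : linear (adj_fun x).
Proof. by move=> b u u'; rewrite /adj_fun tensDl tensZ linearP. Qed.
HB.instance Definition _ x :=
  GRing.isLinear.Build B U Y *:%R (adj_fun x) (adj_fun_linear x).

Definition adj (x : X) : bimHom U Y := GRing.Linear.clone _ _ _ _ (adj_fun x) _.
Fact adj_linear : linear adj.
Proof.
move=> a x x'; apply: bimHom_ext => u.
by rewrite /bimHom_app /= /adj_fun tensDr raddfD /= -tens_bal.
Qed.
HB.instance Definition _ :=
  GRing.isLinear.Build A X (bimHom U Y) *:%R adj adj_linear.

End Adjoint.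

Section MoritaClasses.
Variables (A B : pzRingType) (V : bimodule A B) (U : bimodule B A).
Variables (C : modclass A) (D : modclass B).

(* The class of Lambda-modules identified with the tuples satisfying P. *)
Definition tuple_class (P : mtuple V U -> Prop) : modclass (morita V U) :=
  fun M => exists T : mtuple V U,
    isomorphic (mt_mod T : lmodType (morita V U)) M /\ P T.

Definition U_class : modclass (morita V U) :=
  tuple_class (fun T => C (mt_X T) /\ D (mt_Y T)).

Definition B_class : modclass (morita V U) :=
  tuple_class (fun T =>
    [/\ coker_in D (mt_f T), coker_in C (mt_g T),
        exact_at (tensor_map V (mt_f T)) (mt_g T)
      & exact_at (tensor_map U (mt_g T)) (mt_f T)]).

(* [X, Y, adj f, adj g] is the tuple corresponding to (X, Y, f, g). *)
Definition J_class : modclass (morita V U) :=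
  tuple_class (fun T =>
    [/\ ker_in C (adj (mt_f T)), ker_in D (adj (mt_g T)),
        exact_at (adj (mt_f T)) (hom_map U (adj (mt_g T)))
      & exact_at (adj (mt_g T)) (hom_map V (adj (mt_f T)))]).

End MoritaClasses.

Arguments U_class {A B} V U C D.
Arguments B_class {A B} V U C D.
Arguments J_class {A B} V U C D.

(* Main.v *)
Require Import Defs.
From HB Require Import structures.
From mathcomp Require Import all_boot all_order all_algebra generic_quotient.
From mathcomp Require Import boolp.
Set Implicit Arguments.
Unset Strict Implicit.
Unset Printing Implicit Defensive.
Import GRing.Theory.
Local Open Scope ring_scope.
Local Open Scope quotient_scope.

(** A module over the Morita ring is a tuple T = (X, Y, f, g).  The functor
    T |-> X to A-modules has a right adjoint H_A K = [K, Hom_A(V, K), 0, id] and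
    a left adjoint T_A K = (K, U (x) K, id, 0); exchanging the two rings gives
    H_B and T_B for T |-> Y.  Everything follows from these adjunctions.

    The class J.  Let T be in J, with K = Ker (X -> Hom(U, Y)) in C2 and
    L = Ker (Y -> Hom(V, X)) in D2.  The exactness conditions say that
    0 -> K -> X -> Hom(U, L) -> 0 and 0 -> L -> Y -> Hom(V, K) -> 0 are exact.
    The two Ext^1 hypotheses split both sequences, so that T is the direct sum of
    H_A K and H_B L: morphisms into T are arbitrary pairs of linear maps into K
    and L ([J_cofree], [cofree_tmor]).  An extension problem into T therefore
    splits into one over A and one over B, and Ext^1(U-class, J) = 0 follows from
    Ext^1(C1, C2) = 0 = Ext^1(D1, D2) ([left_orthogonal]).

    Approximations.  Since Ext^i(V, C2) = 0 for 1 <= i <= n, dimension shifting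
    gives Ext^1(V, K) = 0 when K has a resolution of length < n by C2.  Hence, when
    0 -> K -> P -> X -> 0 is an approximation of the first component of T, the
    map H_A P -> H_A X is onto with kernel H_A K, and its pullback along the unit
    T -> H_A X is an epimorphism T1 -> T with kernel H_A K whose first component
    is P ([hom_tuple_pullback]).  The same step for the second component gives
    T2 -> T1 with kernel H_B L.  Passing from T1 to T2 extends the first
    component by Hom(U, L), which lies in C1 because the Ext^1 hypothesis makes
    it a direct summand of its own approximation; so T2 is in the U-class.  The
    kernel of T2 -> T is an extension of H_A K by H_B L, and H_A carries finite
    resolutions by C2 to finite resolutions by J ([hom_tuple_finite_res]).

    Higher Ext.  Approximations of the components of a projective module split
    by the same pullback, so projectives are in the U-class ([left_projective]).
    As that class is resolving, all syzygies of its objects stay in it, and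
    every Ext^i reduces to Ext^1 ([resolving_Ext_zero]).

    The second half is dual: objects of B are the sums of T_A K and T_B L
    ([B_free]), pullbacks become pushouts ([tensor_tuple_pushout]), and
    Ext^1(V, -) becomes Tor_1(U, -), whose vanishing makes U (x) - preserve the
    relevant monomorphisms.  Dimension shifting of Tor in the module variable
    rests on the horseshoe lemma.  Higher Ext needs no injectives: a class in
    Ext^(i+2)(M, N) dies in a suitable extension of N, hence in some D of the
    U-class containing that extension, and so it comes from
    Ext^(i+1)(M, D / N), where D / N is again in the class because the class is
    coresolving ([coresolving_Ext_zero]). *)

(** * Linear maps, kernels, cokernels and free modules *)

Definition lin_of (R : pzRingType) (X Y : lmodType R) (f : X -> Y)
    (fL : linear f) : {linear X -> Y} :=
  HB.pack f (GRing.isLinear.Build R X Y *:%R f fL).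

Notation lin f := (GRing.Linear.clone _ _ _ _ f _).

Section LinearMaps.
Variable R : pzRingType.
Implicit Types X Y Z : lmodType R.

Lemma linear_inj X Y (f : {linear X -> Y}) :
  (forall x, f x = 0 -> x = 0) -> injective f.
Proof.
move=> f0 x y fxy; apply/eqP; rewrite -subr_eq0; apply/eqP/f0.
by rewrite linearB fxy subrr.
Qed.

Lemma linear_inj0 X Y (f : {linear X -> Y}) x : injective f -> f x = 0 -> x = 0.
Proof. by move=> fI fx; apply: fI; rewrite fx linear0. Qed.

Lemma lift_through_inj X Y Z (i : {linear Y -> Z}) (f : {linear X -> Z}) :
  injective i -> (forall x, exists y, i y = f x) ->
  exists g : {linear X -> Y}, forall x, i (g x) = f x.
Proof.
move=> iI /choice [g gE].
have gL : linear g.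
  by move=> a x y; apply: iI; rewrite linearP !gE linearP.
by exists (lin_of gL).
Qed.

Lemma factor_through_surj X Y Z (q : {linear X -> Y}) (f : {linear X -> Z}) :
  surj q -> (forall x, q x = 0 -> f x = 0) ->
  exists g : {linear Y -> Z}, forall x, g (q x) = f x.
Proof.
move=> /choice [s sE] qf.
have fq x x' : q x = q x' -> f x = f x'.
  by move=> qx; apply/eqP; rewrite -subr_eq0 -linearB qf // linearB qx subrr.
have gL : linear (f \o s).
  move=> a x y /=; rewrite -[RHS]linearP; apply: fq.
  by rewrite linearP !sE.
by exists (lin_of gL) => x /=; apply: fq; rewrite sE.
Qed.

Lemma inj_surj_bij X Y (f : {linear X -> Y}) :
  injective f -> surj f -> bijective f.
Proof.
move=> fI /choice [g gE]; exists g => // x.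
by apply: fI; rewrite gE.
Qed.

Lemma isomorphic_inj_surj X Y (f : {linear X -> Y}) :
  injective f -> surj f -> isomorphic X Y.
Proof. by move=> fI fS; exists f; apply: inj_surj_bij. Qed.

Lemma linear_inverse X Y (f : {linear X -> Y}) : bijective f ->
  exists g : {linear Y -> X}, cancel f g /\ cancel g f.
Proof.
case=> g fK gK.
have gL : linear g.
  by move=> a x y; apply: (can_inj fK); rewrite linearP !gK.
by exists (lin_of gL).
Qed.

Lemma isomorphic_sym X Y : isomorphic X Y -> isomorphic Y X.
Proof. by case=> f /linear_inverse [g [fK gK]]; exists g; exists f. Qed.

Lemma isomorphic_refl X : isomorphic X X.
Proof. by exists (lin idfun); exists idfun. Qed.

Definition lpair X Y Z (f : {linear X -> Y}) (g : {linear X -> Z}) :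
  {linear X -> (Y * Z)%type}.
Proof.
by apply: (@lin_of _ _ _ (fun x => (f x, g x))) => a x y; rewrite !linearP.
Defined.

Definition lcopair X Y Z (f : {linear X -> Z}) (g : {linear Y -> Z}) :
  {linear (X * Y)%type -> Z}.
Proof.
apply: (@lin_of _ _ _ (fun p => f p.1 + g p.2)) => a x y.
by rewrite /= !linearP scalerDr addrACA.
Defined.

Lemma exact_at0 X Y Z (f : {linear X -> Y}) (g : {linear Y -> Z}) x :
  exact_at f g -> g (f x) = 0.
Proof. by move=> ex; apply/ex; exists x. Qed.

End LinearMaps.

Section Kernel.
Variables (R : pzRingType) (X Y : lmodType R) (f : {linear X -> Y}).

Definition ker_pred : {pred X} := fun x => f x == 0.
Fact ker_submod : submod_closed ker_pred.
Proof.
split; first by rewrite /in_mem /= /ker_pred linear0.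
move=> a x y; rewrite /in_mem /= /ker_pred => /eqP fx /eqP fy.
by rewrite linearP fx fy scaler0 addr0.
Qed.
HB.instance Definition _ := GRing.isSubmodClosed.Build R X ker_pred ker_submod.

Record kermod := Kermod { ker_val : X; _ : ker_val \in ker_pred }.
HB.instance Definition _ := [isSub for ker_val].
HB.instance Definition _ := [Choice of kermod by <:].
HB.instance Definition _ := [SubChoice_isSubLmodule of kermod by <:].

Fact kerl_linear : linear (ker_val).
Proof. by []. Qed.
Definition kerl : {linear kermod -> X} := lin_of kerl_linear.

Lemma kerl_inj : injective kerl.
Proof. exact: val_inj. Qed.

Lemma kerlP x : f x = 0 <-> exists k, kerl k = x.
Proof.
split=> [fx|[[y /eqP fy] <-]] //.
have xP : x \in ker_pred by apply/eqP.
by exists (Kermod xP).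
Qed.

Lemma kerl_exact : exact_at kerl f.
Proof. exact: kerlP. Qed.

Lemma kerl_ses : surj f -> short_exact kerl f.
Proof. by split; [apply: kerl_inj|apply: kerl_exact|]. Qed.

Lemma ker_lift (Z : lmodType R) (g : {linear Z -> X}) : (forall z, f (g z) = 0) ->
  exists h : {linear Z -> kermod}, forall z, kerl (h z) = g z.
Proof.
by move=> fg; apply: (lift_through_inj kerl_inj) => z; apply/kerlP.
Qed.

End Kernel.

Section Cokernel.
Variables (R : pzRingType) (X Y : lmodType R) (f : {linear X -> Y}).

Definition coker_eqv : rel Y := fun y y' => `[< exists x, f x = y - y' >].
Fact coker_eqv_refl : reflexive coker_eqv.
Proof. by move=> y; apply/asboolP; exists 0; rewrite subrr linear0. Qed.
Fact coker_eqv_sym : symmetric coker_eqv.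
Proof.
by move=> y y'; apply/asboolP/asboolP => -[x fx]; exists (- x);
  rewrite linearN fx opprB.
Qed.
Fact coker_eqv_trans : transitive coker_eqv.
Proof.
move=> y2 y1 y3 /asboolP [x fx] /asboolP [x' fx']; apply/asboolP.
by exists (x + x'); rewrite linearD fx fx' addrA subrK.
Qed.
Canonical coker_equiv :=
  EquivRel coker_eqv coker_eqv_refl coker_eqv_sym coker_eqv_trans.

Definition cokermod : Type := {eq_quot coker_equiv}.
HB.instance Definition _ := Quotient.on cokermod.
HB.instance Definition _ := Choice.on cokermod.

Definition coker_pi (y : Y) : cokermod := \pi_cokermod y.

Lemma coker_piP y y' : coker_pi y = coker_pi y' <-> exists x, f x = y - y'.
Proof.
split=> [/eqmodP /asboolP //|ex].
by apply/eqmodP; apply/asboolP.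
Qed.

Lemma coker_pi_repr (q : cokermod) : coker_pi (repr q) = q.
Proof. exact: reprK. Qed.

Lemma repr_coker_pi y : exists x, f x = repr (coker_pi y) - y.
Proof. by apply/coker_piP; rewrite coker_pi_repr. Qed.

Definition coker_lc (a : R) (p q : cokermod) := coker_pi (a *: repr p + repr q).
Lemma coker_lcE a y y' :
  coker_lc a (coker_pi y) (coker_pi y') = coker_pi (a *: y + y').
Proof.
have [x fx] := repr_coker_pi y; have [x' fx'] := repr_coker_pi y'.
apply/coker_piP; exists (a *: x + x'); rewrite linearP fx fx'.
by rewrite scalerBr opprD addrACA.
Qed.

Definition coker_add := coker_lc 1.
Definition coker_scale a p := coker_lc a p (coker_pi 0).
Definition coker_opp := coker_scale (-1).

Lemma coker_addE y y' : coker_add (coker_pi y) (coker_pi y') = coker_pi (y + y').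
Proof. by rewrite /coker_add coker_lcE scale1r. Qed.
Lemma coker_scaleE a y : coker_scale a (coker_pi y) = coker_pi (a *: y).
Proof. by rewrite /coker_scale coker_lcE addr0. Qed.

Fact coker_addA : associative coker_add.
Proof.
move=> p q r; rewrite -(coker_pi_repr p) -(coker_pi_repr q) -(coker_pi_repr r).
by rewrite !coker_addE addrA.
Qed.
Fact coker_addC : commutative coker_add.
Proof.
move=> p q; rewrite -(coker_pi_repr p) -(coker_pi_repr q).
by rewrite !coker_addE addrC.
Qed.
Fact coker_add0 : left_id (coker_pi 0) coker_add.
Proof. by move=> p; rewrite -(coker_pi_repr p) coker_addE add0r. Qed.
Fact coker_addN : left_inverse (coker_pi 0) coker_opp coker_add.
Proof.
move=> p; rewrite -(coker_pi_repr p) /coker_opp coker_scaleE coker_addE.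
by rewrite scaleN1r addNr.
Qed.
HB.instance Definition _ := GRing.isZmodule.Build cokermod
  coker_addA coker_addC coker_add0 coker_addN.

Fact coker_scaleA a b p : coker_scale a (coker_scale b p) = coker_scale (a * b) p.
Proof. by rewrite -(coker_pi_repr p) !coker_scaleE scalerA. Qed.
Fact coker_scale1 : left_id 1 coker_scale.
Proof. by move=> p; rewrite -(coker_pi_repr p) coker_scaleE scale1r. Qed.
Fact coker_scaleDr : right_distributive coker_scale +%R.
Proof.
move=> a p q; rewrite -(coker_pi_repr p) -(coker_pi_repr q).
by rewrite [_ + _]coker_addE !coker_scaleE [RHS]coker_addE scalerDr.
Qed.
Fact coker_scaleDl p : {morph coker_scale^~ p : a b / a + b}.
Proof.
move=> a b; rewrite -(coker_pi_repr p).
by rewrite !coker_scaleE [RHS]coker_addE scalerDl.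
Qed.
HB.instance Definition _ := GRing.Zmodule_isLmodule.Build R cokermod
  coker_scaleA coker_scale1 coker_scaleDr coker_scaleDl.

Fact coker_pi_linear : linear coker_pi.
Proof.
by move=> a y y'; rewrite [a *: coker_pi y]coker_scaleE [RHS]coker_addE.
Qed.
Definition cokerl : {linear Y -> cokermod} := lin_of coker_pi_linear.

Lemma cokerl_surj : surj cokerl.
Proof. by move=> q; exists (repr q); apply: coker_pi_repr. Qed.

Lemma cokerl_exact : exact_at f cokerl.
Proof.
move=> y; split=> [|[x <-]].
  by rewrite -[0]/(coker_pi 0) => /coker_piP; rewrite subr0.
by apply/coker_piP; exists x; rewrite subr0.
Qed.

Lemma cokerl_ses : injective f -> short_exact f cokerl.
Proof. by split; [|apply: cokerl_exact|apply: cokerl_surj]. Qed.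

Lemma coker_factor (Z : lmodType R) (g : {linear Y -> Z}) : (forall x, g (f x) = 0) ->
  exists h : {linear cokermod -> Z}, forall y, h (cokerl y) = g y.
Proof.
by move=> gf; apply: (factor_through_surj cokerl_surj) => y /cokerl_exact [x <-].
Qed.

End Cokernel.

Section FreeModule.
Variables (R : pzRingType) (S : Type).

(** The free module on S is encoded as the formal module expressions in elements
    of S modulo the module axioms: a map out of it is then defined by evaluating
    expressions, with no finiteness of supports to keep track of. *)
Inductive lterm :=
| LGen of S | LZero | LOpp of lterm | LAdd of lterm & lterm | LScale of R & lterm.

Inductive lterm_rel : lterm -> lterm -> Prop :=
| LRefl t : lterm_rel t t
| LSym s t : lterm_rel s t -> lterm_rel t s
| LTrans r s t : lterm_rel r s -> lterm_rel s t -> lterm_rel r t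
| LCongN s t : lterm_rel s t -> lterm_rel (LOpp s) (LOpp t)
| LCongD s s' t t' : lterm_rel s s' -> lterm_rel t t' ->
    lterm_rel (LAdd s t) (LAdd s' t')
| LCongZ a s t : lterm_rel s t -> lterm_rel (LScale a s) (LScale a t)
| LAddA r s t : lterm_rel (LAdd r (LAdd s t)) (LAdd (LAdd r s) t)
| LAddC s t : lterm_rel (LAdd s t) (LAdd t s)
| LAdd0 t : lterm_rel (LAdd LZero t) t
| LAddN t : lterm_rel (LAdd (LOpp t) t) LZero
| LScaleA a b t : lterm_rel (LScale a (LScale b t)) (LScale (a * b) t)
| LScale1 t : lterm_rel (LScale 1 t) t
| LScaleDr a s t : lterm_rel (LScale a (LAdd s t)) (LAdd (LScale a s) (LScale a t))
| LScaleDl a b t : lterm_rel (LScale (a + b) t) (LAdd (LScale a t) (LScale b t)).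

HB.instance Definition _ := gen_eqMixin lterm.
HB.instance Definition _ := gen_choiceMixin lterm.

Definition lterm_eqv : rel lterm := fun s t => `[< lterm_rel s t >].
Fact lterm_eqv_refl : reflexive lterm_eqv.
Proof. by move=> t; apply/asboolP; apply: LRefl. Qed.
Fact lterm_eqv_sym : symmetric lterm_eqv.
Proof. by move=> s t; apply/asboolP/asboolP; apply: LSym. Qed.
Fact lterm_eqv_trans : transitive lterm_eqv.
Proof.
by move=> s r t /asboolP rs /asboolP st; apply/asboolP; apply: LTrans rs st.
Qed.
Canonical lterm_equiv :=
  EquivRel lterm_eqv lterm_eqv_refl lterm_eqv_sym lterm_eqv_trans.

Definition freemod : Type := {eq_quot lterm_equiv}.
HB.instance Definition _ := Quotient.on freemod.
HB.instance Definition _ := Choice.on freemod.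

Definition fpi (t : lterm) : freemod := \pi_freemod t.
Lemma fpiP s t : fpi s = fpi t <-> lterm_rel s t.
Proof. by split=> [/eqmodP /asboolP //|r]; apply/eqmodP; apply/asboolP. Qed.
Lemma fpi_repr (x : freemod) : fpi (repr x) = x.
Proof. exact: reprK. Qed.
Lemma repr_fpi t : lterm_rel (repr (fpi t)) t.
Proof. by apply/fpiP; rewrite fpi_repr. Qed.

Definition free_add (x y : freemod) := fpi (LAdd (repr x) (repr y)).
Definition free_opp (x : freemod) := fpi (LOpp (repr x)).
Definition free_scale a (x : freemod) := fpi (LScale a (repr x)).
Lemma free_addE s t : free_add (fpi s) (fpi t) = fpi (LAdd s t).
Proof. by apply/fpiP/LCongD; apply: repr_fpi. Qed.
Lemma free_oppE t : free_opp (fpi t) = fpi (LOpp t).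
Proof. by apply/fpiP/LCongN/repr_fpi. Qed.
Lemma free_scaleE a t : free_scale a (fpi t) = fpi (LScale a t).
Proof. by apply/fpiP/LCongZ/repr_fpi. Qed.

Fact free_addA : associative free_add.
Proof.
move=> x y z; rewrite -(fpi_repr x) -(fpi_repr y) -(fpi_repr z) !free_addE.
exact/fpiP/LAddA.
Qed.
Fact free_addC : commutative free_add.
Proof. by move=> x y; apply/fpiP/LAddC. Qed.
Fact free_add0 : left_id (fpi LZero) free_add.
Proof. by move=> x; rewrite -(fpi_repr x) free_addE; apply/fpiP/LAdd0. Qed.
Fact free_addN : left_inverse (fpi LZero) free_opp free_add.
Proof.
by move=> x; rewrite -(fpi_repr x) free_oppE free_addE; apply/fpiP/LAddN.
Qed.
HB.instance Definition _ := GRing.isZmodule.Build freemod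
  free_addA free_addC free_add0 free_addN.

Fact free_scaleA a b x : free_scale a (free_scale b x) = free_scale (a * b) x.
Proof. by rewrite -(fpi_repr x) !free_scaleE; apply/fpiP/LScaleA. Qed.
Fact free_scale1 : left_id 1 free_scale.
Proof. by move=> x; rewrite -(fpi_repr x) free_scaleE; apply/fpiP/LScale1. Qed.
Fact free_scaleDr : right_distributive free_scale +%R.
Proof.
move=> a x y; rewrite -(fpi_repr x) -(fpi_repr y).
rewrite [_ + _]free_addE !free_scaleE [RHS]free_addE; exact/fpiP/LScaleDr.
Qed.
Fact free_scaleDl x : {morph free_scale^~ x : a b / a + b}.
Proof.
move=> a b; rewrite -(fpi_repr x) !free_scaleE [RHS]free_addE.
exact/fpiP/LScaleDl.
Qed.
HB.instance Definition _ := GRing.Zmodule_isLmodule.Build R freemod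
  free_scaleA free_scale1 free_scaleDr free_scaleDl.

Definition free_gen (s : S) : freemod := fpi (LGen s).

Section Extension.
Variables (M : lmodType R) (g : S -> M).

Fixpoint lterm_eval (t : lterm) : M :=
  match t with
  | LGen s => g s
  | LZero => 0
  | LOpp t => - lterm_eval t
  | LAdd s t => lterm_eval s + lterm_eval t
  | LScale a t => a *: lterm_eval t
  end.

Lemma lterm_eval_rel s t : lterm_rel s t -> lterm_eval s = lterm_eval t.
Proof.
elim=> {s t} //=.
- by move=> r s t _ -> _ ->.
- by move=> s t _ ->.
- by move=> s s' t t' _ -> _ ->.
- by move=> a s t _ ->.
- by move=> *; rewrite addrA.
- by move=> *; rewrite addrC.
- by move=> *; rewrite add0r.
- by move=> *; rewrite addNr.
- by move=> *; rewrite scalerA.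
- by move=> *; rewrite scale1r.
- by move=> *; rewrite scalerDr.
- by move=> *; rewrite scalerDl.
Qed.

Definition free_ext_fun (x : freemod) : M := lterm_eval (repr x).
Lemma free_ext_funE t : free_ext_fun (fpi t) = lterm_eval t.
Proof. exact/lterm_eval_rel/repr_fpi. Qed.

Fact free_ext_linear : linear free_ext_fun.
Proof.
move=> a x y; rewrite -(fpi_repr x) -(fpi_repr y).
by rewrite [a *: fpi _]free_scaleE [_ + _]free_addE !free_ext_funE.
Qed.
Definition free_ext : {linear freemod -> M} := lin_of free_ext_linear.

Lemma free_ext_gen s : free_ext (free_gen s) = g s.
Proof. exact: free_ext_funE. Qed.
End Extension.

Lemma free_linear_ext (M : lmodType R) (h k : {linear freemod -> M}) :
  (forall s, h (free_gen s) = k (free_gen s)) -> h =1 k.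
Proof.
move=> hk x; rewrite -(fpi_repr x); elim: (repr x) => /=.
- exact: hk.
- by rewrite -[fpi LZero]/(0 : freemod) !linear0.
- by move=> t IHt; rewrite -free_oppE -/(- fpi t) !linearN IHt.
- move=> s IHs t IHt; rewrite -free_addE -[free_add _ _]/(fpi s + fpi t).
  by rewrite !linearD IHs IHt.
- move=> a t IHt; rewrite -free_scaleE -[free_scale _ _]/(a *: fpi t).
  by rewrite !linearZ IHt.
Qed.

Lemma freemod_projective : projective (freemod : lmodType R).
Proof.
move=> M N p h /choice [s sE].
pose k := free_ext (fun x => s (h (free_gen x))).
exists k; apply: (@free_linear_ext _ (lin (p \o k))) => x.
by rewrite -[LHS]/(p (k (free_gen x))) free_ext_gen sE.
Qed.

End FreeModule.

(** * Extensions and projective resolutions *)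

Section Resolutions.
Variable R : pzRingType.
Implicit Types K M N X Y Z E : lmodType R.

(** The terms of the standard resolution are the free modules on the underlying
    sets of these iterated kernels. *)
Fixpoint free_syzygy M (i : nat) : lmodType R :=
  if i is j.+1
  then kermod (free_ext (idfun : free_syzygy M j -> free_syzygy M j))
  else M.

Lemma free_ext_surj M : surj (free_ext (idfun : M -> M)).
Proof. by move=> x; exists (free_gen R x); rewrite free_ext_gen. Qed.

Lemma free_resolution M :
  exists P : resolution M, forall j, projective (P j).
Proof.
pose S := free_syzygy M.
pose aug i : {linear freemod R (S i) -> S i} := free_ext idfun.
have augS i : surj (aug i) by apply: free_ext_surj.
pose d i : {linear freemod R (S i.+1) -> freemod R (S i)} :=
  lin (kerl (aug i) \o aug i.+1).
have ex i : exact_at (d i) (aug i).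
  move=> y; split=> [/kerlP [k <-]|[x <-]].
    by have [x <-] := augS i.+1 k; exists x.
  by apply/kerlP; exists (aug i.+1 x).
have exd i : exact_at (d i.+1) (d i).
  move=> y; rewrite -ex; split=> [dy|auy]; last first.
    by rewrite -[LHS]/(kerl (aug i) (aug i.+1 y)) auy linear0.
  exact: linear_inj0 (@kerl_inj _ _ _ (aug i)) dy.
exists (@Resolution R M (fun i => freemod R (S i)) d (aug 0%N)
          (augS 0%N) (ex 0%N) exd) => j.
exact: freemod_projective.
Qed.

Section Shift.
Variables (M : lmodType R) (P : resolution M).

Fact res_augK x : res_aug P (res_d P 0 x) = 0.
Proof. exact: (exact_at0 _ (@res_exact0 _ _ P)). Qed.

Fact res_dK i x : res_d P i (res_d P i.+1 x) = 0.
Proof. exact: (exact_at0 _ (@res_exactS _ _ P i)). Qed.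

Definition shift_aug : {linear P 1%N -> kermod (res_aug P)} :=
  projT1 (cid (ker_lift res_augK)).
Lemma shift_augE x : kerl _ (shift_aug x) = res_d P 0 x.
Proof. exact: (projT2 (cid (ker_lift res_augK))). Qed.

Fact shift_aug_surj : surj shift_aug.
Proof.
move=> k; have /(@res_exact0 _ _ P) [x dx] : res_aug P (kerl _ k) = 0.
  by apply/kerlP; exists k.
by exists x; apply: (@kerl_inj _ _ _ (res_aug P)); rewrite shift_augE.
Qed.

Fact shift_exact0 : exact_at (res_d P 1) shift_aug.
Proof.
move=> y; rewrite -(@res_exactS _ _ P 0); split=> [ay|dy].
  by rewrite -shift_augE ay linear0.
by apply: (@kerl_inj _ _ _ (res_aug P)); rewrite shift_augE dy linear0.
Qed.

Definition res_shift : resolution (kermod (res_aug P)) :=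
  @Resolution R (kermod (res_aug P)) (fun i => P i.+1) (fun i => res_d P i.+1)
    shift_aug shift_aug_surj shift_exact0 (fun i => @res_exactS _ _ P i.+1).

End Shift.

(** The cochain complexes of P and of its shift agree up to the index.  Ext^1 is
    left out because Ext^0 of the syzygy is a whole group of homomorphisms. *)
Lemma Ext_zero_syzygy i M N :
  (forall P : resolution M, (forall j, projective (P j)) ->
     Ext_zero i.+1 (kermod (res_aug P) : lmodType R) N) -> Ext_zero i.+2 M N.
Proof.
move=> ext P Pproj phi phid.
exact: (ext P Pproj (res_shift P) (fun j => Pproj j.+1) phi phid).
Qed.

(** Ext^1(M, N) = 0 in terms of short exact sequences: no extension problem
    into N has an obstruction. *)
Definition ext_extends M N :=
  forall Z E (i : {linear Z -> E}) (p : {linear E -> M}), short_exact i p ->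
  forall h : {linear Z -> N}, exists k : {linear E -> N},
    forall z, k (i z) = h z.

(** An extension E of M by Z is presented by the generators P 0 + Z and the
    relations P 1: lifting the augmentation to P 0 -> E determines P 1 -> Z, the
    cocycle of the extension.  Both Ext^1 and Tor_1 are compared with extensions
    through this presentation. *)
Lemma extension_presentation M Z E (i : {linear Z -> E}) (p : {linear E -> M})
    (P : resolution M) : short_exact i p -> projective (P 0%N) ->
  exists (a : {linear P 0%N -> E}) (b : {linear P 1%N -> Z}),
    [/\ surj (lcopair a i),
        exact_at (lpair (res_d P 0) (lin (\- b))) (lcopair a i)
      & forall x, b (res_d P 1 x) = 0].
Proof.
move=> [iI ip pS] P0proj.
have [a aE] := P0proj _ _ p (res_aug P) pS.
have [|b bE] := @lift_through_inj _ _ _ _ i (lin (a \o res_d P 0)) iI.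
  by move=> x; apply/ip; rewrite /= aE res_augK.
exists a, b; split=> [e|[x z]|x].
- have [x xE] := @res_aug_surj _ _ P (p e).
  have /ip [z zE] : p (e - a x) = 0 by rewrite linearB aE xE subrr.
  by exists (x, z) => /=; rewrite zE addrC subrK.
- split=> [/= axz|[y [<- <-]]]; last by rewrite /= linearN bE subrr.
  have /(@res_exact0 _ _ P) [y yE] : res_aug P x = 0.
    rewrite -aE; have := congr1 p axz.
    by rewrite linearD linear0 (exact_at0 z ip) addr0.
  exists y; congr (_, _); first exact: yE.
  apply/esym/eqP; rewrite /= -addr_eq0; apply/eqP/iI.
  by rewrite linearD bE /= yE addrC axz linear0.
- by apply: iI; rewrite bE /= res_dK !linear0.
Qed.

(** On generators take h on Z and, on P 0, a cochain whose coboundary is the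
    cocycle of the extension pushed along h; the two agree on the relations. *)
Lemma Ext_zero_extends M N : Ext_zero 1 M N -> ext_extends M N.
Proof.
move=> ext Z E i p ses h.
have [P Pproj] := free_resolution M.
have [a [b [qS ex bd]]] := extension_presentation ses (Pproj 0%N).
have /= [] := ext P Pproj (lin (h \o b)) => [x|psi psiE].
  by rewrite /= bd linear0.
have [|k kE] := @factor_through_surj _ _ _ _ _ (lcopair psi h) qS.
  by move=> _ /ex [y <-]; rewrite /= psiE linearN subrr.
exists k => z; have := kE (0, z) => /=.
by rewrite !linear0 !add0r.
Qed.

(** A 1-cocycle is a map from the first syzygy; extending it to P 0 exhibits it as
    a coboundary. *)
Lemma extends_Ext_zero M N : ext_extends M N -> Ext_zero 1 M N.
Proof.
move=> ext P Pproj phi phid.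
have [phi' phiE] := @factor_through_surj _ _ _ _ (res_aug (res_shift P)) phi
  (@res_aug_surj _ _ (res_shift P))
  (fun x ax => let: ex_intro y dy := (@res_exact0 _ _ (res_shift P) x).1 ax in
     etrans (congr1 phi (esym dy)) (phid y)).
have [psi psiE] := ext _ _ _ _ (kerl_ses (@res_aug_surj _ _ P)) phi'.
exists psi => x; rewrite -phiE -psiE; congr (psi _).
exact/esym/shift_augE.
Qed.

Lemma extends_lift M N E X (i : {linear N -> E}) (p : {linear E -> X})
    (h : {linear M -> X}) : ext_extends M N -> short_exact i p ->
  exists k : {linear M -> E}, forall m, p (k m) = h m.
Proof.
move=> ext [iI ip pS].
(* W is the pullback of p and h; a retraction of W onto N splits W -> M. *)
pose f : {linear (E * M)%type -> X} := lcopair p (lin (\- h)).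
pose W : lmodType R := kermod f.
pose j : {linear W -> (E * M)%type} := kerl f.
have fE e m : f (e, m) = 0 <-> p e = h m.
  by rewrite /f /=; split=> [/eqP|->]; rewrite ?subrr // subr_eq0 => /eqP.
pose q : {linear W -> M} := lin (snd \o j).
have qE w : q w = (j w).2 by [].
have [i' i'E] : exists i' : {linear N -> W}, forall x, j (i' x) = (i x, 0).
  apply: (ker_lift (g := lpair i (lin \0))) => x.
  by apply/fE; rewrite linear0 (exact_at0 x ip).
have ses : short_exact i' q.
  split.
  - by move=> x y /(congr1 j); rewrite !i'E => -[/iI].
  - move=> w; rewrite qE; split=> [|[x <-]]; last by rewrite i'E.
    case jw: (j w) => [e m] /= m0.
    have /fE : f (e, m) = 0 by apply/kerlP; exists w.
    rewrite m0 linear0 => /ip [x xE]; exists x.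
    by apply: (@kerl_inj _ _ _ f); rewrite [LHS]i'E [RHS]jw m0 xE.
  - move=> m; have [e eE] := pS (h m).
    have /kerlP [w wE] : f (e, m) = 0 by apply/fE.
    by exists w; rewrite qE [j w]wE.
have [r rE] := ext _ _ _ _ ses (lin idfun).
have [] := @factor_through_surj _ _ _ _ q (lin ((fst \o j) \- (i \o r))) => [|w qw|k kE].
- by case: ses.
- have [_ ex _] := ses; have /ex [x <-] := qw.
  by rewrite -[LHS]/((j (i' x)).1 - i (r (i' x))) rE i'E subrr.
exists k => m; case: ses => _ _ /(_ m) [w <-].
rewrite kE /= linearB (exact_at0 _ ip) subr0; apply/fE.
by rewrite -surjective_pairing; apply/kerlP; exists w.
Qed.

(** The long exact sequence in the second variable, read off on cochains: lift a
    cocycle with values in M to X, and correct the coboundary of the lift, which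
    takes values in K. *)
Lemma Ext_zero_dimension_shift i K X M (j : {linear K -> X})
    (p : {linear X -> M}) Q : short_exact j p ->
  Ext_zero i.+1 Q X -> Ext_zero i.+2 Q K -> Ext_zero i.+1 Q M.
Proof.
move=> [jI jp pS] extX extK P Pproj phi phid.
have [phi' phiE] := Pproj i.+1 _ _ p phi pS.
have [w wE] : exists w : {linear P i.+2 -> K},
    forall x, j (w x) = phi' (res_d P i.+1 x).
  apply: (lift_through_inj (f := lin (phi' \o res_d P i.+1)) jI) => x /=.
  by apply/jp; rewrite phiE phid.
have /= [|psi psiE] := extK P Pproj w.
  by move=> x; apply: jI; rewrite wE res_dK !linear0.
have /= [|chi chiE] := extX P Pproj (lin (phi' \- (j \o psi))).
  by move=> x /=; rewrite psiE wE subrr.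
exists (lin (p \o chi)) => x /=.
by rewrite chiE /= linearB (exact_at0 _ jp) subr0 phiE.
Qed.

End Resolutions.

(** * Finite resolutions and direct summands *)

Section FiniteClasses.
Variable R : pzRingType.
Implicit Types K M N X Y Z E : lmodType R.

(** Any zero module will do; the kernel of an identity map is one. *)
Definition zeromod M : lmodType R := kermod (idfun : {linear M -> M}).

Lemma zeromod0 M : zero_module (zeromod M).
Proof.
move=> x; apply: (@kerl_inj _ _ _ (idfun : {linear M -> M})).
by rewrite linear0; apply/(kerlP (idfun : {linear M -> M})); exists x.
Qed.

Section ZeroResolutions.
Variables (Z : lmodType R) (Z0 : zero_module Z).

Definition zero_resolution : resolution Z.
Proof.
apply: (@Resolution R Z (fun=> Z) (fun=> lin \0) (lin idfun)).
- by move=> y; exists y.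
- by move=> y; split=> _; [exists 0|]; rewrite ?(Z0 y) // (Z0 0) Z0.
- by move=> i y; split=> _; [exists 0|]; rewrite ?(Z0 y) // (Z0 0) Z0.
Defined.

Definition zero_coresolution : coresolution Z.
Proof.
apply: (@Coresolution R Z (fun=> Z) (fun=> lin \0) (lin idfun)).
- by [].
- by move=> y; split=> _; [exists 0|]; rewrite ?(Z0 y) // (Z0 0) Z0.
- by move=> i y; split=> _; [exists 0|]; rewrite ?(Z0 y) // (Z0 0) Z0.
Defined.
End ZeroResolutions.

Section Splice.
Variables (K X M : lmodType R) (i : {linear K -> X}) (p : {linear X -> M}).
Hypothesis ses : short_exact i p.

Section Resolution.
Variable P : resolution K.

Definition splice_mod (n : nat) : lmodType R := if n is m.+1 then P m else X.
Definition splice_d (n : nat) : {linear splice_mod n.+1 -> splice_mod n} :=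
  match n return {linear splice_mod n.+1 -> splice_mod n} with
  | 0 => lin (i \o res_aug P)
  | m.+1 => res_d P m
  end.

Fact splice_surj : surj p. Proof. by case: ses. Qed.

Fact splice_exact0 : exact_at (splice_d 0) p.
Proof.
case: ses => iI ip _ y; rewrite ip; split=> [[k <-]|[x <-]]; last first.
  by exists (res_aug P x).
by have [x <-] := @res_aug_surj _ _ P k; exists x.
Qed.

Fact splice_exactS n : exact_at (splice_d n.+1) (splice_d n).
Proof.
case: n => [|n]; last exact: (@res_exactS _ _ P n).
case: ses => iI _ _ y; rewrite -(@res_exact0 _ _ P); split=> [iy|ay].
  exact: linear_inj0 iI iy.
by rewrite -[LHS]/(i (res_aug P y)) ay linear0.
Qed.

Definition res_splice : resolution M :=
  @Resolution R M splice_mod splice_d p splice_surj splice_exact0 splice_exactS.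
End Resolution.

Section Coresolution.
Variable I : coresolution M.

Definition cosplice_mod (n : nat) : lmodType R := if n is m.+1 then I m else X.
Definition cosplice_d (n : nat) : {linear cosplice_mod n -> cosplice_mod n.+1} :=
  match n return {linear cosplice_mod n -> cosplice_mod n.+1} with
  | 0 => lin (cores_aug I \o p)
  | m.+1 => cores_d I m
  end.

Fact cosplice_inj : injective i. Proof. by case: ses. Qed.

Fact cosplice_exact0 : exact_at i (cosplice_d 0).
Proof.
case: ses => _ ip _ y; rewrite -ip; split=> [|py].
  exact: linear_inj0 (@cores_aug_inj _ _ I).
by rewrite -[LHS]/(cores_aug I (p y)) py linear0.
Qed.

Fact cosplice_exactS n : exact_at (cosplice_d n) (cosplice_d n.+1).
Proof.
case: n => [|n]; last exact: (@cores_exactS _ _ I n).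
case: ses => _ _ pS y; rewrite (@cores_exact0 _ _ I); split=> [[m <-]|[x <-]].
  by have [x <-] := pS m; exists x.
by exists (p x).
Qed.

Definition cores_splice : coresolution K :=
  @Coresolution R K cosplice_mod cosplice_d i cosplice_inj cosplice_exact0
    cosplice_exactS.
End Coresolution.
End Splice.

Variable C : modclass R.

Lemma finite_res_cons m K X M (i : {linear K -> X}) (p : {linear X -> M}) :
  short_exact i p -> C X -> finite_res_class C m K ->
  finite_res_class C m.+1 M.
Proof.
move=> ses CX [P [k [le_km CP P0]]]; exists (res_splice ses P), k.+1.
by split=> // -[|j] //=; [move=> /CP|move=> /P0].
Qed.

Lemma finite_cores_cons m K X M (i : {linear K -> X}) (p : {linear X -> M}) :
  short_exact i p -> C X -> finite_cores_class C m M ->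
  finite_cores_class C m.+1 K.
Proof.
move=> ses CX [I [k [le_km CI I0]]]; exists (cores_splice ses I), k.+1.
by split=> // -[|j] //=; [move=> /CI|move=> /I0].
Qed.

Lemma finite_res_base m M : C M -> finite_res_class C m M.
Proof.
move=> CM.
have ses : short_exact (kerl (idfun : {linear M -> M})) (lin idfun : {linear M -> M}).
  by apply: kerl_ses => x; exists x.
exists (res_splice ses (zero_resolution (@zeromod0 M))), 0%N; split=> //.
- by case.
- by case=> // j _; apply: (@zeromod0 M).
Qed.

Lemma finite_cores_base m M : C M -> finite_cores_class C m M.
Proof.
move=> CM.
have ses : short_exact (lin idfun : {linear M -> M}) (lin \0 : {linear M -> zeromod M}).
  split=> [//|y|y]; first by split=> // _; exists y.
  by exists 0; rewrite [y]zeromod0.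
exists (cores_splice ses (zero_coresolution (@zeromod0 M))), 0%N; split=> //.
- by case.
- by case=> // j _; apply: (@zeromod0 M).
Qed.

Hypothesis C_class : is_class C.

(** Splitting a finite resolution into short exact sequences turns statements
    about it into inductions on its length.  The base case needs C to be closed
    under isomorphism, as M is then only isomorphic to the single term. *)
Lemma finite_res_ind (Q : nat -> modclass R) :
  (forall m M, C M -> Q m M) ->
  (forall m K X M (i : {linear K -> X}) (p : {linear X -> M}),
     short_exact i p -> C X -> finite_res_class C m K -> Q m K -> Q m.+1 M) ->
  forall m M, finite_res_class C m M -> Q m M.
Proof.
move=> Q0 QS m M [P [k [le_km CP P0]]].
elim: k m M P le_km CP P0 => [|k IHk] [|m] M P // le_km CP P0.
1,2: apply/Q0/(C_class.2 (P 0%N)); last exact: CP.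
1,2: apply: (@isomorphic_inj_surj _ _ _ (res_aug P)); last exact: res_aug_surj.
1,2: by apply: linear_inj => x /(@res_exact0 _ _ P) [y <-];
  rewrite (P0 1%N isT y) linear0.
have CP' i : (i <= k)%N -> C (res_shift P i) by move=> le_ik; apply: CP.
have P0' i : (k < i)%N -> zero_module (res_shift P i).
  by move=> lt_ki; apply: P0.
apply: (QS m _ _ _ _ _ (kerl_ses (@res_aug_surj _ _ P))); first exact: CP.
  by exists (res_shift P), k.
exact: (IHk m _ (res_shift P)).
Qed.

Section CoShift.
Variables (M : lmodType R) (I : coresolution M).
Let K := kermod (cores_d I 1).

Fact coshift_exact0 : exact_at (kerl (cores_d I 1)) (cores_d I 1).
Proof. exact: kerl_exact. Qed.

(** The cokernel of M -> I 0 is realised as a kernel inside I 1. *)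
Definition coshift : coresolution K :=
  @Coresolution R K (fun i => I i.+1) (fun i => cores_d I i.+1)
    (kerl (cores_d I 1)) (@kerl_inj _ _ _ _) coshift_exact0
    (fun i => @cores_exactS _ _ I i.+1).

Lemma coshift_ses : exists p : {linear I 0%N -> K}, short_exact (cores_aug I) p.
Proof.
have [p pE] : exists p : {linear I 0%N -> K},
    forall x, kerl (cores_d I 1) (p x) = cores_d I 0 x.
  by apply: ker_lift => x; apply: (exact_at0 _ (@cores_exactS _ _ I 0)).
exists p; split.
- exact: cores_aug_inj.
- move=> y; rewrite -(@cores_exact0 _ _ I) -pE; split=> [->|py].
    exact: linear0.
  exact: linear_inj0 (@kerl_inj _ _ _ (cores_d I 1)) py.
- move=> k; have /(@cores_exactS _ _ I 0) [x xE] : cores_d I 1 (kerl _ k) = 0.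
    by apply/kerlP; exists k.
  by exists x; apply: (@kerl_inj _ _ _ (cores_d I 1)); rewrite pE.
Qed.
End CoShift.

Lemma finite_cores_ind (Q : nat -> modclass R) :
  (forall m M, C M -> Q m M) ->
  (forall m K X M (i : {linear K -> X}) (p : {linear X -> M}),
     short_exact i p -> C X -> finite_cores_class C m M -> Q m M -> Q m.+1 K) ->
  forall m M, finite_cores_class C m M -> Q m M.
Proof.
move=> Q0 QS m M [I [k [le_km CI I0]]].
elim: k m M I le_km CI I0 => [|k IHk] [|m] M I // le_km CI I0.
1,2: apply/Q0/(C_class.2 (I 0%N)); last exact: CI.
1,2: apply/isomorphic_sym.
1,2: apply: (@isomorphic_inj_surj _ _ _ (cores_aug I)); first exact: cores_aug_inj.
1,2: by move=> x; apply/(@cores_exact0 _ _ I); apply: I0.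
have [p ses] := coshift_ses I.
have CI' i : (i <= k)%N -> C (coshift I i) by move=> le_ik; apply: CI.
have I0' i : (k < i)%N -> zero_module (coshift I i).
  by move=> lt_ki; apply: I0.
apply: (QS m _ _ _ _ _ ses); first exact: CI.
  by exists (coshift I), k.
exact: (IHk m _ (coshift I)).
Qed.

End FiniteClasses.

Section Summands.
Variable R : pzRingType.
Implicit Types K M N X Y Z E : lmodType R.

(** A retract has the kernel of the retraction as complement. *)
Lemma summand_retract (C : modclass R) M N (s : {linear N -> M})
    (r : {linear M -> N}) :
  summand_closed C -> cancel s r -> C M -> C N.
Proof.
move=> sumC sK; apply: (sumC M N (kermod r)).
have rs m : r (m - s (r m)) = 0 by rewrite linearB sK subrr.
have [t tE] := ker_lift (f := r) (g := lin (idfun \- (s \o r))) rs.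
apply: (@isomorphic_inj_surj _ _ _ (lpair r t)).
  apply: linear_inj => m /= [rm tm]; have := tE m.
  by rewrite tm linear0 /= rm linear0 subr0.
move=> [n k]; have rk : r (kerl r k) = 0 by apply/kerlP; exists k.
exists (s n + kerl r k); congr (_, _); first by rewrite linearD sK rk addr0.
apply: (@kerl_inj _ _ _ r); rewrite tE /= [r _]linearD sK rk addr0 addrC addKr //.
Qed.

Lemma extends_retract M N X (i : {linear N -> X}) (p : {linear X -> M}) :
  ext_extends M N -> short_exact i p ->
  exists r : {linear X -> N}, cancel i r.
Proof. by move=> ext ses; have [r rE] := ext _ _ _ _ ses (lin idfun); exists r. Qed.

Lemma extends_section M N X (i : {linear N -> X}) (p : {linear X -> M}) :
  ext_extends M N -> short_exact i p ->
  exists s : {linear M -> X}, cancel s p.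
Proof. by move=> ext ses; apply: (extends_lift (lin idfun) ext ses). Qed.

Lemma kernel_comp_ses K1 K2 X1 X2 M
    (i1 : {linear K1 -> X1}) (p1 : {linear X1 -> M})
    (i2 : {linear K2 -> X2}) (p2 : {linear X2 -> X1}) :
  short_exact i1 p1 -> short_exact i2 p2 ->
  exists (i : {linear K2 -> kermod (lin (p1 \o p2))})
         (p : {linear kermod (lin (p1 \o p2)) -> K1}), short_exact i p.
Proof.
move=> [i1I ex1 p1S] [i2I ex2 p2S].
set f : {linear X2 -> M} := lin (p1 \o p2).
have fE x : f x = p1 (p2 x) by [].
have fi2 x : f (i2 x) = 0 by rewrite fE (exact_at0 _ ex2) linear0.
have [i iE] := ker_lift fi2.
have [|p pE] := @lift_through_inj _ _ _ _ i1 (lin (p2 \o kerl f)) i1I.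
  by move=> k; apply/ex1; rewrite -fE; apply/kerlP; exists k.
exists i, p; split.
- by move=> x y /(congr1 (kerl f)); rewrite !iE => /i2I.
- move=> k; split=> [pk|[x <-]].
    have /ex2 [x xE] : p2 (kerl f k) = 0.
      by rewrite -[LHS]/((p2 \o kerl f) k) -pE pk linear0.
    by exists x; apply: (@kerl_inj _ _ _ f); rewrite iE.
  apply: i1I; rewrite pE linear0 -[LHS]/(p2 (kerl f (i x))) iE.
  exact: exact_at0.
- move=> k; have [x xE] := p2S (i1 k).
  have /kerlP [k' k'E] : f x = 0 by rewrite fE xE (exact_at0 _ ex1).
  by exists k'; apply: i1I; rewrite pE -[LHS]/(p2 (kerl f k')) k'E.
Qed.

Lemma cokernel_comp_ses M X1 X2 K1 K2
    (i1 : {linear M -> X1}) (p1 : {linear X1 -> K1})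
    (i2 : {linear X1 -> X2}) (p2 : {linear X2 -> K2}) :
  short_exact i1 p1 -> short_exact i2 p2 ->
  exists (i : {linear K1 -> cokermod (lin (i2 \o i1))})
         (p : {linear cokermod (lin (i2 \o i1)) -> K2}), short_exact i p.
Proof.
move=> [i1I ex1 p1S] [i2I ex2 p2S].
set f : {linear M -> X2} := lin (i2 \o i1).
have fE x : f x = i2 (i1 x) by [].
have [|p pE] := @coker_factor _ _ _ f _ p2.
  by move=> x; rewrite fE (exact_at0 _ ex2).
have [|i iE] := @factor_through_surj _ _ _ _ p1 (lin (cokerl f \o i2)) p1S.
  by move=> x /ex1 [m <-]; apply/cokerl_exact; exists m.
exists i, p; split.
- apply: linear_inj => k; have [x <-] := p1S k; rewrite iE.
  move=> /cokerl_exact [m]; rewrite fE => /i2I <-.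
  exact: exact_at0.
- move=> q; have [x <-] := @cokerl_surj _ _ _ f q; rewrite pE ex2.
  split=> [[y <-]|[k]]; first by exists (p1 y); rewrite iE.
  have [y <-] := p1S k; rewrite iE => xy.
  have /cokerl_exact [m mE] : cokerl f (x - i2 y) = 0.
    by rewrite linearB -xy subrr.
  by exists (y + i1 m); rewrite linearD -fE mE addrC subrK.
- by move=> k; have [x <-] := p2S k; exists (cokerl f x); rewrite pE.
Qed.

End Summands.

(** * Tensor products and Tor *)

#[local] Arguments tensor_map {B A} U {X X'} f t : simpl never.
#[local] Arguments tens {B A U X} u x : simpl never.

Section Tensor.
Variables (B A : pzRingType) (U : bimodule B A).

Lemma tpi_cons (X : lmodType A) u x (w : seq (U * X)) :
  tpi ((u, x) :: w) = tens u x + tpi w.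
Proof. by rewrite [RHS]tensor_addE. Qed.

Lemma tensr0 (X : lmodType A) u : tens u (0 : X) = 0 :> tensor U X.
Proof. by apply: (addrI (tens u (0 : X))); rewrite -tensDr !addr0. Qed.

Lemma tensor_linear_ext (X : lmodType A) (Y : lmodType B)
    (f g : {linear tensor U X -> Y}) :
  (forall u x, f (tens u x) = g (tens u x)) -> f =1 g.
Proof.
move=> fg t; rewrite -(tpi_repr t); elim: (repr t) => [|[u x] w IHw].
  by rewrite -[tpi _]/(0 : tensor U X) !linear0.
by rewrite tpi_cons !linearD fg IHw.
Qed.

Section Lift.
Variables (X : lmodType A) (Y : lmodType B) (b : U -> X -> Y).
Hypothesis bL : forall x, linear (b^~ x).
Hypothesis bD : forall u x x', b u (x + x') = b u x + b u x'.
Hypothesis bM : forall u a x, b (ract u a) x = b u (a *: x).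

Definition word_eval (w : seq (U * X)) : Y := \sum_(p <- w) b p.1 p.2.

Lemma word_eval_rel w w' : tensor_rel w w' -> word_eval w = word_eval w'.
Proof.
have bDl u u' x : b (u + u') x = b u x + b u' x.
  by have := bL x 1 u u'; rewrite !scale1r.
have b0 x : b 0 x = 0 by apply: (addrI (b 0 x)); rewrite -bDl !addr0.
rewrite /word_eval; elim=> {w w'} //.
- by move=> w1 w2 w3 _ -> _ ->.
- by move=> *; rewrite !big_cat; congr (_ + _).
- by move=> *; rewrite !big_cat; apply: addrC.
- by move=> x; rewrite big_seq1 big_nil b0.
- by move=> u u' x; rewrite !big_cons !big_nil !addr0 bDl.
- by move=> u x x'; rewrite !big_cons !big_nil !addr0 bD.
- by move=> u a x; rewrite !big_seq1 bM.
Qed.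

Fact tensor_lift_linear : linear (fun t : tensor U X => word_eval (repr t)).
Proof.
have E w : word_eval (repr (tpi w : tensor U X)) = word_eval w.
  exact/word_eval_rel/repr_tpi.
have bZ c u x : b (c *: u) x = c *: b u x.
  have b0 y : b 0 y = 0.
    apply: (addrI (b 0 y)); have := bL y 1 0 0.
    by rewrite !scale1r !addr0 => <-.
  by have := bL x c u 0; rewrite !addr0 b0 addr0.
move=> c s t; rewrite -(tpi_repr s) -(tpi_repr t).
rewrite [_ *: tpi _]tensor_scaleE [_ + _]tensor_addE !E.
rewrite /word_eval big_cat big_map scaler_sumr; congr (_ + _).
by apply: eq_bigr => p _; rewrite /= bZ.
Qed.

Definition tensor_lift : {linear tensor U X -> Y} := lin_of tensor_lift_linear.

Lemma tensor_liftE u x : tensor_lift (tens u x) = b u x.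
Proof.
rewrite -[LHS]/(word_eval (repr (tens u x))) (word_eval_rel (repr_tpi _)).
exact: big_seq1.
Qed.
End Lift.

Section Functor.
Variables X Y Z : lmodType A.

Lemma tensor_map_comp (f : {linear X -> Y}) (g : {linear Y -> Z})
    (h : {linear X -> Z}) : (forall x, h x = g (f x)) ->
  forall t, tensor_map U h t = tensor_map U g (tensor_map U f t).
Proof.
move=> hE; apply: (tensor_linear_ext (g := lin (tensor_map U g \o tensor_map U f))).
by move=> u x; rewrite /= !tensor_map_tens hE.
Qed.

Lemma tensor_map_id (f : {linear X -> X}) : (forall x, f x = x) ->
  forall t, tensor_map U f t = t.
Proof.
move=> fE; apply: (tensor_linear_ext (g := lin idfun)) => u x.
by rewrite /= tensor_map_tens fE.
Qed.

Lemma tensor_map0 (f : {linear X -> Y}) : (forall x, f x = 0) ->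
  forall t, tensor_map U f t = 0.
Proof.
move=> fE; apply: (tensor_linear_ext (g := lin \0)) => u x.
by rewrite /= tensor_map_tens fE tensr0.
Qed.

Lemma tensor_mapD (f g h : {linear X -> Y}) : (forall x, h x = f x + g x) ->
  forall t, tensor_map U h t = tensor_map U f t + tensor_map U g t.
Proof.
move=> hE.
apply: (tensor_linear_ext (g := lin (tensor_map U f \+ tensor_map U g))) => u x.
by rewrite /= !tensor_map_tens hE tensDr.
Qed.

Lemma tensor_map_surj (f : {linear X -> Y}) : surj f -> surj (tensor_map U f).
Proof.
move=> fS t; rewrite -(tpi_repr t); elim: (repr t) => [|[u y] w [s sE]].
  by exists 0; rewrite linear0.
have [x xE] := fS y; exists (tens u x + s).
by rewrite linearD /= sE tensor_map_tens xE tpi_cons.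
Qed.

End Functor.

(** The inverse of Coker (U (x) i) -> U (x) Z is built on pure tensors: u (x) z goes
    to the class of u (x) y for any y above z. *)
Lemma tensor_right_exact (X Y Z : lmodType A) (i : {linear X -> Y})
    (p : {linear Y -> Z}) :
  exact_at i p -> surj p -> exact_at (tensor_map U i) (tensor_map U p).
Proof.
move=> ip pS t; split=> [pt|[s <-]]; last first.
  rewrite -(@tensor_map_comp _ _ _ _ _ (lin \0)) ?tensor_map0 // => x.
  by rewrite (exact_at0 x ip).
apply/cokerl_exact; pose c := cokerl (tensor_map U i).
have [s sE] := choice pS.
have cE u y y' : p y = p y' -> c (tens u y) = c (tens u y').
  move=> pyy'; have /ip [x xE] : p (y - y') = 0 by rewrite linearB pyy' subrr.
  rewrite -[y](subrK y') tensDr -xE linearD -tensor_map_tens.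
  by rewrite (exact_at0 _ (@cokerl_exact _ _ _ (tensor_map U i))) add0r.
have bL z : linear (fun u => c (tens u (s z))).
  by move=> a u u'; rewrite tensDl tensZ linearP.
have bD u z z' : c (tens u (s (z + z'))) = c (tens u (s z)) + c (tens u (s z')).
  by rewrite -linearD -tensDr; apply: cE; rewrite linearD !sE.
have bM u a z : c (tens (ract u a) (s z)) = c (tens u (s (a *: z))).
  by rewrite tens_bal; apply: cE; rewrite linearZ !sE.
pose l := tensor_lift bL bD bM.
suff lE : lin (l \o tensor_map U p) =1 c.
  by rewrite -[LHS]lE -[LHS]/(l (tensor_map U p t)) pt linear0.
apply: tensor_linear_ext => u y.
rewrite -[LHS]/(l (tensor_map U p (tens u y))) tensor_map_tens tensor_liftE.
by apply: cE; rewrite sE.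
Qed.
End Tensor.

Lemma prod_projective (R : pzRingType) (P Q : lmodType R) :
  projective P -> projective Q -> projective (P * Q)%type.
Proof.
move=> Pproj Qproj M N p h pS.
pose in1 : {linear P -> (P * Q)%type} := lpair (lin idfun) (lin \0).
pose in2 : {linear Q -> (P * Q)%type} := lpair (lin \0) (lin idfun).
have [k kE] := Pproj _ _ p (lin (h \o in1)) pS.
have [l lE] := Qproj _ _ p (lin (h \o in2)) pS.
exists (lcopair k l) => -[x y].
rewrite /= linearD kE lE /= -linearD; congr (h _).
by congr (_, _); rewrite /= ?addr0 ?add0r.
Qed.

Lemma projective_lift_exact (R : pzRingType) (Q L M N : lmodType R)
    (d : {linear L -> M}) (e : {linear M -> N}) (f : {linear Q -> M}) :
  projective Q -> exact_at d e -> (forall x, e (f x) = 0) ->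
  exists g : {linear Q -> L}, forall x, d (g x) = f x.
Proof.
move=> Qproj ex ef; have [f' f'E] := ker_lift ef.
have [d' d'E] := ker_lift (fun x => exact_at0 x ex).
have [|g gE] := Qproj _ _ d' f'.
  move=> k; have /ex [x xE] : e (kerl e k) = 0 by apply/kerlP; exists k.
  by exists x; apply: (@kerl_inj _ _ _ e); rewrite d'E.
by exists g => x; rewrite -d'E gE f'E.
Qed.

Section Horseshoe.
Variables (R : pzRingType) (K M N : lmodType R).
Variables (i : {linear K -> M}) (p : {linear M -> N}).
Variables (P : resolution K) (Q : resolution N).
Hypotheses (ses : short_exact i p) (Qproj : forall j, projective (Q j)).

(** The augmentation and the differentials of a resolution are indexed uniformly,
    so that the recursion below treats its first step like the others. *)
Definition res_target (j : nat) : lmodType R := if j is k.+1 then P k else K.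
Definition res_out (j : nat) : {linear P j -> res_target j} :=
  match j return {linear P j -> res_target j} with
  | 0 => res_aug P
  | k.+1 => res_d P k
  end.
Lemma res_out_exact j : exact_at (res_d P j) (res_out j).
Proof. by case: j => [|j]; [apply: res_exact0|apply: res_exactS]. Qed.

Let twist j := {t : {linear Q j.+1 -> P j} |
  forall y, res_out j (t (res_d Q j.+1 y)) = 0}.

Lemma twist_next j (t : twist j) : exists t' : twist j.+1,
  forall y, res_d P j (sval t' y) = - sval t (res_d Q j.+1 y).
Proof.
case: t => t tE /=.
have [|t' t'E] := @projective_lift_exact _ (Q j.+2) _ _ _ (res_d P j) (res_out j)
  (lin (\- (t \o res_d Q j.+1))) (@Qproj _) (@res_out_exact j).
  by move=> y; rewrite /= linearN tE oppr0.
have t'P y : res_out j.+1 (t' (res_d Q j.+2 y)) = 0.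
  by rewrite -[LHS]/(res_d P j _) t'E /= res_dK linear0 oppr0.
by exists (exist _ t' t'P).
Qed.

(** The resolution of M has terms P j + Q j, with P and Q as a subcomplex and a
    quotient complex; what has to be chosen is the component t j from Q (j + 1)
    to P j of its differential.  Each t j is a lift of the previous one along the
    exact complex P, possible since Q (j + 1) is projective. *)
Lemma horseshoe_twist : exists (h : {linear Q 0%N -> M})
    (t : forall j, {linear Q j.+1 -> P j}),
  [/\ forall y, p (h y) = res_aug Q y,
      forall y, i (res_aug P (t 0%N y)) = - h (res_d Q 0 y)
    & forall j y, res_d P j (t j.+1 y) = - t j (res_d Q j.+1 y)].
Proof.
case: ses => iI ip pS.
have [h hE] := @Qproj 0%N _ _ p (res_aug Q) pS.
have [|c cE] := @lift_through_inj _ _ _ _ i (lin (\- (h \o res_d Q 0))) iI.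
  by move=> y; apply/ip; rewrite /= linearN hE res_augK oppr0.
have [t0 t0E] := @Qproj 1%N _ _ (res_aug P) c (@res_aug_surj _ _ P).
have t0P y : res_out 0 (t0 (res_d Q 1 y)) = 0.
  by apply: iI; rewrite /= t0E cE /= res_dK !linear0.
pose t := fix t j : twist j := match j return twist j with
  | 0 => exist _ t0 t0P
  | k.+1 => projT1 (cid (twist_next (t k)))
  end.
exists h, (fun j => sval (t j)); split=> // [y|j y].
  by rewrite /= t0E cE.
exact: (projT2 (cid (twist_next (t j)))).
Qed.

Lemma horseshoe : exists (e : {linear (P 0%N * Q 0%N)%type -> M})
    (d : forall j, {linear (P j.+1 * Q j.+1)%type -> (P j * Q j)%type}),
  [/\ [/\ surj e, exact_at (d 0%N) e & forall j, exact_at (d j.+1) (d j)],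
      forall j x, d j (x, 0) = (res_d P j x, 0)
    & forall j z, (d j z).2 = res_d Q j z.2].
Proof.
have [iI ip pS] := ses.
have [h [t [hE t0E tE]]] := horseshoe_twist.
pose e : {linear (P 0%N * Q 0%N)%type -> M} := lcopair (lin (i \o res_aug P)) h.
pose d j : {linear (P j.+1 * Q j.+1)%type -> (P j * Q j)%type} :=
  lpair (lcopair (res_d P j) (t j)) (lin (res_d Q j \o snd)).
have eE x y : e (x, y) = i (res_aug P x) + h y by [].
have dE j x y : d j (x, y) = (res_d P j x + t j y, res_d Q j y) by [].
exists e, d; split; last 2 first.
- by move=> j x; rewrite dE !linear0 addr0.
- by move=> j [x y]; rewrite dE.
split.
- move=> m; have [y yE] := @res_aug_surj _ _ Q (p m).
  have /ip [k kE] : p (m - h y) = 0 by rewrite linearB hE yE subrr.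
  have [x xE] := @res_aug_surj _ _ P k.
  by exists (x, y); rewrite eE xE kE subrK.
- move=> [x y]; rewrite eE; split=> [exy|[[x' y'] [<- <-]]]; last first.
    by rewrite linearD res_augK add0r t0E addNr.
  have /(@res_exact0 _ _ Q) [y1 y1E] : res_aug Q y = 0.
    have := congr1 p exy.
    by rewrite linearD linear0 (exact_at0 _ ip) add0r hE.
  have /(@res_exact0 _ _ P) [x1 x1E] : res_aug P (x - t 0%N y1) = 0.
    by apply: iI; rewrite !linearB t0E y1E opprK exy linear0.
  by exists (x1, y1); rewrite dE x1E y1E subrK.
- move=> j [x y]; rewrite dE; split=> [[dx dy]|[[x' y'] [<- <-]]]; last first.
    by rewrite linearD !res_dK add0r tE addNr.
  have /(@res_exactS _ _ Q) [y1 y1E] := dy.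
  have /(@res_exactS _ _ P) [x1 x1E] : res_d P j (x - t j.+1 y1) = 0.
    by rewrite linearB tE opprK y1E.
  by exists (x1, y1); rewrite dE x1E y1E subrK.
Qed.

End Horseshoe.

Section Tor.
Variables (B A : pzRingType) (U : bimodule B A).
Implicit Types K M N Z E : lmodType A.

(** The long exact sequence of Tor in the module variable.  A cycle t over the
    resolution P of K is also a cycle over the horseshoe resolution of M, where it
    bounds some s; the Q-component of s is a cycle, hence a boundary, and removing
    it from s leaves a chain over P that bounds t. *)
Lemma Tor_zero_dimension_shift i K M N (f : {linear K -> M})
    (g : {linear M -> N}) : short_exact f g ->
  Tor_zero i.+1 U M -> Tor_zero i.+2 U N -> Tor_zero i.+1 U K.
Proof.
move=> ses torM torN P Pproj t dt.
have [Q Qproj] := free_resolution N.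
have [e [d [[eS ex0 exS] dP dQ]]] := horseshoe P ses Qproj.
pose H := @Resolution A M (fun j => (P j * Q j)%type) d e eS ex0 exS.
have Hproj j : projective (H j) by apply: prod_projective.
pose in1 j : {linear P j -> (P j * Q j)%type} := lpair (lin idfun) (lin \0).
pose in2 j : {linear Q j -> (P j * Q j)%type} := lpair (lin \0) (lin idfun).
pose pr1 j : {linear (P j * Q j)%type -> P j} := lin fst.
pose pr2 j : {linear (P j * Q j)%type -> Q j} := lin snd.
pose T (X Y : lmodType A) (f : {linear X -> Y}) : {linear tensor U X -> tensor U Y} :=
  tensor_map U f.
have din1 j x : T _ _ (d j) (T _ _ (in1 j.+1) x) = T _ _ (in1 j) (T _ _ (res_d P j) x).
  rewrite /T /= -(@tensor_map_comp _ _ _ _ _ _ _ _ (lin (d j \o in1 j.+1))) //.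
  by apply: tensor_map_comp => y; rewrite /= dP.
have dpr2 j x : T _ _ (pr2 j) (T _ _ (d j) x) = T _ _ (res_d Q j) (T _ _ (pr2 j.+1) x).
  rewrite /T /= -(@tensor_map_comp _ _ _ _ _ _ _ _ (lin (pr2 j \o d j))) //.
  by apply: tensor_map_comp => y; rewrite /= dQ.
have split_id j x : x = T _ _ (in1 j) (T _ _ (pr1 j) x) + T _ _ (in2 j) (T _ _ (pr2 j) x).
  rewrite /T /= -(@tensor_map_comp _ _ _ _ _ _ _ _ (lin (in1 j \o pr1 j))) //.
  rewrite -(@tensor_map_comp _ _ _ _ _ _ _ _ (lin (in2 j \o pr2 j))) //.
  rewrite -(@tensor_mapD _ _ _ _ _ _ _ (lin idfun)) ?tensor_map_id //.
  by move=> [y z]; congr (_, _); rewrite /= ?addr0 ?add0r.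
have pr1in1 j x : T _ _ (pr1 j) (T _ _ (in1 j) x) = x.
  by rewrite /T /= -(@tensor_map_comp _ _ _ _ _ _ _ _ (lin idfun)) ?tensor_map_id.
have pr2in1 j x : T _ _ (pr2 j) (T _ _ (in1 j) x) = 0.
  by rewrite /T /= -(@tensor_map_comp _ _ _ _ _ _ _ _ (lin \0)) ?tensor_map0.
have pr2in2 j x : T _ _ (pr2 j) (T _ _ (in2 j) x) = x.
  by rewrite /T /= -(@tensor_map_comp _ _ _ _ _ _ _ _ (lin idfun)) ?tensor_map_id.
have ddQ j x : T _ _ (d j) (T _ _ (d j.+1) x) = 0.
  rewrite /T /= -(@tensor_map_comp _ _ _ _ _ _ _ _ (lin \0)) ?tensor_map0 // => y.
  by rewrite (exact_at0 _ (exS j)).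
have /= [|s sE] := torM H Hproj (T _ _ (in1 i.+1) t).
  by rewrite -[LHS]/(T _ _ (d i) _) din1 [T _ _ (res_d P i) t]dt linear0.
have /= [|s3 s3E] := torN Q Qproj (T _ _ (pr2 i.+2) s).
  by rewrite -[LHS]/(T _ _ _ _) -dpr2 [T _ _ (d _) s]sE pr2in1.
pose s' := s - T _ _ (d i.+2) (T _ _ (in2 i.+3) s3).
have ds' : T _ _ (d i.+1) s' = T _ _ (in1 i.+1) t.
  by rewrite linearB /= ddQ subr0 [LHS]sE.
have pr2s' : T _ _ (pr2 i.+2) s' = 0.
  by rewrite linearB /= dpr2 pr2in2 [T _ _ (res_d Q _) s3]s3E subrr.
exists (T _ _ (pr1 i.+2) s').
by rewrite -[RHS]pr1in1 -ds' (split_id _ s') pr2s' linear0 addr0 din1 !pr1in1.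
Qed.

(** An element killed in U (x) E is killed in the presentation of E by relations
    from U (x) P 1; these relations are cycles, hence boundaries, and boundaries
    act trivially on Z. *)
Lemma Tor_zero_injective M Z E (i : {linear Z -> E}) (p : {linear E -> M}) :
  short_exact i p -> Tor_zero 1 U M -> injective (tensor_map U i).
Proof.
move=> ses tor; have [P Pproj] := free_resolution M.
have [a [b [qS ex bd]]] := extension_presentation ses (Pproj 0%N).
set r := lpair _ _ in ex; set q := lcopair _ _ in qS ex.
apply: linear_inj => t it0.
pose in2 : {linear Z -> (P 0%N * Z)%type} := lpair (lin \0) (lin idfun).
have /(@tensor_right_exact _ _ U _ _ _ _ _ ex qS) [s sE] :
    tensor_map U q (tensor_map U in2 t) = 0.
  rewrite -(@tensor_map_comp _ _ _ _ _ _ _ _ i) // => z.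
  by rewrite /= linear0 add0r.
have /= [|s' s'E] := tor P Pproj s.
  rewrite (@tensor_map_comp _ _ _ _ _ _ r (lin fst)) // sE.
  by rewrite -(@tensor_map_comp _ _ _ _ _ _ _ _ (lin \0)) ?tensor_map0.
rewrite -[t](@tensor_map_id _ _ _ _ (lin (snd \o in2))) //.
rewrite (@tensor_map_comp _ _ _ _ _ _ in2 (lin snd)) // -sE -s'E.
rewrite -(@tensor_map_comp _ _ _ _ _ _ (res_d P 1) r (lin (r \o res_d P 1))) //.
rewrite -(@tensor_map_comp _ _ _ _ _ _ _ _ (lin \0)) ?tensor_map0 // => y.
by rewrite /= bd oppr0.
Qed.
End Tor.

(** * Modules over the Morita ring as tuples *)

(** A map c : R -> S preserving sums and products, though perhaps not 1, makes
    the image of the idempotent c 1 on an S-module an R-module.  For the diagonal idempotents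
    of the Morita ring these are the two components of a module. *)
Section Corner.
Variables (R S : pzRingType) (c : R -> S).
Hypotheses (cD : {morph c : a b / a + b}) (cM : {morph c : a b / a * b}).
Variable M : lmodType S.

Definition corner_pred : {pred M} := fun x => c 1 *: x == x.
Fact corner_zmod : zmod_closed corner_pred.
Proof.
split; first by rewrite /in_mem /= /corner_pred scaler0.
move=> x y; rewrite /in_mem /= /corner_pred => /eqP cx /eqP cy.
by rewrite scalerBr cx cy.
Qed.
HB.instance Definition _ := GRing.isZmodClosed.Build M corner_pred corner_zmod.

(** The hypotheses are parameters of the type because the scaling attached to it
    depends on them. *)
Record corner_of (cD : {morph c : a b / a + b}) (cM : {morph c : a b / a * b})
  := Corner { corner_val : M; _ : corner_val \in corner_pred }.
Notation corner := (corner_of cD cM).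
HB.instance Definition _ := [isSub for @corner_val cD cM].
HB.instance Definition _ := [Choice of corner by <:].
HB.instance Definition _ := [SubChoice_isSubZmodule of corner by <:].

Lemma cornerP (x : M) : c 1 *: x = x -> exists k : corner, corner_val k = x.
Proof. by move=> /eqP cx; exists (Corner cD cM cx). Qed.

Lemma corner_id (k : corner) : c 1 *: corner_val k = corner_val k.
Proof. by case: k => x /= /eqP. Qed.

Lemma corner_inj : injective (@corner_val cD cM).
Proof. exact: val_inj. Qed.

Lemma corner_valD : {morph @corner_val cD cM : k l / k + l}.
Proof. by []. Qed.

Lemma corner_scale_mem a (x : M) : c 1 *: (c a *: x) = c a *: x.
Proof. by rewrite scalerA -cM mul1r. Qed.

Definition corner_scale a (k : corner) : corner :=
  projT1 (cid (cornerP (corner_scale_mem a (corner_val k)))).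
Lemma corner_scaleE a k : corner_val (corner_scale a k) = c a *: corner_val k.
Proof.
exact: (projT2 (cid (cornerP (corner_scale_mem a (corner_val k))))).
Qed.

Fact corner_scaleA a b k : corner_scale a (corner_scale b k) = corner_scale (a * b) k.
Proof. by apply: corner_inj; rewrite !corner_scaleE scalerA cM. Qed.
Fact corner_scale1 : left_id 1 corner_scale.
Proof. by move=> k; apply: corner_inj; rewrite corner_scaleE corner_id. Qed.
Fact corner_scaleDr : right_distributive corner_scale +%R.
Proof.
move=> a k l; apply: corner_inj.
by rewrite corner_scaleE !corner_valD !corner_scaleE scalerDr.
Qed.
Fact corner_scaleDl k : {morph corner_scale^~ k : a b / a + b}.
Proof.
move=> a b; apply: corner_inj.
by rewrite corner_valD !corner_scaleE cD scalerDl.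
Qed.
HB.instance Definition _ := GRing.Zmodule_isLmodule.Build R corner
  corner_scaleA corner_scale1 corner_scaleDr corner_scaleDl.

Lemma corner_valZ a (k : corner) : corner_val (a *: k) = c a *: corner_val k.
Proof. exact: corner_scaleE. Qed.
End Corner.

Section Tuples.
Variables (A B : pzRingType) (V : bimodule A B) (U : bimodule B A).
Local Notation Lambda := (morita V U).
Implicit Types S T W : mtuple V U.

Record tmor T W := Tmor {
  tX : {linear mt_X T -> mt_X W};
  tY : {linear mt_Y T -> mt_Y W};
  tmor_f : forall u x, tY (mt_f T (tens u x)) = mt_f W (tens u (tX x));
  tmor_g : forall v y, tX (mt_g T (tens v y)) = mt_g W (tens v (tY y))
}.

Lemma mt_scaleE T (m : Lambda) (z : mt_mod T) :
  m *: z = (m_a m *: z.1 + mt_g T (tens (m_v m) z.2),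
            mt_f T (tens (m_u m) z.1) + m_b m *: z.2).
Proof. by []. Qed.

Definition tlin T W (m : tmor T W) : {linear mt_mod T -> mt_mod W}.
Proof.
apply: (@lin_of _ _ _ (fun z : mt_mod T => (tX m z.1, tY m z.2) : mt_mod W)).
move=> a z z'; rewrite !mt_scaleE; congr (_, _).
  by rewrite /= !linearD tmor_g linearZ.
by rewrite /= !linearD tmor_f linearZ.
Defined.

Lemma tlinE T W (m : tmor T W) x y : tlin m (x, y) = (tX m x, tY m y).
Proof. by []. Qed.

(** A linear map commutes with the two diagonal idempotents, so it preserves the
    two components; commuting with the off-diagonal matrices is compatibility with
    the structure maps. *)
Lemma tmor_of_linear T W (h : {linear mt_mod T -> mt_mod W}) :
  exists m : tmor T W, forall z, h z = tlin m z.
Proof.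
have sX m x : m *: ((x, 0) : mt_mod T) = (m_a m *: x, mt_f T (tens (m_u m) x)).
  by rewrite mt_scaleE /= tensr0 linear0 scaler0 !addr0.
have sY m y : m *: ((0, y) : mt_mod T) = (mt_g T (tens (m_v m) y), m_b m *: y).
  by rewrite mt_scaleE /= tensr0 linear0 scaler0 !add0r.
have hZ m z : h (m *: z) = m *: h z by apply: linearZ.
have hX x : h (x, 0) = ((h (x, 0)).1, 0).
  have E : (x, 0) = Morita 1 0 0 0 *: ((x, 0) : mt_mod T).
    by rewrite sX /= scale1r tens0 linear0.
  rewrite [LHS](congr1 h E) hZ mt_scaleE /=.
  by rewrite scale1r scale0r !tens0 !linear0 !addr0.
have hY y : h (0, y) = (0, (h (0, y)).2).
  have E : (0, y) = Morita 0 0 0 1 *: ((0, y) : mt_mod T).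
    by rewrite sY /= scale1r tens0 linear0.
  rewrite [LHS](congr1 h E) hZ mt_scaleE /=.
  by rewrite scale1r scale0r !tens0 !linear0 !add0r.
have Xlin : linear (fun x => (h (x, 0)).1).
  move=> a x x'.
  have -> : (a *: x + x', 0) = Morita a 0 0 0 *: ((x, 0) : mt_mod T) + (x', 0).
    by rewrite sX /= tens0 linear0; congr (_, _); rewrite /= addr0.
  by rewrite [h _]linearD hZ (hX x) mt_scaleE /= tensr0 linear0 addr0.
have Ylin : linear (fun y => (h (0, y)).2).
  move=> b y y'.
  have -> : (0, b *: y + y') = Morita 0 0 0 b *: ((0, y) : mt_mod T) + (0, y').
    by rewrite sY /= tens0 linear0; congr (_, _); rewrite /= addr0.
  by rewrite [h _]linearD hZ (hY y) mt_scaleE /= tensr0 linear0 add0r.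
have mf u x : lin_of Ylin (mt_f T (tens u x)) = mt_f W (tens u (lin_of Xlin x)).
  have := hZ (Morita 0 0 u 0 : Lambda) ((x, 0) : mt_mod T).
  by rewrite sX /= scale0r hX mt_scaleE /= => ->; rewrite /= scaler0 addr0.
have mg v y : lin_of Xlin (mt_g T (tens v y)) = mt_g W (tens v (lin_of Ylin y)).
  have := hZ (Morita 0 v 0 0 : Lambda) ((0, y) : mt_mod T).
  by rewrite sY /= scale0r hY mt_scaleE /= => ->; rewrite /= scaler0 add0r.
exists (Tmor mf mg) => -[x y].
have -> : (x, y) = ((x, 0) : mt_mod T) + (0, y).
  by congr (_, _); rewrite /= ?addr0 ?add0r.
rewrite linearD hX hY [RHS](linearD (tlin _)) !tlinE.
by congr (_, _); rewrite /= ?linear0.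
Qed.

Definition tcomp S T W (n : tmor T W) (m : tmor S T) : tmor S W.
Proof.
apply: (@Tmor S W (lin (tX n \o tX m)) (lin (tY n \o tY m))) => [u x|v y] /=.
  by rewrite !tmor_f.
by rewrite !tmor_g.
Defined.

Definition tses S T W (j : tmor S T) (q : tmor T W) :=
  short_exact (tX j) (tX q) /\ short_exact (tY j) (tY q).

Lemma tsesP S T W (j : tmor S T) (q : tmor T W) :
  tses j q <-> short_exact (tlin j) (tlin q).
Proof.
split=> [[[jX eX qX] [jY eY qY]]|[jI ex qS]].
  split.
  - by move=> [x y] [x' y']; rewrite !tlinE => -[/jX -> /jY ->].
  - move=> [x y]; rewrite tlinE; split=> [[/eX [x' <-] /eY [y' <-]]|[[x' y']]].
      by exists (x', y').
    by rewrite tlinE => -[<- <-]; congr (_, _); apply/(exact_at0 _ _).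
  - by move=> [x y]; have [x' <-] := qX x; have [y' <-] := qY y; exists (x', y').
split; split.
- move=> x x' jx; have /jI [] // : tlin j (x, 0) = tlin j (x', 0).
  by rewrite !tlinE jx.
- move=> x; split=> [qx|[x' xE]].
    have /ex [[x' y']] : tlin q (x, 0) = 0 by rewrite tlinE qx linear0.
    by rewrite tlinE => -[<- _]; exists x'.
  have : tlin q (x, 0) = 0 by apply/ex; exists (x', 0); rewrite tlinE xE linear0.
  by rewrite tlinE => -[].
- by move=> x; have [[x' y']] := qS (x, 0); rewrite tlinE => -[<- _]; exists x'.
- move=> y y' jy; have /jI [] // : tlin j (0, y) = tlin j (0, y').
  by rewrite !tlinE jy.
- move=> y; split=> [qy|[y' yE]].
    have /ex [[x' y']] : tlin q (0, y) = 0 by rewrite tlinE qy linear0.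
    by rewrite tlinE => -[_ <-]; exists y'.
  have : tlin q (0, y) = 0 by apply/ex; exists (0, y'); rewrite tlinE yE linear0.
  by rewrite tlinE => -[].
- by move=> y; have [[x' y']] := qS (0, y); rewrite tlinE => -[_ <-]; exists y'.
Qed.

Lemma tuple_isomorphic T W :
  isomorphic (mt_mod T : lmodType Lambda) (mt_mod W) <->
  exists m : tmor T W, bijective (tX m) /\ bijective (tY m).
Proof.
split=> [[h hB]|[m [[X XK KX] [Y YK KY]]]]; last first.
  exists (tlin m); exists (fun z : mt_mod W => (X z.1, Y z.2) : mt_mod T).
    by move=> [x y]; rewrite tlinE /= XK YK.
  by move=> [x y]; rewrite tlinE KX KY.
have [m mE] := tmor_of_linear h; exists m.
have hI := bij_inj hB; case: hB => k _ kK.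
split; apply: inj_surj_bij.
- move=> x x' mx; have /hI [] // : h (x, 0) = h (x', 0).
  by rewrite !mE !tlinE mx.
- move=> x; have := kK (x, 0); case: (k _) => x' y'.
  by rewrite mE tlinE => -[<- _]; exists x'.
- move=> y y' my; have /hI [] // : h (0, y) = h (0, y').
  by rewrite !mE !tlinE my.
- move=> y; have := kK (0, y); case: (k _) => x' y'.
  by rewrite mE tlinE => -[_ <-]; exists y'.
Qed.

Lemma U_classP (C : modclass A) (D : modclass B) T : is_class C -> is_class D ->
  U_class V U C D (mt_mod T) <-> C (mt_X T) /\ D (mt_Y T).
Proof.
move=> [_ Ciso] [_ Diso]; split=> [[W [/tuple_isomorphic [m [mX mY]] [CW DW]]]|CD].
  by split; [apply: Ciso CW; exists (tX m)|apply: Diso DW; exists (tY m)].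
by exists T; split=> //; apply: isomorphic_refl.
Qed.

(** The Peirce decomposition: the components are the images of the two diagonal
    idempotents, and the structure maps are the actions of the off-diagonal
    matrices, whose products vanish. *)
Lemma tuple_of_module (M : lmodType Lambda) :
  exists T, isomorphic (mt_mod T : lmodType Lambda) M.
Proof.
pose cA (a : A) : Lambda := Morita a 0 0 0.
pose cB (b : B) : Lambda := Morita 0 0 0 b.
have mD (m m' : Lambda) : m + m' = Morita (m_a m + m_a m') (m_v m + m_v m')
    (m_u m + m_u m') (m_b m + m_b m') by [].
have mM (m m' : Lambda) : m * m' = Morita (m_a m * m_a m')
    (m_a m *: m_v m' + ract (m_v m) (m_b m'))
    (ract (m_u m) (m_a m') + m_b m *: m_u m') (m_b m * m_b m') by [].
have E := (mM, mD, mulr0, mul0r, mulr1, mul1r, addr0, add0r, scaler0, scale0r,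
           scale1r, @ract0, @ract1).
have ract_0 (R S : pzRingType) (W : bimodule R S) (w : W) : ract w 0 = 0.
  by apply: (addrI (ract w 0)); rewrite -ractDr !addr0.
have cAD : {morph cA : a b / a + b} by move=> a b; rewrite E /= !E.
have cAM : {morph cA : a b / a * b}.
  by move=> a b; rewrite E /= !E.
have cBD : {morph cB : a b / a + b} by move=> a b; rewrite E /= !E.
have cBM : {morph cB : a b / a * b} by move=> a b; rewrite E /= !E.
pose X : lmodType A := corner_of M cAD cAM.
pose Y : lmodType B := corner_of M cBD cBM.
pose vX (x : X) : M := corner_val x; pose vY (y : Y) : M := corner_val y.
have vXD x x' : vX (x + x') = vX x + vX x' by [].
have vYD y y' : vY (y + y') = vY y + vY y' by [].
have vXZ a x : vX (a *: x) = cA a *: vX x by apply: corner_valZ.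
have vYZ b y : vY (b *: y) = cB b *: vY y by apply: corner_valZ.
have vX1 x : cA 1 *: vX x = vX x by apply: corner_id.
have vY1 y : cB 1 *: vY y = vY y by apply: corner_id.
have vXI : injective vX by apply: corner_inj.
have vYI : injective vY by apply: corner_inj.
pose uu u : Lambda := Morita 0 0 u 0; pose vv v : Lambda := Morita 0 v 0 0.
have [bf bfE] : exists bf : U -> X -> Y, forall u x, vY (bf u x) = uu u *: vX x.
  have mem u (x : X) : cB 1 *: (uu u *: vX x) = uu u *: vX x.
    by rewrite scalerA E /= !E ?ract_0 ?E.
  exists (fun u x => projT1 (cid (cornerP cBD cBM (mem u x)))) => u x.
  exact: (projT2 (cid (cornerP cBD cBM (mem u x)))).
have [bg bgE] : exists bg : V -> Y -> X, forall v y, vX (bg v y) = vv v *: vY y.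
  have mem v (y : Y) : cA 1 *: (vv v *: vY y) = vv v *: vY y.
    by rewrite scalerA E /= !E ?ract_0 ?E.
  exists (fun v y => projT1 (cid (cornerP cAD cAM (mem v y)))) => v y.
  exact: (projT2 (cid (cornerP cAD cAM (mem v y)))).
have bfL x : linear (bf^~ x).
  move=> b u u'; apply: vYI; rewrite vYD vYZ !bfE scalerA -scalerDl.
  by rewrite E /= !E ?ract_0 ?E.
have bfD u x x' : bf u (x + x') = bf u x + bf u x'.
  by apply: vYI; rewrite vYD !bfE vXD scalerDr.
have bfM u a x : bf (ract u a) x = bf u (a *: x).
  by apply: vYI; rewrite !bfE vXZ scalerA E /= !E ?ract_0 ?E.
have bgL y : linear (bg^~ y).
  move=> a v v'; apply: vXI; rewrite vXD vXZ !bgE scalerA -scalerDl.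
  by rewrite E /= !E ?ract_0 ?E.
have bgD v y y' : bg v (y + y') = bg v y + bg v y'.
  by apply: vXI; rewrite vXD !bgE vYD scalerDr.
have bgM v b y : bg (ract v b) y = bg v (b *: y).
  by apply: vXI; rewrite !bgE vYZ scalerA E /= !E ?ract_0 ?E.
pose f := tensor_lift bfL bfD bfM; pose g := tensor_lift bgL bgD bgM.
have fE u x : f (tens u x) = bf u x by apply: tensor_liftE.
have gE v y : g (tens v y) = bg v y by apply: tensor_liftE.
have gf0 s : adj g (f s) = 0.
  apply: (tensor_linear_ext (f := lin (adj g \o f)) (g := lin \0)) => u x.
  apply: bimHom_ext => v; rewrite -[LHS]/(g (tens v (f (tens u x)))).
  by apply: vXI; rewrite fE gE bgE bfE scalerA E /= !E ?ract_0 ?E.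
have gf t : g (tensor_map V f t) = 0.
  apply: (tensor_linear_ext (f := lin (g \o tensor_map V f)) (g := lin \0)).
  move=> v s; rewrite /= tensor_map_tens.
  exact: (congr1 (fun h => bimHom_app h v) (gf0 s)).
have fg0 s : adj f (g s) = 0.
  apply: (tensor_linear_ext (f := lin (adj f \o g)) (g := lin \0)) => v y.
  apply: bimHom_ext => u; rewrite -[LHS]/(f (tens u (g (tens v y)))).
  by apply: vYI; rewrite gE fE bfE bgE scalerA E /= !E ?ract_0 ?E.
have fg t : f (tensor_map U g t) = 0.
  apply: (tensor_linear_ext (f := lin (f \o tensor_map U g)) (g := lin \0)).
  move=> u s; rewrite /= tensor_map_tens.
  exact: (congr1 (fun h => bimHom_app h u) (fg0 s)).
pose T : mtuple V U := @MTuple _ _ V U X Y f g gf fg.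
have hL : linear (fun z : mt_mod T => vX z.1 + vY z.2).
  move=> m [x y] [x' y'].
  rewrite -[LHS]/(vX (m_a m *: x + g (tens (m_v m) y) + x') +
                  vY (f (tens (m_u m) x) + m_b m *: y + y')).
  rewrite -[(x, y).1]/x -[(x, y).2]/y -[(x', y').1]/x' -[(x', y').2]/y' !vXD !vYD.
  rewrite fE gE bfE bgE vXZ vYZ.
  have mz : m *: (vX x + vY y) =
      cA (m_a m) *: vX x + vv (m_v m) *: vY y + (uu (m_u m) *: vX x + cB (m_b m) *: vY y).
    rewrite scalerDr -[in LHS](vX1 x) -[in LHS](vY1 y) !scalerA.
    have -> : m * cA 1 = cA (m_a m) + uu (m_u m) by rewrite !E /= ?ract_0 ?E.
    have -> : m * cB 1 = vv (m_v m) + cB (m_b m) by rewrite !E /= ?ract_0 ?E.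
    by rewrite !scalerDl addrACA.
  by rewrite mz addrACA.
exists T; apply: (@isomorphic_inj_surj _ _ _ (lin_of hL)).
  apply: linear_inj => -[x y]; rewrite -[lin_of hL _]/(vX x + vY y) => xy0.
  have x0 : vX x = 0.
    have := congr1 ( *:%R (cA 1)) xy0; rewrite scalerDr vX1 -[vY y]vY1 scalerA.
    by rewrite E /= !E ?ract_0 ?E.
  by congr (_, _); [apply: vXI|apply: vYI; rewrite -[vY y]add0r -x0].
move=> z; have [x xE] : exists x : X, vX x = cA 1 *: z.
  by apply: cornerP; rewrite scalerA -cAM mulr1.
have [y yE] : exists y : Y, vY y = cB 1 *: z.
  by apply: cornerP; rewrite scalerA -cBM mulr1.
exists (x, y).
by rewrite -[LHS]/(vX x + vY y) xE yE -scalerDl E /= !E.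
Qed.

End Tuples.

Section Swap.
Variables (A B : pzRingType) (V : bimodule A B) (U : bimodule B A).

(** The roles of the two rings are exchanged on tuples rather than on modules: the
    components of a swapped tuple are convertible to the original ones, so
    statements about components transfer without any transport. *)
Definition tswap (T : mtuple V U) : mtuple U V :=
  MTuple (mt_fUg (m:=T)) (mt_gVf (m:=T)).

Definition tmor_swap (T W : mtuple V U) (m : tmor T W) :
    tmor (tswap T) (tswap W) :=
  @Tmor _ _ U V (tswap T) (tswap W) (tY m) (tX m) (tmor_g m) (tmor_f m).

End Swap.

Section SwapHom.
Variables (A B : pzRingType) (V : bimodule A B) (U : bimodule B A).

(** Swapping is involutive on components up to conversion, but not on tuples;
    these variants avoid double swaps. *)
Definition tmor_swapl (T : mtuple V U) (W : mtuple U V) (m : tmor (tswap T) W) :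
    tmor T (tswap W) :=
  @Tmor _ _ V U T (tswap W) (tY m) (tX m) (tmor_g m) (tmor_f m).

Definition tmor_swapr (T : mtuple V U) (W : mtuple U V) (m : tmor T (tswap W)) :
    tmor (tswap T) W :=
  @Tmor _ _ U V (tswap T) W (tY m) (tX m) (tmor_g m) (tmor_f m).

End SwapHom.

(** * The right adjoint of the first component *)

Section Hom.
Variables (B A : pzRingType) (U : bimodule B A).
Implicit Types X Y Z : lmodType B.

Fact hom_map_linear Y Z (f : {linear Y -> Z}) : linear (hom_map U f).
Proof. by move=> a h k; apply: bimHom_ext => u; apply: (linearD f). Qed.

Definition hom_lin Y Z (f : {linear Y -> Z}) : {linear bimHom U Y -> bimHom U Z} :=
  lin_of (hom_map_linear f).

Lemma hom_lin_ses X Y Z (i : {linear X -> Y}) (p : {linear Y -> Z}) :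
  short_exact i p ->
  (forall h : {linear U -> Z}, exists k : {linear U -> Y}, forall u, p (k u) = h u) ->
  short_exact (hom_lin i) (hom_lin p).
Proof.
move=> [iI ip pS] lift; split.
- move=> h k hk; apply: bimHom_ext => u; apply: iI.
  exact: (congr1 (fun l => bimHom_app l u) hk).
- move=> h; split=> [ph|[k <-]].
    have [|k kE] := @lift_through_inj _ _ _ _ i (h : {linear U -> Y}) iI.
      by move=> u; apply/ip; apply: (congr1 (fun l => bimHom_app l u) ph).
    by exists (k : bimHom U X); apply: bimHom_ext => u; apply: kE.
  by apply: bimHom_ext => u; apply: (exact_at0 _ ip).
- move=> h; have [k kE] := lift (h : {linear U -> Z}).
  by exists (k : bimHom U Y); apply: bimHom_ext => u; apply: kE.
Qed.

Fact eval_linear Y (h : bimHom U Y) : linear (fun u => bimHom_app h u).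
Proof. by move=> b u u'; rewrite /bimHom_app linearP. Qed.
Fact eval_add Y (u : U) (h k : bimHom U Y) :
  bimHom_app (h + k) u = bimHom_app h u + bimHom_app k u.
Proof. by []. Qed.
Fact eval_balanced Y (u : U) (a : A) (h : bimHom U Y) :
  bimHom_app h (ract u a) = bimHom_app (a *: h) u.
Proof. by []. Qed.

Definition hom_eval Y : {linear tensor U (bimHom U Y) -> Y} :=
  tensor_lift (@eval_linear Y) (@eval_add Y) (@eval_balanced Y).

Arguments hom_eval : simpl never.

Lemma hom_evalE Y u (h : bimHom U Y) : hom_eval Y (tens u h) = bimHom_app h u.
Proof. exact: tensor_liftE. Qed.

Lemma adjE (X : lmodType A) Y (f : {linear tensor U X -> Y}) x u :
  bimHom_app (adj f x) u = f (tens u x).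
Proof. by []. Qed.

End Hom.

Section HomTuple.
Variables (A B : pzRingType) (V : bimodule A B) (U : bimodule B A).
Implicit Types K X M P : lmodType A.

Fact hom_tuple_gVf K t :
  hom_eval V K (tensor_map V (lin \0 : {linear tensor U K -> bimHom V K}) t) = 0.
Proof. by rewrite tensor_map0 // linear0. Qed.

(** The value at K of the right adjoint of T |-> X:
    H_A K = [K, Hom_A(V, K), 0, id]. *)
Definition hom_tuple K : mtuple V U :=
  @MTuple A B V U K (bimHom V K) (lin \0) (hom_eval V K)
    (@hom_tuple_gVf K) (fun=> erefl).

Definition hom_tuple_map K X (f : {linear K -> X}) :
  tmor (hom_tuple K) (hom_tuple X).
Proof.
apply: (@Tmor _ _ V U (hom_tuple K) (hom_tuple X) f (hom_lin V f)) => [u x|v h].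
  exact: linear0.
rewrite -[LHS]/(f (hom_eval V K (tens v h))) hom_evalE.
by rewrite -[RHS]/(hom_eval V X (tens v (hom_lin V f h))) hom_evalE.
Defined.

Lemma hom_tuple_ses K X M (i : {linear K -> X}) (p : {linear X -> M}) :
  short_exact i p ->
  (forall h : {linear V -> M}, exists k : {linear V -> X}, forall v, p (k v) = h v) ->
  tses (hom_tuple_map i) (hom_tuple_map p).
Proof. by move=> ses lift; split; [|apply: hom_lin_ses]. Qed.

(** The pullback of the unit T -> H_A X along H_A P -> H_A X.  The kernel H_A K of
    the latter does not change, and the first component becomes P since the unit is
    the identity there. *)
Lemma hom_tuple_pullback (T : mtuple V U) K P (i : {linear K -> P})
    (p : {linear P -> mt_X T}) :
  short_exact i p ->
  (forall h : {linear V -> mt_X T}, exists k : {linear V -> P},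
     forall v, p (k v) = h v) ->
  exists (T' : mtuple V U) (j : tmor (hom_tuple K) T') (q : tmor T' T),
    tses j q /\ isomorphic P (mt_X T').
Proof.
move=> [iI ip pS] lift.
pose d : {linear (bimHom V P * mt_Y T)%type -> bimHom V (mt_X T)} :=
  lcopair (hom_lin V p) (lin (\- adj (mt_g T))).
pose Y := kermod d; pose e : {linear Y -> (bimHom V P * mt_Y T)%type} := kerl d.
have dP h y : d (h, y) = 0 <-> forall v, p (bimHom_app h v) = mt_g T (tens v y).
  rewrite -[d _]/(hom_lin V p h - adj (mt_g T) y); split=> [/eqP|E].
    by rewrite subr_eq0 => /eqP E v; apply: (congr1 (fun l => bimHom_app l v) E).
  by apply/eqP; rewrite subr_eq0; apply/eqP/bimHom_ext => v; rewrite adjE -E.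
have eP w v : p (bimHom_app (e w).1 v) = mt_g T (tens v (e w).2).
  by apply: (dP _ _).1; rewrite -surjective_pairing; apply/kerlP; exists w.
have [f fE] : exists f : {linear tensor U P -> Y},
    forall t, e (f t) = (0, mt_f T (tensor_map U p t)).
  apply: (ker_lift (g := lpair (lin \0) (lin (mt_f T \o tensor_map U p)))) => t.
  apply/dP => v; rewrite -[RHS]/(mt_g T (tens v (mt_f T (tensor_map U p t)))).
  by rewrite -tensor_map_tens mt_gVf; apply: linear0.
pose g : {linear tensor V Y -> P} :=
  lin (hom_eval V P \o tensor_map V (lin (fst \o e))).
have gE v w : g (tens v w) = bimHom_app (e w).1 v.
  rewrite -[LHS]/(hom_eval V P (tensor_map V (lin (fst \o e)) (tens v w))).
  by rewrite tensor_map_tens hom_evalE.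
have gf t : g (tensor_map V f t) = 0.
  apply: (tensor_linear_ext (f := lin (g \o tensor_map V f)) (g := lin \0)).
  move=> v s; rewrite -[LHS]/(g (tensor_map V f (tens v s))) tensor_map_tens.
  by rewrite gE fE.
have fg t : f (tensor_map U g t) = 0.
  apply: (tensor_linear_ext (f := lin (f \o tensor_map U g)) (g := lin \0)).
  move=> u s; rewrite -[LHS]/(f (tensor_map U g (tens u s))) tensor_map_tens.
  apply: (@kerl_inj _ _ _ d); rewrite linear0 [LHS]fE tensor_map_tens.
  have -> : p (g s) = mt_g T (tensor_map V (lin (snd \o e)) s).
    apply: (tensor_linear_ext (f := lin (p \o g))
      (g := lin (mt_g T \o tensor_map V (lin (snd \o e))))) => v w.
    rewrite -[LHS]/(p (g (tens v w))) gE eP.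
    by rewrite -[RHS]/(mt_g T (tensor_map V _ (tens v w))) tensor_map_tens.
  by rewrite -tensor_map_tens mt_fUg.
pose T' : mtuple V U := @MTuple _ _ V U P Y f g gf fg.
have [k kE] : exists k : {linear bimHom V K -> Y},
    forall h, e (k h) = (hom_lin V i h, 0).
  apply: (ker_lift (g := lpair (hom_lin V i) (lin \0))) => h.
  by apply/dP => v; rewrite tensr0 linear0; apply: (exact_at0 _ ip).
have jf u x : k (mt_f (hom_tuple K) (tens u x)) = f (tens u (i x)).
  apply: (@kerl_inj _ _ _ d); rewrite [LHS]kE [RHS]fE tensor_map_tens.
  by rewrite (exact_at0 _ ip) tensr0 !linear0.
have jg v h : i (mt_g (hom_tuple K) (tens v h)) = g (tens v (k h)).
  rewrite -[LHS]/(i (hom_eval V K (tens v h))) hom_evalE.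
  by rewrite gE [e _]kE.
have qf u x : (e (f (tens u x))).2 = mt_f T (tens u (p x)).
  by rewrite fE tensor_map_tens.
have qg v w : p (g (tens v w)) = mt_g T (tens v (e w).2) by rewrite gE eP.
pose j : tmor (hom_tuple K) T' := @Tmor _ _ V U (hom_tuple K) T' i k jf jg.
pose q : tmor T' T := @Tmor _ _ V U T' T p (lin (snd \o e)) qf qg.
exists T', j, q; split; last exact: isomorphic_refl.
split=> //; split.
- move=> h h' /(congr1 e); rewrite [e _]kE [e _]kE => -[E].
  apply: bimHom_ext => v; apply: iI.
  exact: (congr1 (@^~ v) E).
- move=> w; rewrite -[tY q w]/((e w).2); split=> [w2|[h <-]]; last by rewrite [e _]kE.
  have pw v : p (bimHom_app (e w).1 v) = 0 by rewrite eP w2 tensr0 linear0.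
  have [|h hE] := @lift_through_inj _ _ _ _ i ((e w).1 : {linear V -> P}) iI.
    by move=> v; apply/ip; apply: pw.
  exists (h : bimHom V K); apply: (@kerl_inj _ _ _ d); rewrite [LHS]kE.
  rewrite [RHS]surjective_pairing -[kerl d w]/(e w) w2; congr (_, _).
  by apply: bimHom_ext => v; apply: hE.
- move=> y; have [h hE] := lift (adj (mt_g T) y : {linear V -> mt_X T}).
  have /kerlP [w wE] : d (h : bimHom V P, y) = 0 by apply/dP => v; rewrite hE.
  by exists w; rewrite -[LHS]/((kerl d w).2) wE.
Qed.

End HomTuple.

(** * The modules of the class J *)

Definition J_pred (A B : pzRingType) (V : bimodule A B) (U : bimodule B A)
    (C : modclass A) (D : modclass B) (T : mtuple V U) :=
  [/\ ker_in C (adj (mt_f T)), ker_in D (adj (mt_g T)),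
      exact_at (adj (mt_f T)) (hom_map U (adj (mt_g T)))
    & exact_at (adj (mt_g T)) (hom_map V (adj (mt_f T)))].

Section Cofree.
Variables (A B : pzRingType) (V : bimodule A B) (U : bimodule B A).
Implicit Types (S T : mtuple V U) (K : lmodType A) (L : lmodType B).

Lemma J_pred_swap C D T : J_pred C D T -> J_pred D C (tswap T).
Proof. by case. Qed.

Definition cofree_map T (K : lmodType A) (L : lmodType B)
    (r : {linear mt_X T -> K}) (s : {linear mt_Y T -> L}) :
    {linear mt_X T -> (K * bimHom U L)%type} :=
  lpair r (adj (lin (s \o mt_f T))).

Lemma cofree_mapE T K L (r : {linear mt_X T -> K}) (s : {linear mt_Y T -> L}) x :
  cofree_map r s x = (r x, adj (lin (s \o mt_f T)) x).
Proof. by []. Qed.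

(** By exactness the image of X -> Hom(U, Y) consists of the maps that
    Y -> Hom(V, X) kills, that is, of Hom(U, L). *)
Lemma J_ses T K L (k : {linear K -> mt_X T}) (l : {linear L -> mt_Y T}) :
  injective k -> exact_at k (adj (mt_f T)) ->
  injective l -> exact_at l (adj (mt_g T)) ->
  exact_at (adj (mt_f T)) (hom_map U (adj (mt_g T))) ->
  exists2 m : {linear mt_X T -> bimHom U L}, short_exact k m &
    forall x u, l (bimHom_app (m x) u) = mt_f T (tens u x).
Proof.
move=> kI ek lI el ex.
have lI' : injective (hom_lin U l).
  move=> h h' hh; apply: bimHom_ext => u; apply: lI.
  exact: (congr1 (fun h => bimHom_app h u) hh).
have im h : hom_lin U (adj (mt_g T)) h = 0 -> exists h', hom_lin U l h' = h.
  move=> gh; have [|h' hE] := @lift_through_inj _ _ _ _ l (h : {linear U -> _}) lI.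
    by move=> u; apply/el; apply: (congr1 (fun h => bimHom_app h u) gh).
  by exists (h' : bimHom U L); apply: bimHom_ext => u; apply: hE.
have [|m mE] := @lift_through_inj _ _ _ _ (hom_lin U l) (adj (mt_f T)) lI'.
  by move=> x; apply: im; apply/ex; exists x.
exists m => [|x u]; last exact: (congr1 (fun h => bimHom_app h u) (mE x)).
split=> //.
- move=> x; rewrite -ek -mE; split=> [->|mx]; first exact: linear0.
  exact: linear_inj0 lI' mx.
- move=> h; have [|x xE] := (ex (hom_lin U l h)).1.
    by apply: bimHom_ext => u; apply: (exact_at0 _ el).
  by exists x; apply: lI'; rewrite mE.
Qed.

Lemma cofree_map_bij T K L (k : {linear K -> mt_X T}) (l : {linear L -> mt_Y T})
    (m : {linear mt_X T -> bimHom U L})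
    (r : {linear mt_X T -> K}) (s : {linear mt_Y T -> L}) :
  cancel k r -> cancel l s -> short_exact k m ->
  (forall x u, l (bimHom_app (m x) u) = mt_f T (tens u x)) ->
  injective (cofree_map r s) /\ surj (cofree_map r s).
Proof.
move=> kK lK [kI ek mS] mE.
have sfE x : adj (lin (s \o mt_f T)) x = m x.
  by apply: bimHom_ext => u; rewrite adjE /= -mE lK.
split.
  apply: linear_inj => x; rewrite cofree_mapE sfE => /pair_equal_spec [rx].
  by move=> /ek [z zE]; rewrite -zE -[z]kK zE rx linear0.
move=> [c h]; have [x xE] := mS h; exists (x + k (c - r x)).
rewrite cofree_mapE sfE [r _]linearD [m _]linearD (exact_at0 _ ek) addr0 xE.
by rewrite kK [r x + _]addrC subrK.
Qed.
End Cofree.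

Section CofreeTuples.
Variables (A B : pzRingType) (V : bimodule A B) (U : bimodule B A).
Implicit Types (S T : mtuple V U) (K X : lmodType A) (L Y : lmodType B).

(** T is the direct sum of H_A K and H_B L with projections r and s, expressed on
    components: X is K + Hom(U, L) and Y is L + Hom(V, K). *)
Definition cofree T K L (r : {linear mt_X T -> K}) (s : {linear mt_Y T -> L}) :=
  [/\ injective (cofree_map r s), surj (cofree_map r s),
      injective (@cofree_map _ _ U V (tswap T) L K s r)
    & surj (@cofree_map _ _ U V (tswap T) L K s r)].

Lemma J_cofree (C : modclass A) (D : modclass B) T : J_pred C D T ->
  (forall Y X, D Y -> C X -> ext_extends (bimHom U Y : lmodType A) X) ->
  (forall X Y, C X -> D Y -> ext_extends (bimHom V X : lmodType B) Y) ->
  exists K L (r : {linear mt_X T -> K}) (s : {linear mt_Y T -> L}),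
    [/\ C K, D L & cofree r s].
Proof.
case=> [[K [k [kI ek CK]]] [L [l [lI el DL]]] exf exg] extC extD.
have [m mses mE] := J_ses kI ek lI el exf.
have [n nses nE] := @J_ses _ _ U V (tswap T) L K l k lI el kI ek exg.
have [r kK] := extends_retract (extC _ _ DL CK) mses.
have [s lK] := extends_retract (extD _ _ CK DL) nses.
exists K, L, r, s; split=> //.
have [? ?] := cofree_map_bij kK lK mses mE.
by have [? ?] := @cofree_map_bij _ _ U V (tswap T) L K l k n s r lK kK nses nE.
Qed.

(** The universal property of a sum of values of the right adjoints.  Compatibility
    with f and g may be tested after the projections, where the composites g f and
    f g vanish. *)
Lemma cofree_tmor T K L (r : {linear mt_X T -> K}) (s : {linear mt_Y T -> L}) S
    (a : {linear mt_X S -> K}) (b : {linear mt_Y S -> L}) : cofree r s ->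
  exists m : tmor S T, (forall x, r (tX m x) = a x) /\ (forall y, s (tY m y) = b y).
Proof.
case=> rI rS sI sS.
have [|mX mXE] := @lift_through_inj _ _ _ _ _
    (cofree_map (T := S) a b) rI.
  by move=> x; apply: rS.
have [|mY mYE] := @lift_through_inj _ _ _ _ _
    (@cofree_map _ _ U V (tswap S) L K b a) sI.
  by move=> y; apply: sS.
have rX x : r (mX x) = a x := congr1 fst (mXE x).
have sY y : s (mY y) = b y := congr1 fst (mYE y).
have sf x u : s (mt_f T (tens u (mX x))) = b (mt_f S (tens u x)) :=
  congr1 (fun p : (K * bimHom U L)%type => bimHom_app p.2 u) (mXE x).
have rg y v : r (mt_g T (tens v (mY y))) = a (mt_g S (tens v y)) :=
  congr1 (fun p : (L * bimHom V K)%type => bimHom_app p.2 v) (mYE y).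
have mf u x : mY (mt_f S (tens u x)) = mt_f T (tens u (mX x)).
  apply: sI; rewrite !cofree_mapE; congr (_, _); first by rewrite /= sY sf.
  apply: bimHom_ext => v; rewrite !adjE /= rg.
  by rewrite -!tensor_map_tens !mt_gVf !linear0.
have mg v y : mX (mt_g S (tens v y)) = mt_g T (tens v (mY y)).
  apply: rI; rewrite !cofree_mapE; congr (_, _); first by rewrite rX rg.
  apply: bimHom_ext => u; rewrite !adjE /= sf.
  by rewrite -!tensor_map_tens !mt_fUg !linear0.
by exists (Tmor mf mg).
Qed.

Lemma cofree_tmor_inj T K L (r : {linear mt_X T -> K}) (s : {linear mt_Y T -> L}) S
    (m n : tmor S T) : cofree r s ->
  (forall x, r (tX m x) = r (tX n x)) -> (forall y, s (tY m y) = s (tY n y)) ->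
  tX m =1 tX n /\ tY m =1 tY n.
Proof.
case=> rI _ sI _ rmn smn; split=> [x|y].
  apply: rI; rewrite !cofree_mapE rmn; congr (_, _); apply: bimHom_ext => u.
  by rewrite !adjE /= -!tmor_f smn.
apply: sI; rewrite !cofree_mapE /= smn; congr (_, _); apply: bimHom_ext => v.
by rewrite !adjE /= -!tmor_g rmn.
Qed.

(** Here the first kernel is K and the second is zero. *)
Lemma hom_tuple_J (C : modclass A) (D : modclass B) K :
  (forall L, zero_module L -> D L) -> C K -> J_pred C D (hom_tuple V U K).
Proof.
move=> D0 CK.
have f0 x : adj (mt_f (hom_tuple V U K)) x = 0 by apply: bimHom_ext.
have gE h : adj (mt_g (hom_tuple V U K)) h = h.
  by apply: bimHom_ext => v; rewrite adjE; apply: hom_evalE.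
split.
- exists K, (lin idfun); split=> // x.
  by split=> _; [exists x|apply: f0].
- exists (zeromod (bimHom V K : lmodType B)),
    (kerl (idfun : {linear bimHom V K -> bimHom V K})).
  split; [exact: kerl_inj| |exact/D0/zeromod0].
  move=> h; have e := kerlP (idfun : {linear bimHom V K -> bimHom V K}) h.
  split=> [gh|/e hE]; first by apply/e; apply: etrans (esym (gE h)) gh.
  exact: etrans (gE h) hE.
- move=> h; split=> [gh|[x <-]]; last first.
    by rewrite f0; apply: bimHom_ext => u; apply: linear0.
  exists 0; rewrite f0; apply: bimHom_ext => u.
  by rewrite -[RHS]gE; apply/esym/(congr1 (fun l => bimHom_app l u) gh).
- move=> h; split=> _; first by exists h; rewrite gE.
  by apply: bimHom_ext => v; apply: bimHom_ext.
Qed.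

End CofreeTuples.

Section Isomorphisms.
Variables (R : pzRingType).
Lemma ext_extends_iso (M M' N N' : lmodType R) :
  isomorphic M M' -> isomorphic N N' -> ext_extends M N -> ext_extends M' N'.
Proof.
case=> [f /linear_inverse [f' [fK f'K]]] [g /linear_inverse [g' [gK g'K]]] ext.
move=> Z E i p [iI ip pS] h.
have [|k kE] := ext Z E i (lin (f' \o p)) _ (lin (g' \o h)).
  split=> // [e|m].
    by rewrite -ip; split=> /= [/(linear_inj0 (can_inj f'K))|->]; rewrite ?linear0.
  by have [e eE] := pS (f m); exists e; rewrite /= eE fK.
by exists (lin (g \o k)) => z; rewrite /= kE /= g'K.
Qed.

Lemma short_exact_iso (Z E Z' E' M : lmodType R) (a : {linear Z -> Z'})
    (b : {linear E -> E'}) (i : {linear Z -> E}) (i' : {linear Z' -> E'})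
    (p' : {linear E' -> M}) :
  bijective a -> bijective b -> (forall z, b (i z) = i' (a z)) ->
  short_exact i' p' -> short_exact i (lin (p' \o b)).
Proof.
move=> [a' aK a'K] [b' bK b'K] bi [iI ip pS]; split.
- by move=> z z' iz; apply: (can_inj aK); apply: iI; rewrite -!bi iz.
- move=> e; rewrite /= ip; split=> [[z' zE]|[z <-]].
    by exists (a' z'); apply: (can_inj bK); rewrite bi a'K.
  by exists (a z); rewrite bi.
- by move=> m; have [e eE] := pS m; exists (b' e); rewrite /= b'K.
Qed.
End Isomorphisms.

Section Orthogonality.
Variables (A B : pzRingType) (V : bimodule A B) (U : bimodule B A).
Local Notation Lambda := (morita V U).

Lemma tuple_ses (M : lmodType Lambda) (T : mtuple V U) (Z E : lmodType Lambda)
    (i : {linear Z -> E}) (p : {linear E -> mt_mod T}) : short_exact i p ->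
  exists (TZ TE : mtuple V U) (a : {linear mt_mod TZ -> Z})
    (b : {linear mt_mod TE -> E}) (j : tmor TZ TE) (q : tmor TE T),
    [/\ bijective a, bijective b, forall z, i (a z) = b (tlin j z),
        forall e, p (b e) = tlin q e & tses j q].
Proof.
move=> ses; have [TZ [a aB]] := tuple_of_module Z.
have [TE [b bB]] := tuple_of_module E.
have [b' [bK b'K]] := linear_inverse bB.
have [j jE] := tmor_of_linear (lin (b' \o i \o a)).
have [q qE] := tmor_of_linear (lin (p \o b)).
have ij z : i (a z) = b (tlin j z) by rewrite -jE /= b'K.
exists TZ, TE, a, b, j, q; split=> //; apply/tsesP.
have [iI ip pS] := @short_exact_iso _ _ _ _ _ _ a b (tlin j) i p aB bB
  (fun z => esym (ij z)) ses.
split=> // [e|m]; first by rewrite -qE; apply: ip.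
by have [e <-] := pS m; exists e; rewrite -qE.
Qed.

(** By the universal property, an extension problem into T amounts to one
    extension problem into K and one into L. *)
Lemma cofree_extends (M T : mtuple V U) (K : lmodType A) (L : lmodType B)
    (r : {linear mt_X T -> K}) (s : {linear mt_Y T -> L}) :
  cofree r s -> ext_extends (mt_X M) K -> ext_extends (mt_Y M) L ->
  ext_extends (mt_mod M : lmodType Lambda) (mt_mod T).
Proof.
move=> rs extK extL Z E i p ses h.
have [TZ [TE [a [b [j [q [aB bB ij pq [jqX jqY]]]]]]]] := tuple_ses (mt_mod M) ses.
have [b' [bK b'K]] := linear_inverse bB; have [a' [aK a'K]] := linear_inverse aB.
have [n nE] := tmor_of_linear (lin (h \o a)).
have [c cE] := extK _ _ _ _ jqX (lin (r \o tX n)).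
have [d dE] := extL _ _ _ _ jqY (lin (s \o tY n)).
have [m [rm sm]] := cofree_tmor c d rs.
have [mnX mnY] : tX (tcomp m j) =1 tX n /\ tY (tcomp m j) =1 tY n.
  apply: (cofree_tmor_inj rs) => [x|y]; first by rewrite /= rm cE.
  by rewrite /= sm dE.
exists (lin (tlin m \o b')) => z; rewrite -[z]a'K /= ij bK.
case: (a' z) => x y; rewrite -[RHS]/((h \o a) (x, y)) [RHS](nE (x, y)) !tlinE.
by congr (_, _); [apply: mnX|apply: mnY].
Qed.
End Orthogonality.

(** * Left cotorsion pairs *)

Section ClassLemmas.
Variable R : pzRingType.
Implicit Types K M N X : lmodType R.

(** Syzygies of objects of C stay in C, so Ext^(i+1)(M, N) becomes Ext^1 of the
    i-th syzygy. *)
Lemma resolving_Ext_zero (C : modclass R) N :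
  epi_kernel_closed C -> (forall P, projective P -> C P) ->
  (forall M, C M -> ext_extends M N) ->
  forall i M, C M -> Ext_zero i.+1 M N.
Proof.
move=> kerC projC ext; elim=> [|i IHi] M CM; first exact/extends_Ext_zero/ext.
apply: Ext_zero_syzygy => P Pproj; apply: IHi.
by apply: (kerC _ _ _ _ _ (kerl_ses (@res_aug_surj _ _ P))) CM; apply: projC.
Qed.

Lemma finite_res_leq (C : modclass R) k m M : (k <= m)%N ->
  finite_res_class C k M -> finite_res_class C m M.
Proof.
by move=> le_km [P [l [le_lk CP P0]]]; exists P, l; split=> //; apply: leq_trans le_km.
Qed.

Lemma finite_cores_leq (C : modclass R) k m M : (k <= m)%N ->
  finite_cores_class C k M -> finite_cores_class C m M.
Proof.
by move=> le_km [P [l [le_lk CP P0]]]; exists P, l; split=> //; apply: leq_trans le_km.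
Qed.

Lemma Ext_zero_finite_res (C : modclass R) n Q : is_class C ->
  (forall i, (1 <= i <= n)%N -> forall X, C X -> Ext_zero i Q X) ->
  forall m M, finite_res_class C m M ->
  forall i, (i.+1 + m <= n)%N -> Ext_zero i.+1 Q M.
Proof.
move=> C_class ext; apply: finite_res_ind => // [m M CM i le_imn|].
  by apply: ext CM; rewrite ltn0Sn (leq_trans (leq_addr _ _) le_imn).
move=> m K X M i p ses CX _ IHK j le_jmn.
apply: (Ext_zero_dimension_shift ses); last by apply: IHK; rewrite addSnnS.
by apply: ext CX; rewrite ltn0Sn (leq_trans (leq_addr _ _) le_jmn).
Qed.

End ClassLemmas.

Section UClass.
Variables (A B : pzRingType) (V : bimodule A B) (U : bimodule B A).
Variables (C : modclass A) (D : modclass B).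
Hypotheses (C_class : is_class C) (D_class : is_class D).
Local Notation Lambda := (morita V U).

Lemma U_class_summand : summand_closed C -> summand_closed D ->
  summand_closed (U_class V U C D).
Proof.
move=> sumC sumD M N N' [h /linear_inverse [h' [hK h'K]]] [T [[a aB] [CT DT]]].
have [a' [aK a'K]] := linear_inverse aB.
have [W [b bB]] := tuple_of_module N; have [b' [bK b'K]] := linear_inverse bB.
pose s0 : {linear N -> M} := lin (h' \o lpair (lin idfun) (lin \0)).
pose r0 : {linear M -> N} := lin (fst \o h).
have rs0 x : r0 (s0 x) = x by rewrite /r0 /s0 /= h'K.
have [s sE] := tmor_of_linear (lin (a' \o s0 \o b)).
have [r rE] := tmor_of_linear (lin (b' \o r0 \o a)).
have rs z : tlin r (tlin s z) = z 
  by rewrite -sE -rE -[LHS]/(b' (r0 (a (a' (s0 (b z)))))) a'K rs0 bK.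
exists W; split; first by exists b.
split.
  apply: (summand_retract (s := tX s) (r := tX r) sumC) CT => x.
  exact: (congr1 fst (rs (x, 0))).
apply: (summand_retract (s := tY s) (r := tY r) sumD) DT => y.
exact: (congr1 snd (rs (0, y))).
Qed.

Lemma U_class_tses : extension_closed (U_class V U C D) ->
  forall (S T W : mtuple V U) (j : tmor S T) (q : tmor T W), tses j q ->
  C (mt_X S) /\ D (mt_Y S) -> C (mt_X W) /\ D (mt_Y W) ->
  C (mt_X T) /\ D (mt_Y T).
Proof.
move=> ext S T W j q /tsesP ses /U_classP US /U_classP UW.
by apply/U_classP => //; apply: ext ses _ _; [apply: US|apply: UW].
Qed.

(** C-modules embed among the tuples with zero second component. *)
Lemma tses_extension_closed :
  (forall (S T W : mtuple V U) (j : tmor S T) (q : tmor T W), tses j q ->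
     C (mt_X S) /\ D (mt_Y S) -> C (mt_X W) /\ D (mt_Y W) ->
     C (mt_X T) /\ D (mt_Y T)) ->
  extension_closed C.
Proof.
move=> ext K M N i p ses CK CN.
pose Z : lmodType B := zeromod (U : lmodType B).
have Z0 : zero_module Z by apply: zeromod0.
have gVf (X : lmodType A) (t : tensor V (tensor U X)) :
    (\0 : tensor V Z -> X) (tensor_map V (lin \0 : {linear tensor U X -> Z}) t) = 0.
  by [].
pose T X : mtuple V U := @MTuple _ _ V U X Z (lin \0) (lin \0) (gVf X) (fun=> erefl).
have tm (X X' : lmodType A) (f : {linear X -> X'}) :
    exists m : tmor (T X) (T X'), tX m = f /\ tY m =1 id.
  have mf u x : idfun (mt_f (T X) (tens u x)) = mt_f (T X') (tens u (f x)) by [].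
  have mg v y : f (mt_g (T X) (tens v y)) = mt_g (T X') (tens v (idfun y)).
    exact: linear0.
  by exists (@Tmor _ _ V U (T X) (T X') f (lin idfun) mf mg).
have [j [jX jY]] := tm _ _ i; have [q [qX qY]] := tm _ _ p.
have [] // := ext (T K) (T M) (T N) j q; try by split=> //; apply: D_class.1.
split; first by rewrite jX qX.
split=> [y y' _|y|y]; first by rewrite [y]Z0 [y']Z0.
  by split=> _; [exists 0; rewrite [y]Z0 linear0|apply: Z0].
by exists 0; rewrite [y]Z0 linear0.
Qed.

End UClass.

Section LeftCover.
Variables (A B : pzRingType) (V : bimodule A B) (U : bimodule B A).
Variables (C1 : modclass A) (G : modclass A).
Hypothesis C1_class : is_class C1.
Hypothesis cover : forall X : lmodType A, exists (K P : lmodType A)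
  (i : {linear K -> P}) (p : {linear P -> X}), [/\ short_exact i p, C1 P & G K].
Hypothesis extVG : forall K, G K -> ext_extends (V : lmodType A) K.

Lemma left_cover (T : mtuple V U) :
  exists (K : lmodType A) (T' : mtuple V U)
    (j : tmor (hom_tuple V U K) T') (q : tmor T' T),
    [/\ tses j q, G K & C1 (mt_X T')].
Proof.
have [K [P [i [p [ses CP GK]]]]] := cover (mt_X T).
have [h|T' [j [q [jq XT']]]] := hom_tuple_pullback ses.
  exact: (extends_lift h (extVG GK) ses).
by exists K, T', j, q; split=> //; apply: C1_class.2 CP.
Qed.

(** A section of the approximation T' -> T makes the first component of T a
    retract of a member of C1. *)
Lemma left_cover_section (T : mtuple V U) : summand_closed C1 ->
  (forall (T' : mtuple V U) (q : tmor T' T), surj (tX q) -> surj (tY q) ->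
     exists s : tmor T T', cancel (tX s) (tX q) /\ cancel (tY s) (tY q)) ->
  C1 (mt_X T).
Proof.
move=> sumC sec; have [K [T' [j [q [[[_ _ qX] [_ _ qY]] _ CT']]]]] := left_cover T.
by have [s [sX _]] := sec T' q qX qY; apply: (summand_retract sumC sX CT').
Qed.

End LeftCover.

Section LeftRes.
Variables (A B : pzRingType) (V : bimodule A B) (U : bimodule B A).

(** H_A is exact on the short exact sequences into which a finite resolution
    splits, since their kernels have no Ext^1 from V.  The predicates F and J are
    abstract because the lemma is also used with the two rings exchanged. *)
Lemma hom_tuple_finite_res (C : modclass A) (F : nat -> mtuple V U -> Prop)
    (J : mtuple V U -> Prop) m : is_class C ->
  (forall K, C K -> J (hom_tuple V U K)) ->
  (forall k T, J T -> F k T) ->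
  (forall k S T W (j : tmor S T) (q : tmor T W), tses j q -> J T ->
     F k S -> F k.+1 W) ->
  (forall K, finite_res_class C m K -> ext_extends (V : lmodType A) K) ->
  forall k K, finite_res_class C k K -> (k <= m.+1)%N -> F k (hom_tuple V U K).
Proof.
move=> C_class homJ F0 FS ext.
apply: finite_res_ind => // [k M CM _|k K X M i p ses CX resK IHK le_km].
  exact/F0/homJ.
have extK := ext K (finite_res_leq (le_km : (k <= m)%N) resK).
have jq := hom_tuple_ses U ses (fun h => extends_lift h extK ses).
by apply: FS jq (homJ _ CX) (IHK (ltnW le_km)).
Qed.
End LeftRes.

Section LeftPair.
Variables (A B : pzRingType) (V : bimodule A B) (U : bimodule B A) (n : nat).
Variables (C1 C2 : modclass A) (D1 D2 : modclass B).
Hypotheses (n_gt0 : (0 < n)%N).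
Hypotheses (C1_class : is_class C1) (C2_class : is_class C2).
Hypotheses (D1_class : is_class D1) (D2_class : is_class D2).
Hypotheses (pairC : left_cotorsion_pair n C1 C2).
Hypotheses (pairD : left_cotorsion_pair n D1 D2).
Hypothesis extV : forall i, (1 <= i <= n)%N -> forall X, C2 X -> Ext_zero i V X.
Hypothesis extU : forall i, (1 <= i <= n)%N -> forall Y, D2 Y -> Ext_zero i U Y.
Hypothesis extUD : forall Y X, finite_res_class D2 n.-1 Y ->
  finite_res_class C2 n.-1 X -> Ext_zero 1 (bimHom U Y : lmodType A) X.
Hypothesis extVC : forall X Y, finite_res_class C2 n.-1 X ->
  finite_res_class D2 n.-1 Y -> Ext_zero 1 (bimHom V X : lmodType B) Y.
Hypothesis U_res : resolving (U_class V U C1 D1).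
Hypothesis J_ext : extension_closed (finite_res_class (J_class V U C2 D2) n.-1).

Local Notation Lambda := (morita V U).
Local Notation Ucl := (U_class V U C1 D1).
Local Notation Jcl := (J_class V U C2 D2).

Let extVG K : finite_res_class C2 n.-1 K -> ext_extends (V : lmodType A) K.
Proof.
move=> resK; apply/Ext_zero_extends/(Ext_zero_finite_res C2_class extV resK).
by rewrite add1n prednK.
Qed.

Let extUG L : finite_res_class D2 n.-1 L -> ext_extends (U : lmodType B) L.
Proof.
move=> resL; apply/Ext_zero_extends/(Ext_zero_finite_res D2_class extU resL).
by rewrite add1n prednK.
Qed.

Lemma left_orthogonal (M N : lmodType Lambda) :
  Ucl M -> Jcl N -> ext_extends M N.
Proof.
move=> [S [SM [CS DS]]] [T [TN JT]]; apply: ext_extends_iso SM TN _.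
case: (pairC) (pairD) => _ extC _ [_ extD _].
have one : (1 <= 1 <= n)%N by [].
have [||K [L [r [s [CK DL rs]]]]] := J_cofree JT.
- by move=> Y X DY CX; apply/Ext_zero_extends/extUD; apply: finite_res_base.
- by move=> X Y CX DY; apply/Ext_zero_extends/extVC; apply: finite_res_base.
by apply: (cofree_extends rs); apply/Ext_zero_extends; [apply: extC|apply: extD].
Qed.

Lemma left_projective (P : lmodType Lambda) : projective P -> Ucl P.
Proof.
have [T [h hB]] := tuple_of_module P; have [h' [hK h'K]] := linear_inverse hB.
move=> Pproj; exists T; split; first by exists h.
case: (pairC) (pairD) => sumC _ covC [sumD _ covD].
have sec (T' : mtuple V U) (q : tmor T' T) : surj (tX q) -> surj (tY q) ->
    exists s : tmor T T', cancel (tX s) (tX q) /\ cancel (tY s) (tY q).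
  move=> qX qY.
  have [|k kE] := Pproj _ _ (lin (h \o tlin q)) (lin idfun).
    move=> z; case hz: (h' z) => [x y].
    have [x' x'E] := qX x; have [y' y'E] := qY y.
    by exists (x', y'); rewrite -[LHS]/(h (tX q x', tY q y')) x'E y'E -hz h'K.
  have [s sE] := tmor_of_linear (lin (k \o h)).
  have qs z : tlin q (tlin s z) = z.
    by rewrite -sE; apply: (can_inj hK); apply: kE.
  exists s; split=> [x|y]; first exact: (congr1 fst (qs (x, 0))).
  exact: (congr1 snd (qs (0, y))).
split; first exact: (left_cover_section C1_class covC extVG sumC sec).
apply: (@left_cover_section _ _ U V _ _ D1_class covD extUG (tswap T) sumD).
move=> T' q qY qX; have [s [sX sY]] := sec (tswap T') (tmor_swapr q) qX qY.
by exists (tmor_swapr s).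
Qed.

Lemma left_Ext_zero i : Ext_zero_cc i.+1 Ucl Jcl.
Proof.
move=> M N UM JN; apply: resolving_Ext_zero UM; first exact: U_res.2.
  exact: left_projective.
by move=> M' UM'; apply: left_orthogonal.
Qed.

(** An approximation of Hom(U, L) splits, since Hom(U, L) has no Ext^1 into its
    kernel. *)
Let homU_C1 L : finite_res_class D2 n.-1 L -> C1 (bimHom U L).
Proof.
move=> resL; case: (pairC) => sumC _ /(_ (bimHom U L)) [K [P [i [p [ses CP resK]]]]].
have [s sK] := extends_section (Ext_zero_extends (extUD resL resK)) ses.
exact: summand_retract sumC sK CP.
Qed.

Lemma left_hom_tuple_res K : finite_res_class C2 n.-1 K ->
  finite_res_class Jcl n.-1 (mt_mod (hom_tuple V U K)).
Proof.
move=> resK.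
apply: (@hom_tuple_finite_res _ _ V U C2
  (fun k T => finite_res_class Jcl k (mt_mod T)) (J_pred C2 D2) n.-1) resK _ => //.
- by move=> X; apply: hom_tuple_J; apply: D2_class.1.
- move=> k T JT; apply: finite_res_base; exists T; split=> //.
  exact: isomorphic_refl.
- move=> k S T W j q /tsesP ses JT; apply: finite_res_cons ses _; exists T.
  by split=> //; apply: isomorphic_refl.
Qed.

Lemma left_hom_tuple_res_swap L : finite_res_class D2 n.-1 L ->
  finite_res_class Jcl n.-1 (mt_mod (tswap (hom_tuple U V L))).
Proof.
move=> resL.
apply: (@hom_tuple_finite_res _ _ U V D2
  (fun k T => finite_res_class Jcl k (mt_mod (tswap T)))
  (J_pred D2 C2) n.-1) resL _ => //.
- by move=> X; apply: hom_tuple_J; apply: C2_class.1.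
- move=> k T JT; apply: finite_res_base; exists (tswap T).
  by split; [apply: isomorphic_refl|apply: J_pred_swap JT].
- move=> k S T W j q [jqX jqY] JT.
  have /tsesP ses : tses (tmor_swap j) (tmor_swap q) by [].
  apply: finite_res_cons ses _; exists (tswap T).
  by split; [apply: isomorphic_refl|apply: J_pred_swap JT].
Qed.

Lemma left_approximation (M : lmodType Lambda) :
  exists (K X : lmodType Lambda) (i : {linear K -> X}) (p : {linear X -> M}),
    [/\ short_exact i p, Ucl X & finite_res_class Jcl n.-1 K].
Proof.
have [T [h hB]] := tuple_of_module M; have [h' [hK h'K]] := linear_inverse hB.
case: (pairC) (pairD) => sumC _ covC [sumD _ covD].
have [K [T1 [j1 [q1 [jq1 resK CT1]]]]] := left_cover C1_class covC extVG T.
have [L [S [j2 [q2 [jq2 resL DS]]]]] :=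
  @left_cover _ _ U V _ _ D1_class covD extUG (tswap T1).
have [T2 [j3 [q3 [jq3 DT2]]]] : exists (T2 : mtuple V U)
    (j3 : tmor (tswap (hom_tuple U V L)) T2) (q3 : tmor T2 T1),
    tses j3 q3 /\ D1 (mt_Y T2).
  by exists (tswap S), (tmor_swap j2), (tmor_swapr q2); case: jq2.
have CT2 : C1 (mt_X T2).
  have extC1 : extension_closed C1.
    exact: (tses_extension_closed D1_class (U_class_tses C1_class D1_class U_res.1)).
  by case: jq3 => sesX _; apply: extC1 sesX _ CT1; apply: homU_C1.
have ses1 : short_exact (tlin j1) (lin (h \o tlin q1)).
  have /tsesP [jI ex qS] := jq1; split=> // [z|m].
    by rewrite -ex /=; split=> [/(linear_inj0 (can_inj hK))|->]; rewrite ?linear0.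
  by have [z zE] := qS (h' m); exists z; rewrite -[LHS]/(h (tlin q1 z)) zE h'K.
have ses2 : short_exact (tlin j3) (tlin q3) by apply/tsesP.
have [i [p ses]] := kernel_comp_ses ses1 ses2.
exists (kermod (lin (lin (h \o tlin q1) \o tlin q3))), (mt_mod T2), (kerl _),
  (lin (lin (h \o tlin q1) \o tlin q3)).
split; last first.
- apply: J_ext ses _ _; first exact: left_hom_tuple_res_swap.
  exact: left_hom_tuple_res.
- by apply/U_classP.
apply: kerl_ses => m; case: ses1 => _ _ /(_ m) [z <-].
by case: ses2 => _ _ /(_ z) [w <-]; exists w.
Qed.

Theorem left_hereditary_pair : hereditary_left_cotorsion_pair n Ucl Jcl.
Proof.
split; last exact: left_Ext_zero.
split; last exact: left_approximation.
  by case: (pairC) (pairD) => sumC _ _ [sumD _ _]; apply: U_class_summand.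
by move=> [//|i] _; apply: left_Ext_zero.
Qed.

End LeftPair.

(** * The left adjoint of the first component and the class B *)

Section TensorTuple.
Variables (A B : pzRingType) (V : bimodule A B) (U : bimodule B A).
Implicit Types K X M Q : lmodType A.

Fact tensor_tuple_fUg K (t : tensor U (tensor V (tensor U K))) :
  idfun (tensor_map U (lin \0 : {linear tensor V (tensor U K) -> K}) t) = 0.
Proof. exact: tensor_map0. Qed.

(** The value at K of the left adjoint of T |-> X: T_A K = (K, U (x) K, id, 0). *)
Definition tensor_tuple K : mtuple V U :=
  @MTuple A B V U K (tensor U K) (lin idfun) (lin \0) (fun=> erefl)
    (@tensor_tuple_fUg K).

Definition tensor_tuple_map K X (f : {linear K -> X}) :
  tmor (tensor_tuple K) (tensor_tuple X).
Proof.
apply: (@Tmor _ _ V U (tensor_tuple K) (tensor_tuple X) f (tensor_map U f)).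
  by move=> u x; apply: tensor_map_tens.
by move=> v t; apply: linear0.
Defined.

Lemma tensor_tuple_ses K X M (i : {linear K -> X}) (p : {linear X -> M}) :
  short_exact i p -> injective (tensor_map U i) ->
  tses (tensor_tuple_map i) (tensor_tuple_map p).
Proof.
move=> [iI ip pS] UiI; split=> //; split=> //.
  exact: tensor_right_exact.
exact: tensor_map_surj.
Qed.

(** The pushout of the counit T_A X -> T along T_A X -> T_A Q, which is a
    monomorphism with cokernel T_A K by the hypothesis on U (x) i. *)
Lemma tensor_tuple_pushout (T : mtuple V U) Q K (i : {linear mt_X T -> Q})
    (p : {linear Q -> K}) :
  short_exact i p -> injective (tensor_map U i) ->
  exists (T' : mtuple V U) (j : tmor T T') (q : tmor T' (tensor_tuple K)),
    tses j q /\ isomorphic Q (mt_X T').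
Proof.
move=> [iI ip pS] UiI.
pose d : {linear tensor U (mt_X T) -> (tensor U Q * mt_Y T)%type} :=
  lpair (tensor_map U i) (lin (\- mt_f T)).
pose Y := cokermod d; pose e : {linear (tensor U Q * mt_Y T)%type -> Y} := cokerl d.
have eE t y : e (tensor_map U i t, y) = e (0, y + mt_f T t).
  apply/eqP; rewrite -subr_eq0 -linearB; apply/eqP/cokerl_exact; exists t.
  by congr (_, _); rewrite /= ?subr0 // opprD addrA subrr add0r.
pose f : {linear tensor U Q -> Y} := lin (e \o lpair (lin idfun) (lin \0)).
have fE t : f t = e (t, 0) by [].
have [c cE] : exists c : {linear Y -> bimHom V Q},
    forall z, c (e z) = hom_lin V i (adj (mt_g T) z.2).
  apply: (coker_factor (g := lin ((hom_lin V i \o adj (mt_g T)) \o snd))) => t.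
  rewrite -[LHS]/(hom_lin V i (adj (mt_g T) (- mt_f T t))) !linearN.
  have -> : hom_lin V i (adj (mt_g T) (mt_f T t)) = 0; last exact: oppr0.
  apply: bimHom_ext => v; rewrite -[LHS]/(i (mt_g T (tens v (mt_f T t)))).
  by rewrite -tensor_map_tens mt_gVf; apply: linear0.
pose g : {linear tensor V Y -> Q} := lin (hom_eval V Q \o tensor_map V c).
have gE v t y : g (tens v (e (t, y))) = i (mt_g T (tens v y)).
  rewrite -[LHS]/(hom_eval V Q (tensor_map V c (tens v (e (t, y))))).
  by rewrite tensor_map_tens hom_evalE cE.
have gf t : g (tensor_map V f t) = 0.
  apply: (tensor_linear_ext (f := lin (g \o tensor_map V f)) (g := lin \0)).
  move=> v s; rewrite -[LHS]/(g (tensor_map V f (tens v s))) tensor_map_tens.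
  by rewrite fE gE tensr0 !linear0.
have fg0 s : adj f (g s) = 0.
  apply: (tensor_linear_ext (f := lin (adj f \o g)) (g := lin \0)) => v y.
  have [[t z] <-] := @cokerl_surj _ _ _ d y.
  apply: bimHom_ext => u; rewrite -[LHS]/(f (tens u (g (tens v (e (t, z)))))).
  rewrite gE fE -tensor_map_tens eE -tensor_map_tens mt_fUg addr0.
  exact: linear0.
have fg t : f (tensor_map U g t) = 0.
  apply: (tensor_linear_ext (f := lin (f \o tensor_map U g)) (g := lin \0)).
  move=> u s; rewrite -[LHS]/(f (tensor_map U g (tens u s))) tensor_map_tens.
  exact: (congr1 (fun h => bimHom_app h u) (fg0 s)).
pose T' : mtuple V U := @MTuple _ _ V U Q Y f g gf fg.
have [k kE] : exists k : {linear Y -> tensor U K},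
    forall z, k (e z) = tensor_map U p z.1.
  apply: (coker_factor (g := lin (tensor_map U p \o fst))) => t /=.
  exact: (exact_at0 t (tensor_right_exact ip pS)).
pose l : {linear mt_Y T -> Y} := lin (e \o lpair (lin \0) (lin idfun)).
have lE y : l y = e (0, y) by [].
have jf u x : l (mt_f T (tens u x)) = f (tens u (i x)).
  by rewrite lE fE -tensor_map_tens eE add0r.
have jg v y : i (mt_g T (tens v y)) = g (tens v (l y)) by rewrite lE gE.
have qf u x : k (f (tens u x)) = mt_f (tensor_tuple K) (tens u (p x)).
  by rewrite fE kE tensor_map_tens.
have qg v y : p (g (tens v y)) = mt_g (tensor_tuple K) (tens v (k y)).
  have [[t z] <-] := @cokerl_surj _ _ _ d y.
  by rewrite gE (exact_at0 _ ip).
pose j : tmor T T' := @Tmor _ _ V U T T' i l jf jg.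
pose q : tmor T' (tensor_tuple K) := @Tmor _ _ V U T' (tensor_tuple K) p k qf qg.
exists T', j, q; split; last exact: isomorphic_refl.
split=> //; split.
- apply: linear_inj => y; rewrite -[tY j y]/(e (0, y)).
  move=> /cokerl_exact [t] /pair_equal_spec [it <-].
  by rewrite (linear_inj0 UiI it) /= linear0 oppr0.
- move=> w; have [[t y] <-] := @cokerl_surj _ _ _ d w.
  rewrite -[tY q _]/(k (e (t, y))) kE; split=> [pt|[z zE]].
    have [s <-] : exists s, tensor_map U i s = t.
      exact/(tensor_right_exact ip pS).
    by exists (y + mt_f T s); rewrite -[LHS]/(e _) -eE.
  have := congr1 k zE; rewrite -[tY j z]/(e (0, z)) !kE => <-.
  exact: linear0.
- move=> t; have [s sE] := tensor_map_surj (U := U) pS t.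
  by exists (e (s, 0)); rewrite -[LHS]/(k (e (s, 0))) kE.
Qed.

End TensorTuple.

Definition B_pred (A B : pzRingType) (V : bimodule A B) (U : bimodule B A)
    (C : modclass A) (D : modclass B) (T : mtuple V U) :=
  [/\ coker_in D (mt_f T), coker_in C (mt_g T),
      exact_at (tensor_map V (mt_f T)) (mt_g T)
    & exact_at (tensor_map U (mt_g T)) (mt_f T)].

Section FreeMap.
Variables (A B : pzRingType) (V : bimodule A B) (U : bimodule B A).
Implicit Types (S T : mtuple V U) (K : lmodType A) (L : lmodType B).

Lemma B_pred_swap C D T : B_pred C D T -> B_pred D C (tswap T).
Proof. by case. Qed.

Definition free_map T K L (r : {linear K -> mt_X T}) (s : {linear L -> mt_Y T}) :
    {linear (K * tensor V L)%type -> mt_X T} :=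
  lcopair r (lin (mt_g T \o tensor_map V s)).

Lemma free_mapE T K L (r : {linear K -> mt_X T}) (s : {linear L -> mt_Y T}) x t :
  free_map r s (x, t) = r x + mt_g T (tensor_map V s t).
Proof. by []. Qed.

Lemma tmor_gE S T (m : tmor S T) t :
  tX m (mt_g S t) = mt_g T (tensor_map V (tY m) t).
Proof.
apply: (tensor_linear_ext (f := lin (tX m \o mt_g S))
          (g := lin (mt_g T \o tensor_map V (tY m)))) => v y.
by rewrite /= tmor_g tensor_map_tens.
Qed.

(** The map g kills the image of V (x) f, hence factors through V (x) L, and
    exactness makes the factorisation injective. *)
Lemma B_ses T K L (q : {linear mt_X T -> K}) (c : {linear mt_Y T -> L}) :
  exact_at (mt_g T) q -> surj q -> exact_at (mt_f T) c -> surj c ->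
  exact_at (tensor_map V (mt_f T)) (mt_g T) ->
  exists2 m : {linear tensor V L -> mt_X T}, short_exact m q &
    forall t, m (tensor_map V c t) = mt_g T t.
Proof.
move=> eq qS ec cS ex.
have VcS : surj (tensor_map V c) by apply: tensor_map_surj.
have Vex : exact_at (tensor_map V (mt_f T)) (tensor_map V c).
  exact: tensor_right_exact.
have [|m mE] := @factor_through_surj _ _ _ _ (tensor_map V c) (mt_g T) VcS.
  by move=> t /Vex [s <-]; apply/ex; exists s.
exists m => //; split=> //.
- apply: linear_inj => w; have [t <-] := VcS w.
  by rewrite mE => /ex /Vex.
- move=> x; rewrite eq; split=> [[t <-]|[w <-]].
    by exists (tensor_map V c t); rewrite mE.
  by have [t <-] := VcS w; exists t; rewrite mE.
Qed.

Lemma free_map_bij T K L (q : {linear mt_X T -> K}) (c : {linear mt_Y T -> L})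
    (m : {linear tensor V L -> mt_X T})
    (r : {linear K -> mt_X T}) (s : {linear L -> mt_Y T}) :
  cancel r q -> cancel s c -> short_exact m q ->
  (forall t, m (tensor_map V c t) = mt_g T t) ->
  injective (free_map r s) /\ surj (free_map r s).
Proof.
move=> rK sK [mI eq _] mE.
have gsE t : mt_g T (tensor_map V s t) = m t.
  rewrite -mE -(@tensor_map_comp _ _ _ _ _ _ _ _ (lin idfun)) ?tensor_map_id //.
split.
  apply: linear_inj => -[k t]; rewrite free_mapE gsE => rm.
  have := congr1 q rm; rewrite linearD rK (exact_at0 _ eq) addr0 linear0 => k0.
  move: rm; rewrite k0 linear0 add0r => /(linear_inj0 mI) ->.
  by [].
move=> x; have /eq [t tE] : q (x - r (q x)) = 0 by rewrite linearB rK subrr.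
by exists (q x, t); rewrite free_mapE gsE tE addrC subrK.
Qed.
End FreeMap.

Section FreeTuples.
Variables (A B : pzRingType) (V : bimodule A B) (U : bimodule B A).
Implicit Types (S T : mtuple V U) (K X : lmodType A) (L Y : lmodType B).

(** T is the direct sum of T_A K and T_B L with inclusions r and s, expressed on
    components: X is K + V (x) L and Y is L + U (x) K. *)
Definition free_on T K L (r : {linear K -> mt_X T}) (s : {linear L -> mt_Y T}) :=
  [/\ injective (free_map r s), surj (free_map r s),
      injective (@free_map _ _ U V (tswap T) L K s r)
    & surj (@free_map _ _ U V (tswap T) L K s r)].

Lemma B_free (C : modclass A) (D : modclass B) T : B_pred C D T ->
  (forall X Y, C X -> D Y -> ext_extends X (tensor V Y : lmodType A)) ->
  (forall Y X, D Y -> C X -> ext_extends Y (tensor U X : lmodType B)) ->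
  exists K L (r : {linear K -> mt_X T}) (s : {linear L -> mt_Y T}),
    [/\ C K, D L & free_on r s].
Proof.
case=> [[L [c [ec cS DL]]] [K [q [eq qS CK]]] exg exf] extC extD.
have [m mses mE] := B_ses eq qS ec cS exg.
have [n nses nE] := @B_ses _ _ U V (tswap T) L K c q ec cS eq qS exf.
have [r rK] := extends_section (extC _ _ CK DL) mses.
have [s sK] := extends_section (extD _ _ DL CK) nses.
exists K, L, r, s; split=> //.
have [? ?] := free_map_bij rK sK mses mE.
by have [? ?] := @free_map_bij _ _ U V (tswap T) L K c q n s r sK rK nses nE.
Qed.

(** The universal property of a sum of values of the left adjoints. *)
Lemma free_tmor T K L (r : {linear K -> mt_X T}) (s : {linear L -> mt_Y T}) S
    (a : {linear K -> mt_X S}) (b : {linear L -> mt_Y S}) : free_on r s ->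
  exists m : tmor T S, (forall x, tX m (r x) = a x) /\ (forall y, tY m (s y) = b y).
Proof.
case=> rI rS sI sS.
have [z /(linear_inj0 rI) ->|mX mXE] :=
  @factor_through_surj _ _ _ _ _ (free_map (T := S) a b) rS.
  exact: linear0.
have [z /(linear_inj0 sI) ->|mY mYE] :=
  @factor_through_surj _ _ _ _ _ (@free_map _ _ U V (tswap S) L K b a) sS.
  exact: linear0.
have mr x : mX (r x) = a x.
  by have := mXE (x, 0); rewrite !free_mapE !linear0 !addr0.
have ms y : mY (s y) = b y.
  by have := mYE (y, 0); rewrite !free_mapE !linear0 !addr0.
have mg t : mX (mt_g T (tensor_map V s t)) = mt_g S (tensor_map V b t).
  by have := mXE (0, t); rewrite !free_mapE !linear0 !add0r.
have mf t : mY (mt_f T (tensor_map U r t)) = mt_f S (tensor_map U a t).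
  by have := mYE (0, t); rewrite !free_mapE !linear0 !add0r.
have mF u x : mY (mt_f T (tens u x)) = mt_f S (tens u (mX x)).
  have [[k t] <-] := rS x; rewrite free_mapE linearD mr mg !tensDr !linearD.
  have -> : mt_f T (tens u (mt_g T (tensor_map V s t))) = 0.
    by rewrite -tensor_map_tens mt_fUg.
  have -> : mt_f S (tens u (mt_g S (tensor_map V b t))) = 0.
    by rewrite -tensor_map_tens mt_fUg.
  by rewrite linear0 !addr0 -!tensor_map_tens mf.
have mG v y : mX (mt_g T (tens v y)) = mt_g S (tens v (mY y)).
  have [[k t] <-] := sS y.
  rewrite free_mapE linearD ms [mY _]mf !tensDr !linearD.
  have -> : mt_g T (tens v (mt_f T (tensor_map U r t))) = 0.
    by rewrite -tensor_map_tens mt_gVf.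
  have -> : mt_g S (tens v (mt_f S (tensor_map U a t))) = 0.
    by rewrite -tensor_map_tens mt_gVf.
  by rewrite linear0 !addr0 -!tensor_map_tens mg.
by exists (Tmor mF mG).
Qed.

Lemma free_tmor_inj T K L (r : {linear K -> mt_X T}) (s : {linear L -> mt_Y T}) S
    (m n : tmor T S) : free_on r s ->
  (forall x, tX m (r x) = tX n (r x)) -> (forall y, tY m (s y) = tY n (s y)) ->
  tX m =1 tX n /\ tY m =1 tY n.
Proof.
case=> _ rS _ sS rmn smn; split=> [x|y].
  have [[k t] <-] := rS x; rewrite free_mapE !linearD rmn !tmor_gE.
  rewrite -!(@tensor_map_comp _ _ _ _ _ _ s _ (lin (tY n \o s))) //.
have [[k t] <-] := sS y; rewrite free_mapE !linearD smn.
congr (_ + _); rewrite (@tmor_gE _ _ U V _ _ (tmor_swap m)).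
rewrite (@tmor_gE _ _ U V _ _ (tmor_swap n)).
rewrite -!(@tensor_map_comp _ _ _ _ _ _ r _ (lin (tX n \o r))) //.
Qed.

Lemma tensor_tuple_B (C : modclass A) (D : modclass B) K :
  (forall L, zero_module L -> D L) -> C K -> B_pred C D (tensor_tuple V U K).
Proof.
move=> D0 CK; split.
- exists (zeromod (tensor U K : lmodType B)), (lin \0); split.
  + by move=> t; split=> // _; exists t.
  + by move=> x; exists 0; rewrite [x]zeromod0.
  + exact/D0/zeromod0.
- exists K, (lin idfun); split=> // x; last by exists x.
  split=> [x0|[y yE]]; last exact: (esym yE).
  by exists 0; apply: (esym x0).
- move=> t; split=> // _; exists t; exact: tensor_map_id.
- move=> t; split=> [ft|[s <-]].
    by exists 0; apply: etrans (linear0 _) (esym ft).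
  exact: tensor_map0.
Qed.

End FreeTuples.

Section FreeOrthogonality.
Variable R : pzRingType.

(** An extension problem along i is solved by a retraction of the pushout of i. *)
Lemma sections_extends (M N : lmodType R) :
  (forall (W : lmodType R) (i : {linear N -> W}) (p : {linear W -> M}),
     short_exact i p -> exists s : {linear M -> W}, cancel s p) ->
  ext_extends M N.
Proof.
move=> sec Z E i p [iI ip pS] h.
pose d : {linear Z -> (E * N)%type} := lpair i (lin (\- h)).
pose e := cokerl d.
have eE z y : e (i z, y) = e (0, y + h z).
  apply/eqP; rewrite -subr_eq0 -linearB; apply/eqP/cokerl_exact; exists z.
  by congr (_, _); rewrite /= ?subr0 // opprD addrA subrr add0r.
pose j : {linear N -> cokermod d} := lin (e \o lpair (lin \0) (lin idfun)).
have jE y : j y = e (0, y) by [].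
have [|q qE] := @coker_factor _ _ _ d _ (lin (p \o fst)).
  by move=> z; apply: (exact_at0 _ ip).
have jI : injective j.
  apply: linear_inj => y; rewrite jE => /cokerl_exact [z] /pair_equal_spec [iz <-].
  by rewrite (linear_inj0 iI iz) /= linear0 oppr0.
have jq : exact_at j q.
  move=> w; have [[x y] <-] := @cokerl_surj _ _ _ d w; rewrite qE.
  split=> [px|[y' y'E]].
    have [z <-] : exists z, i z = x by apply/ip.
    by exists (y + h z); rewrite jE -eE.
  by have := congr1 q y'E; rewrite jE !qE => <-; apply: linear0.
have [|s sK] := sec _ j q.
  by split=> // m; have [x <-] := pS m; exists (e (x, 0)); rewrite qE.
have [|r rE] := @lift_through_inj _ _ _ _ j (lin (idfun \- (s \o q))) jI.
  by move=> w; apply/jq; rewrite linearB /= sK subrr.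
exists (lin (r \o (e \o lpair (lin idfun) (lin \0)))) => z.
rewrite -[LHS]/(r (e (i z, 0))) eE add0r -jE; apply: jI.
by rewrite rE /= (exact_at0 _ jq) linear0 subr0.
Qed.
End FreeOrthogonality.

Section FreeExtends.
Variables (A B : pzRingType) (V : bimodule A B) (U : bimodule B A).
Local Notation Lambda := (morita V U).

(** By the universal property, an epimorphism onto T splits as soon as its
    components split over K and L. *)
Lemma free_extends (T N : mtuple V U) (K : lmodType A) (L : lmodType B)
    (r : {linear K -> mt_X T}) (s : {linear L -> mt_Y T}) :
  free_on r s -> ext_extends K (mt_X N) -> ext_extends L (mt_Y N) ->
  ext_extends (mt_mod T : lmodType Lambda) (mt_mod N).
Proof.
move=> rs extK extL; apply: sections_extends => W i p ses.
have [TW [b bB]] := tuple_of_module W; have [b' [bK b'K]] := linear_inverse bB.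
have [j jE] := tmor_of_linear (lin (b' \o i)).
have [q qE] := tmor_of_linear (lin (p \o b)).
have [jqX jqY] : tses j q.
  apply/tsesP.
  have bi z : b (tlin j z) = i (idfun z) by rewrite -jE /= b'K.
  have idB : bijective (lin idfun : {linear mt_mod N -> mt_mod N}).
    by exists idfun.
  have [jI ex pS] := @short_exact_iso _ _ _ _ _ _ (lin idfun) b _ i p idB bB bi ses.
  split=> // [z|m]; first by rewrite -qE; apply: ex.
  by have [z <-] := pS m; exists z; rewrite -qE.
have [c cE] := extends_lift r extK jqX.
have [d dE] := extends_lift s extL jqY.
have [m [mr ms]] := free_tmor c d rs.
have [idf idg] : (forall u x, (lin idfun : {linear mt_Y T -> mt_Y T})
      (mt_f T (tens u x)) = mt_f T (tens u ((lin idfun : {linear mt_X T -> mt_X T}) x)))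
    /\ (forall v y, (lin idfun : {linear mt_X T -> mt_X T})
      (mt_g T (tens v y)) = mt_g T (tens v ((lin idfun : {linear mt_Y T -> mt_Y T}) y))).
  by [].
have [qmX qmY] : tX (tcomp q m) =1 tX (Tmor idf idg) /\
    tY (tcomp q m) =1 tY (Tmor idf idg).
  apply: (free_tmor_inj rs) => [x|y]; first by rewrite /= mr cE.
  by rewrite /= ms dE.
exists (lin (b \o tlin m)) => -[x y].
rewrite -[LHS]/((p \o b) (tlin m (x, y))) [LHS]qE !tlinE.
by congr (_, _); [apply: qmX|apply: qmY].
Qed.
End FreeExtends.

(** * Right cotorsion pairs *)

Section CoresolvingExt.
Variable R : pzRingType.

(** Embed N in some D in C such that a given class of Ext^(i+2)(M, N) vanishes in
    D; the class then comes from Ext^(i+1)(M, D / N), and D / N is in C.  To find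
    D, first push out the cocycle so that it becomes a coboundary, then embed the
    pushout in a member of C. *)
Lemma coresolving_Ext_zero (C : modclass R) M :
  mono_cokernel_closed C ->
  (forall N : lmodType R, exists (D : lmodType R) (i : {linear N -> D}),
     injective i /\ C D) ->
  (forall N, C N -> ext_extends M N) ->
  forall i N, C N -> Ext_zero i.+1 M N.
Proof.
move=> cokC embC ext; elim=> [|i IHi] N CN; first exact/extends_Ext_zero/ext.
move=> P Pproj phi phid.
(* The cokernel of d is the pushout of phi and res_d P i.+1. *)
pose d : {linear P i.+2 -> (P i.+1 * N)%type} := lpair (res_d P i.+1) (lin (\- phi)).
pose e := cokerl d.
have eE x : e (res_d P i.+1 x, 0) = e (0, phi x).
  apply/eqP; rewrite -subr_eq0 -linearB; apply/eqP/cokerl_exact; exists x.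
  by congr (_, _); rewrite /= ?subr0 // sub0r.
have [D [j [jI CD]]] := embC (cokermod d).
pose k : {linear N -> D} := lin (j \o (e \o lpair (lin \0) (lin idfun))).
have kE y : k y = j (e (0, y)) by [].
have kI : injective k.
  apply: linear_inj => y; rewrite kE => /(linear_inj0 jI) /cokerl_exact [x].
  move=> /pair_equal_spec [/(@res_exactS _ _ P) [z <-] <-].
  by rewrite /= phid oppr0.
pose psi0 : {linear P i.+1 -> D} := lin (j \o (e \o lpair (lin idfun) (lin \0))).
have psi0E x : psi0 (res_d P i.+1 x) = k (phi x).
  by rewrite -[LHS]/(j (e (res_d P i.+1 x, 0))) eE.
have ses := cokerl_ses kI; have Cq := cokC _ _ _ _ _ ses CN CD.
have /= [x|chi chiE] := IHi _ Cq P Pproj (lin (cokerl k \o psi0)).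
  rewrite -[LHS]/(cokerl k (psi0 _)) psi0E.
  exact: (exact_at0 _ (@cokerl_exact _ _ _ k)).
have [chi' chi'E] := Pproj i _ _ (cokerl k) chi (@cokerl_surj _ _ _ k).
have [x|psi psiE] :=
  @lift_through_inj _ _ _ _ k (lin (psi0 \- (chi' \o res_d P i))) kI.
  apply/cokerl_exact; rewrite -[X in cokerl k X]/(psi0 x - chi' (res_d P i x)).
  by rewrite linearB chi'E chiE subrr.
exists psi => x; apply: kI; rewrite psiE -psi0E.
by rewrite -[LHS]/(psi0 (res_d P i.+1 x) - chi' _) res_dK linear0 subr0.
Qed.

Lemma Tor_zero_finite_cores (S : pzRingType) (W : bimodule S R) (C : modclass R) n :
  is_class C ->
  (forall i, (1 <= i <= n)%N -> forall X, C X -> Tor_zero i W X) ->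
  forall m M, finite_cores_class C m M ->
  forall i, (i.+1 + m <= n)%N -> Tor_zero i.+1 W M.
Proof.
move=> C_class tor; apply: finite_cores_ind => // [m M CM i le_imn|].
  by apply: tor CM; rewrite ltn0Sn (leq_trans (leq_addr _ _) le_imn).
move=> m K X M i p ses CX _ IHM j le_jmn.
apply: (Tor_zero_dimension_shift ses); last by apply: IHM; rewrite addSnnS.
by apply: tor CX; rewrite ltn0Sn (leq_trans (leq_addr _ _) le_jmn).
Qed.

End CoresolvingExt.

Section RightCover.
Variables (A B : pzRingType) (V : bimodule A B) (U : bimodule B A).

(** T_A is exact on the short exact sequences into which a finite coresolution
    splits, since their cokernels have no Tor_1 with U. *)
Lemma tensor_tuple_finite_cores (C : modclass A) (F : nat -> mtuple V U -> Prop)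
    (J : mtuple V U -> Prop) m : is_class C ->
  (forall K, C K -> J (tensor_tuple V U K)) ->
  (forall k T, J T -> F k T) ->
  (forall k S T W (j : tmor S T) (q : tmor T W), tses j q -> J T ->
     F k W -> F k.+1 S) ->
  (forall K, finite_cores_class C m K -> Tor_zero 1 U K) ->
  forall k K, finite_cores_class C k K -> (k <= m.+1)%N -> F k (tensor_tuple V U K).
Proof.
move=> C_class tenJ F0 FS tor.
apply: finite_cores_ind => // [k M CM _|k K X M i p ses CX resM IHM le_km].
  exact/F0/tenJ.
have torM := tor M (finite_cores_leq (le_km : (k <= m)%N) resM).
have jq := tensor_tuple_ses V ses (Tor_zero_injective ses torM).
by apply: FS jq (tenJ _ CX) (IHM (ltnW le_km)).
Qed.

Lemma right_cover (C2 G : modclass A) (T : mtuple V U) : is_class C2 ->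
  (forall X : lmodType A, exists (Q K : lmodType A) (i : {linear X -> Q})
     (p : {linear Q -> K}), [/\ short_exact i p, C2 Q & G K]) ->
  (forall K, G K -> Tor_zero 1 U K) ->
  exists (K : lmodType A) (T' : mtuple V U)
    (j : tmor T T') (q : tmor T' (tensor_tuple V U K)),
    [/\ tses j q, G K & C2 (mt_X T')].
Proof.
move=> C2_class cover tor.
have [Q [K [i [p [ses CQ GK]]]]] := cover (mt_X T).
have [T' [j [q [jq XT']]]] :=
  tensor_tuple_pushout ses (Tor_zero_injective ses (tor K GK)).
by exists K, T', j, q; split=> //; apply: C2_class.2 CQ.
Qed.

End RightCover.

Section RightPair.
Variables (A B : pzRingType) (V : bimodule A B) (U : bimodule B A) (n : nat).
Variables (C1 C2 : modclass A) (D1 D2 : modclass B).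
Hypotheses (n_gt0 : (0 < n)%N).
Hypotheses (C1_class : is_class C1) (C2_class : is_class C2).
Hypotheses (D1_class : is_class D1) (D2_class : is_class D2).
Hypotheses (pairC : right_cotorsion_pair n C1 C2).
Hypotheses (pairD : right_cotorsion_pair n D1 D2).
Hypothesis torU : forall i, (1 <= i <= n)%N -> forall X, C1 X -> Tor_zero i U X.
Hypothesis torV : forall i, (1 <= i <= n)%N -> forall Y, D1 Y -> Tor_zero i V Y.
Hypothesis extCV : forall X Y, finite_cores_class C1 n.-1 X ->
  finite_cores_class D1 n.-1 Y -> Ext_zero 1 X (tensor V Y : lmodType A).
Hypothesis extDU : forall Y X, finite_cores_class D1 n.-1 Y ->
  finite_cores_class C1 n.-1 X -> Ext_zero 1 Y (tensor U X : lmodType B).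
Hypothesis U_cores : coresolving (U_class V U C2 D2).
Hypothesis B_ext : extension_closed (finite_cores_class (B_class V U C1 D1) n.-1).

Local Notation Lambda := (morita V U).
Local Notation Ucl := (U_class V U C2 D2).
Local Notation Bcl := (B_class V U C1 D1).

Let torUG K : finite_cores_class C1 n.-1 K -> Tor_zero 1 U K.
Proof.
move=> resK; apply: (Tor_zero_finite_cores C1_class torU resK).
by rewrite add1n prednK.
Qed.

Let torVG L : finite_cores_class D1 n.-1 L -> Tor_zero 1 V L.
Proof.
move=> resL; apply: (Tor_zero_finite_cores D1_class torV resL).
by rewrite add1n prednK.
Qed.

Lemma right_orthogonal (M N : lmodType Lambda) :
  Bcl M -> Ucl N -> ext_extends M N.
Proof.
move=> [T [TM BT]] [S [SN [CS DS]]]; apply: ext_extends_iso TM SN _.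
case: (pairC) (pairD) => _ extC _ [_ extD _].
have one : (1 <= 1 <= n)%N by [].
have [||K [L [r [s [CK DL rs]]]]] := B_free BT.
- by move=> X Y CX DY; apply/Ext_zero_extends/extCV; apply: finite_cores_base.
- by move=> Y X DY CX; apply/Ext_zero_extends/extDU; apply: finite_cores_base.
by apply: (free_extends rs); apply/Ext_zero_extends; [apply: extC|apply: extD].
Qed.

(** An approximation of V (x) L splits, since its cokernel has no Ext^1 into
    V (x) L. *)
Let tensorV_C2 L : finite_cores_class D1 n.-1 L -> C2 (tensor V L).
Proof.
move=> resL; case: (pairC) => sumC _ /(_ (tensor V L)) [Y [K [i [p [ses CY resK]]]]].
have [r rK] := extends_retract (Ext_zero_extends (extCV resK resL)) ses.
exact: summand_retract sumC rK CY.
Qed.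

Lemma right_tensor_tuple_res K : finite_cores_class C1 n.-1 K ->
  finite_cores_class Bcl n.-1 (mt_mod (tensor_tuple V U K)).
Proof.
move=> resK.
apply: (@tensor_tuple_finite_cores _ _ V U C1
  (fun k T => finite_cores_class Bcl k (mt_mod T)) (B_pred C1 D1) n.-1) resK _ => //.
- by move=> X; apply: tensor_tuple_B; apply: D1_class.1.
- move=> k T BT; apply: finite_cores_base; exists T; split=> //.
  exact: isomorphic_refl.
- move=> k S T W j q /tsesP ses BT; apply: finite_cores_cons ses _; exists T.
  by split=> //; apply: isomorphic_refl.
Qed.

Lemma right_tensor_tuple_res_swap L : finite_cores_class D1 n.-1 L ->
  finite_cores_class Bcl n.-1 (mt_mod (tswap (tensor_tuple U V L))).
Proof.
move=> resL.
apply: (@tensor_tuple_finite_cores _ _ U V D1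
  (fun k T => finite_cores_class Bcl k (mt_mod (tswap T)))
  (B_pred D1 C1) n.-1) resL _ => //.
- by move=> X; apply: tensor_tuple_B; apply: C1_class.1.
- move=> k T BT; apply: finite_cores_base; exists (tswap T).
  by split; [apply: isomorphic_refl|apply: B_pred_swap BT].
- move=> k S T W j q [jqX jqY] BT.
  have /tsesP ses : tses (tmor_swap j) (tmor_swap q) by [].
  apply: finite_cores_cons ses _; exists (tswap T).
  by split; [apply: isomorphic_refl|apply: B_pred_swap BT].
Qed.

Lemma right_approximation (M : lmodType Lambda) :
  exists (X K : lmodType Lambda) (i : {linear M -> X}) (p : {linear X -> K}),
    [/\ short_exact i p, Ucl X & finite_cores_class Bcl n.-1 K].
Proof.
have [T [h hB]] := tuple_of_module M; have [h' [hK h'K]] := linear_inverse hB.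
case: (pairC) (pairD) => sumC _ covC [sumD _ covD].
have [K [T1 [j1 [q1 [jq1 resK CT1]]]]] := right_cover T C2_class covC torUG.
have [L [S [j2 [q2 [jq2 resL DS]]]]] :=
  @right_cover _ _ U V _ _ (tswap T1) D2_class covD torVG.
have [T2 [j3 [q3 [jq3 DT2]]]] : exists (T2 : mtuple V U)
    (j3 : tmor T1 T2) (q3 : tmor T2 (tswap (tensor_tuple U V L))),
    tses j3 q3 /\ D2 (mt_Y T2).
  by exists (tswap S), (tmor_swapl j2), (tmor_swap q2); case: jq2.
have CT2 : C2 (mt_X T2).
  have extC2 : extension_closed C2.
    exact: (tses_extension_closed D2_class (U_class_tses C2_class D2_class U_cores.1)).
  by case: jq3 => sesX _; apply: extC2 sesX CT1 _; apply: tensorV_C2.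
have ses1 : short_exact (lin (tlin j1 \o h')) (tlin q1).
  have /tsesP [jI ex qS] := jq1; split=> // [m m' jm|z].
    by apply: (can_inj h'K); apply: jI.
  rewrite ex; split=> [[x <-]|[m <-]]; last by exists (h' m).
  by exists (h x); rewrite -[LHS]/(tlin j1 (h' (h x))) hK.
have ses2 : short_exact (tlin j3) (tlin q3) by apply/tsesP.
have [i [p ses]] := cokernel_comp_ses ses1 ses2.
exists (mt_mod T2), (cokermod (lin (tlin j3 \o lin (tlin j1 \o h')))),
  (lin (tlin j3 \o lin (tlin j1 \o h'))), (cokerl _).
split; last first.
- apply: B_ext ses _ _; first exact: right_tensor_tuple_res.
  exact: right_tensor_tuple_res_swap.
- by apply/U_classP.
apply: cokerl_ses => m m' jm; case: ses1 => + _ _; apply.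
by case: ses2 => + _ _; apply.
Qed.

Lemma right_Ext_zero i : Ext_zero_cc i.+1 Bcl Ucl.
Proof.
move=> M N BM UN; apply: coresolving_Ext_zero UN; first exact: U_cores.2.
  move=> N'; have [D [K [j [q [[jI _ _] UD _]]]]] := right_approximation N'.
  by exists D, j.
by move=> N' UN'; apply: right_orthogonal.
Qed.

Theorem right_hereditary_pair : hereditary_right_cotorsion_pair n Bcl Ucl.
Proof.
split; last exact: right_Ext_zero.
split; last exact: right_approximation.
  by case: (pairC) (pairD) => sumC _ _ [sumD _ _]; apply: U_class_summand.
by move=> [//|i] _; apply: right_Ext_zero.
Qed.

End RightPair.

Theorem proposition4p11 (A B : pzRingType)
    (V : bimodule A B) (U : bimodule B A) (n : nat)
    (C1 C2 : modclass A) (D1 D2 : modclass B)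
    (n_ge1 : (1 <= n)%N)
    (C1_class : is_class C1) (C2_class : is_class C2)
    (D1_class : is_class D1) (D2_class : is_class D2) :
  (left_cotorsion_pair n C1 C2 ->
   left_cotorsion_pair n D1 D2 ->
   (forall i, (1 <= i <= n)%N -> forall X, C2 X -> Ext_zero i V X) ->
   (forall i, (1 <= i <= n)%N -> forall Y, D2 Y -> Ext_zero i U Y) ->
   (forall Y X, finite_res_class D2 n.-1 Y -> finite_res_class C2 n.-1 X ->
      Ext_zero 1 (bimHom U Y : lmodType A) X) ->
   (forall X Y, finite_res_class C2 n.-1 X -> finite_res_class D2 n.-1 Y ->
      Ext_zero 1 (bimHom V X : lmodType B) Y) ->
   resolving (U_class V U C1 D1) ->
   extension_closed (finite_res_class (J_class V U C2 D2) n.-1) ->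
   hereditary_left_cotorsion_pair n (U_class V U C1 D1) (J_class V U C2 D2))
  /\
  (right_cotorsion_pair n C1 C2 ->
   right_cotorsion_pair n D1 D2 ->
   (forall i, (1 <= i <= n)%N -> forall X, C1 X -> Tor_zero i U X) ->
   (forall i, (1 <= i <= n)%N -> forall Y, D1 Y -> Tor_zero i V Y) ->
   (forall X Y, finite_cores_class C1 n.-1 X -> finite_cores_class D1 n.-1 Y ->
      Ext_zero 1 X (tensor V Y : lmodType A)) ->
   (forall Y X, finite_cores_class D1 n.-1 Y -> finite_cores_class C1 n.-1 X ->
      Ext_zero 1 Y (tensor U X : lmodType B)) ->
   coresolving (U_class V U C2 D2) ->
   extension_closed (finite_cores_class (B_class V U C1 D1) n.-1) ->
   hereditary_right_cotorsion_pair n (B_class V U C1 D1) (U_class V U C2 D2)).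
Proof.
split.
  move=> pairC pairD extV extU extUD extVC U_res J_ext.
  exact: (left_hereditary_pair n_ge1).
move=> pairC pairD torU torV extCV extDU U_cores B_ext.
exact: (right_hereditary_pair n_ge1).
Qed.
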